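(* Let $u\in H^3(\Omega)$ be the exact solution of $-\nabla\cdot(A\nabla u)=f$ in $\Omega=(0,1)^3$, $u=g$ on $\partial\Omega$. On each cubic element $T=[x_{i-1},x_i]\times[y_{j-1},y_j]\times[z_{s-1},z_s]\in\mathcal{T}_h$ define $w_b\in V_b$ by $$w_b|_{F_p}=\tfrac1{12}\rho^{-1}h^{-1}\Big(\rho h^{-1}\big(|e_y|^2Q_bu_{yy}|_{F_p}+|e_z|^2Q_bu_{zz}|_{F_p}\big)-6\big(|e_y|Q_bq_{2y}|_{F_p}+|e_z|Q_bq_{3z}|_{F_p}\big)\Big),\quad p=1,2,$$ $$w_b|_{F_p}=\tfrac1{12}\rho^{-1}h^{-1}\Big(\rho h^{-1}\big(|e_x|^2Q_bu_{xx}|_{F_p}+|e_z|^2Q_bu_{zz}|_{F_p}\big)-6\big(|e_x|Q_bq_{1x}|_{F_p}+|e_z|Q_bq_{3z}|_{F_p}\big)\Big),\quad p=3,4,$$ $$w_b|_{F_p}=\tfrac1{12}\rho^{-1}h^{-1}\Big(\rho h^{-1}\big(|e_y|^2Q_bu_{yy}|_{F_p}+|e_x|^2Q_bu_{xx}|_{F_p}\big)-6\big(|e_y|Q_bq_{2y}|_{F_p}+|e_x|Q_bq_{1x}|_{F_p}\big)\Big),\quad p=5,6.$$ Let $u_b\in V_b$ be the solution of the simplified weak Galerkin scheme $$(A\nabla_du_b,\nabla_dv_b)_h+\rho h^{-1}\sum_{T\in\mathcal{T}_h}\langle Q_b\mathcal{S}(u_b)-u_b,\,Q_b\mathcal{S}(v_b)-v_b\rangle_{\partial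 T}=(f,\mathcal{S}(v_b)),\qquad\forall v_b\in V_b^0,$$ with boundary values $u_b=Q_bg+h^2w_b$ on $\partial\Omega$. Let $\widetilde{e_b}=(Q_bu-u_b)+h^2w_b$ be the modified error function. Then $$\Big(\sum_{T\in\mathcal{T}_h}\|\nabla_d\widetilde{e_b}\|_T^2\Big)^{1/2}+|||\mathcal{S}(\widetilde{e_b})-\widetilde{e_b}|||_{\mathcal{E}_h}\le Ch^2\|u\|_3,$$ with a constant $C$ independent of $h$ and $u$.
   Context: Mesh. $\Omega=(0,1)^3$ is partitioned into axis-parallel boxes (''cubic elements'') $T=[x_{i-1},x_i]\times[y_{j-1},y_j]\times[z_{s-1},z_s]$ by the Cartesian product $\mathcal{T}_h=\Delta_x\times\Delta_y\times\Delta_z$ of partitions $0=x_0<\dots<x_n=1$, $0=y_0<\dots<y_m=1$, $0=z_0<\dots<z_q=1$ (possibly non-uniform); the partition is shape regular (the ratios of edge lengths of elements are uniformly bounded). $h_T$ is the size (diameter) of $T$ and $h=\max_T h_T$. $|e_x|,|e_y|,|e_z|$ are the edge lengths of $T$ in the $x$-, $y$-, $z$-directions. $F_1,F_2$ are the faces of $T$ at $x=x_{i-1},x_i$; $F_3,F_4$ those at $y=y_{j-1},y_j$; $F_5,F_6$ those at $z=z_{s-1},z_s$. $\mathbf{n}$ is the unit outward normal to $\partial T$. $\rho>0$ is a fixed stabilization parameter. Coefficient and flux. $A=\{a_{ij}\}_{3\times3}$ is uniformly bounded, symmetric, positive definite on $\Omega$, and assumed piecewise constant with respect to $\mathcal{T}_h$.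 $\mathbf{q}=A\nabla u=(q_1,q_2,q_3)'$, $q_{1x}=\partial q_1/\partial x$, $q_{2y}=\partial q_2/\partial y$, $q_{3z}=\partial q_3/\partial z$. Spaces and operators. $V_b$ is the space of functions on the union of all faces of $\mathcal{T}_h$ that are constant on each face (single-valued on interior faces), and $V_b^0=\{v_b\in V_b: v_b|_{\partial\Omega}=0\}$. For $v_b\in V_b$, the discrete weak gradient $\nabla_dv_b$ is the piecewise constant vector field with $(\nabla_dv_b,\boldsymbol\psi)_T=\langle v_b,\boldsymbol\psi\cdot\mathbf{n}\rangle_{\partial T}$ for all $\boldsymbol\psi\in[P_0(T)]^3$, on each $T$; $(A\nabla_du_b,\nabla_dv_b)_h=\sum_T(A\nabla_du_b,\nabla_dv_b)_T$. $Q_b$ is the $L^2$ projection onto constants on each face (the face average). On each $T$, $\mathcal{S}(v_b)\in P_1(T)$ is defined by $\langle\mathcal{S}(v_b),Q_b\psi\rangle_{\partial T}=\langle v_b,\psi\rangle_{\partial T}$ for all $\psi\in P_1(T)$. Norms. $\|\cdot\|_T$ is the $L^2(T)$ norm, $\|\cdot\|_3$ is the $H^3(\Omega)$ norm, and $|||\mathcal{S}(v_b)-v_b|||_{\mathcal{E}_h}^2=\rho h^{-1}\sum_{T\in\mathcal{T}_h}\langle Q_b\mathcal{S}(v_b)-v_b,Q_b\mathcal{S}(v_b)-v_b\rangle_{\partial T}$. $C$ may depend on $A$, $\rho$ and the shape regularity. *)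

(* Defs.v *)
From HB Require Import structures.
From mathcomp Require Import all_boot all_order all_algebra.
From mathcomp Require Import all_classical all_reals all_analysis.

Set Implicit Arguments.
Unset Strict Implicit.
Unset Printing Implicit Defensive.

Import Order.TTheory GRing.Theory Num.Theory.
Import numFieldNormedType.Exports.

Local Open Scope classical_set_scope.
Local Open Scope ring_scope.

Notation leb2 R := (@lebesgue_measure R \x @lebesgue_measure R)%E.
Notation leb3 R :=
  (@lebesgue_measure R \x @lebesgue_measure R \x @lebesgue_measure R)%E.

(* The x-, y- and z-axes are numbered 0, 1, 2 : 'I_3.  On a box B, the pair
   (d, b) with d : 'I_3 and b : bool names the face orthogonal to axis d, the
   lower one if b = false and the upper one if b = true; so (0, _), (1, _),
   (2, _) are F_1 and F_2, F_3 and F_4, F_5 and F_6. *)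

Definition mkpt (R : realType) (x : 'I_3 -> R) : R * R * R := (x 0, x 1, x 2).

Definition co (R : realType) (p : R * R * R) (i : 'I_3) : R :=
  [:: p.1.1; p.1.2; p.2]`_i.

Definition axis (R : realType) (i : 'I_3) : R * R * R :=
  mkpt (fun j => (i == j)%:R).

Definition dot (R : realType) (a c : 'cV[R]_3) : R := \sum_i a i 0 * c i 0.

Record box (R : realType) := Box { lo : 'I_3 -> R; hi : 'I_3 -> R }.

Definition inbox (R : realType) (B : box R) : set (R * R * R) :=
  [set p | forall i, lo B i < co p i < hi B i].

Definition cube (R : realType) : box R := Box (fun=> 0) (fun=> 1).

Definition Omega (R : realType) : set (R * R * R) := inbox (cube R).

Definition len (R : realType) (B : box R) (i : 'I_3) : R := hi B i - lo B i.

Definition diam (R : realType) (B : box R) : R :=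
  Num.sqrt (\sum_i len B i ^+ 2).

Definition level (R : realType) (B : box R) (d : 'I_3) (b : bool) : R :=
  if b then hi B d else lo B d.

Definition nsign (R : realType) (b : bool) : R := if b then 1 else -1.

Definition normal (R : realType) (d : 'I_3) (b : bool) : 'cV[R]_3 :=
  nsign R b *: delta_mx d 0.

(* A face (d, b) is parametrized by the two coordinates other than d, taken in
   increasing order: these are lift d 0 and lift d 1. *)
Definition facept (R : realType) (B : box R) (d : 'I_3) (b : bool) (y : R * R) :
    R * R * R :=
  mkpt (fun k => if unlift d k is Some j then (if j == ord0 then y.1 else y.2)
                 else level B d b).

Definition facedom (R : realType) (B : box R) (d : 'I_3) : set (R * R) :=
  let d1 := lift d (ord0 : 'I_2) in let d2 := lift d (ord_max : 'I_2) in
  [set y | lo B d1 < y.1 < hi B d1 /\ lo B d2 < y.2 < hi B d2].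

Definition fint (R : realType) (B : box R) (d : 'I_3) (b : bool)
    (g : R * R * R -> R) : R :=
  \int[leb2 R]_(y in facedom B d) g (facept B d b y).

Definition bint (R : realType) (B : box R)
    (g : 'I_3 -> bool -> R * R * R -> R) : R :=
  \sum_(d < 3) \sum_(b : bool) fint B d b (g d b).

Definition fmean (R : realType) (B : box R) (d : 'I_3) (b : bool)
    (g : R * R * R -> R) : R :=
  fint B d b g / fint B d b (fun=> 1).

Definition L2 (R : realType) (D : set (R * R * R)) (f : R * R * R -> R) : Prop :=
  measurable_fun D f /\ (leb3 R).-integrable D (fun p => (f p ^+ 2)%:E).

Definition L2face (R : realType) (B : box R) (d : 'I_3) (b : bool)
    (g : R * R * R -> R) : Prop :=
  measurable_fun (facedom B d) (g \o facept B d b) /\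
  (leb2 R).-integrable (facedom B d) (fun y => (g (facept B d b y) ^+ 2)%:E).

(* Iterated partial derivative along a list of axes, e.g. [:: 0; 2] for
   d_x d_z. *)
Definition pderiv (R : realType) (s : seq 'I_3) (f : R * R * R -> R) :
    R * R * R -> R :=
  foldr (fun i (g : R * R * R -> R) => 'D_(axis R i) g) f s.

Definition smooth (R : realType) (f : R * R * R -> R) : Prop :=
  forall s, continuous (pderiv s f) /\
            forall i p, derivable (pderiv s f) p (axis R i).

Definition test_fun (R : realType) (D : set (R * R * R)) (phi : R * R * R -> R) :
    Prop :=
  smooth phi /\
  exists K : set (R * R * R),
    [/\ compact K, K `<=` D & forall p, ~ K p -> phi p = 0].

Definition is_wderiv (R : realType) (D : set (R * R * R)) (s : seq 'I_3)
    (u v : R * R * R -> R) : Prop :=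
  L2 D v /\
  forall phi, test_fun D phi ->
    \int[leb3 R]_(p in D) (u p * pderiv s phi p) =
    (-1) ^+ size s * \int[leb3 R]_(p in D) (v p * phi p).

(* The weak derivative of u on D: a representative of its almost everywhere
   class, when there is one. *)
Definition wderiv (R : realType) (D : set (R * R * R)) (s : seq 'I_3)
    (u : R * R * R -> R) : R * R * R -> R :=
  xget (fun=> 0) [set v | is_wderiv D s u v].

Definition sobolev (R : realType) (k : nat) (u : R * R * R -> R) : Prop :=
  L2 (@Omega R) u /\
  forall s, (size s <= k)%N -> exists v, is_wderiv (@Omega R) s u v.

(* Nondecreasing j-tuples of axes are the multi-indices of order j. *)
Definition sobolev_norm (R : realType) (k : nat) (u : R * R * R -> R) : R :=
  Num.sqrt (\sum_(j < k.+1)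
    \sum_(t : j.-tuple 'I_3 | sorted (fun i1 i2 : 'I_3 => (i1 <= i2)%N) t)
      \int[leb3 R]_(p in @Omega R) (wderiv (@Omega R) t u p ^+ 2)).

(* g is the trace on the face (d, b) of a function v in H^1(B).  The trace is
   specified by Green's formula
     (v, d_d phi)_B + (d_d v, phi)_B = <g, phi n_d>_{face (d, b)}
   for smooth phi vanishing on the plane of the opposite face; this determines
   g almost everywhere on the face. *)
Definition is_trace (R : realType) (B : box R) (d : 'I_3) (b : bool)
    (v g : R * R * R -> R) : Prop :=
  L2face B d b g /\
  exists2 dv, is_wderiv (inbox B) [:: d] v dv &
    forall phi, smooth phi -> (forall p, co p d = level B d (~~ b) -> phi p = 0) ->
      \int[leb3 R]_(p in inbox B) (v p * pderiv [:: d] phi p + dv p * phi p) =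
      nsign R b * fint B d b (fun p => g p * phi p).

Definition trace (R : realType) (B : box R) (d : 'I_3) (b : bool)
    (v : R * R * R -> R) : R * R * R -> R :=
  xget (fun=> 0) [set g | is_trace B d b v g].

Definition Qface (R : realType) (B : box R) (d : 'I_3) (b : bool)
    (v : R * R * R -> R) : R :=
  fmean B d b (trace B d b v).

(* Tensor product partitions of Omega; node i 0 < ... < node i (ncell i) is the
   partition of (0, 1) along axis i. *)
Record mesh (R : realType) := Mesh {
  ncell : 'I_3 -> nat;
  node : 'I_3 -> nat -> R;
  node_first : forall i, node i 0%N = 0;
  node_last : forall i, node i (ncell i) = 1;
  node_incr : forall i k, (k < ncell i)%N -> node i k < node i k.+1 }.

Section Mesh.
Variables (R : realType) (M : mesh R).

Definition cell : finType := {dffun forall i : 'I_3, 'I_(ncell M i)}.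

Definition cbox (T : cell) : box R :=
  Box (fun i => node M i (T i)) (fun i => node M i (T i).+1).

(* A face of the mesh is an axis d with the index of a node along d and the
   index of an interval along each of the two other axes. *)
Definition face_index (d : 'I_3) : finType :=
  {dffun forall i : 'I_3, 'I_(ncell M i + (i == d))}.

Definition face : finType := {d : 'I_3 & face_index d}.

Lemma lface_subproof (T : cell) (d : 'I_3) (b : bool) (i : 'I_3) :
  (T i + (b && (i == d)) < ncell M i + (i == d))%N.
Proof.
have := ltn_ord (T i); case: (i == d); rewrite ?andbT ?andbF ?addn0 //.
by case: b => h; rewrite ?addn0 !addn1 // ltnS ltnW.
Qed.

(* The global index of the face (d, b) of the element T. *)
Definition lface (T : cell) (d : 'I_3) (b : bool) : face :=
  Tagged face_index
    ([ffun i => Ordinal (lface_subproof T d b i)] : face_index d).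

Definition boundary (F : face) : bool :=
  let k : nat := tagged F (tag F) in
  (k == 0%N) || (k == ncell M (tag F)).

Definition Vb : Type := face -> R.

Definition Vb0 (v : Vb) : Prop := forall F, boundary F -> v F = 0.

Definition meshsize : R := \big[Num.max/0]_(T : cell) diam (cbox T).

Definition shape_regular (sigma : R) : Prop :=
  forall (T : cell) i j, len (cbox T) i <= sigma * len (cbox T) j.

(* Q_b v for v in H^1(Omega), the trace being taken from one of the elements
   that have F as a face. *)
Definition Qb (v : R * R * R -> R) : Vb := fun F =>
  if [pick x : cell * bool | lface x.1 (tag F) x.2 == F] is Some x
  then Qface (cbox x.1) (tag F) x.2 v else 0.

Definition is_wgrad (T : cell) (v : Vb) (c : 'cV[R]_3) : Prop :=
  forall psi : 'cV[R]_3,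
    \int[leb3 R]_(p in inbox (cbox T)) dot c psi =
    bint (cbox T) (fun d b _ => v (lface T d b) * dot psi (normal R d b)).

Definition wgrad (T : cell) (v : Vb) : 'cV[R]_3 :=
  xget 0 [set c | is_wgrad T v c].

Definition P1 (s : R * R * R -> R) : Prop :=
  exists (a : R) (c : 'I_3 -> R), forall p, s p = a + \sum_i c i * co p i.

Definition is_ext (T : cell) (v : Vb) (s : R * R * R -> R) : Prop :=
  P1 s /\
  forall psi, P1 psi ->
    bint (cbox T) (fun d b p => s p * fmean (cbox T) d b psi) =
    bint (cbox T) (fun d b p => v (lface T d b) * psi p).

(* The operator S of the scheme, on the element T. *)
Definition ext (T : cell) (v : Vb) : R * R * R -> R :=
  xget (fun=> 0) [set s | is_ext T v s].

(* The sum over T of <Q_b S(u) - u, Q_b S(v) - v> on the boundary of T. *)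
Definition stab (u v : Vb) : R :=
  \sum_(T : cell) bint (cbox T) (fun d b _ =>
    (fmean (cbox T) d b (ext T u) - u (lface T d b)) *
    (fmean (cbox T) d b (ext T v) - v (lface T d b))).

Definition wg_form (A : R * R * R -> 'M[R]_3) (u v : Vb) : R :=
  \sum_(T : cell)
    \int[leb3 R]_(p in inbox (cbox T)) dot (A p *m wgrad T u) (wgrad T v).

Definition load (f : R * R * R -> R) (v : Vb) : R :=
  \sum_(T : cell) \int[leb3 R]_(p in inbox (cbox T)) (f p * ext T v p).

Definition wgrad_norm (v : Vb) : R :=
  Num.sqrt (\sum_(T : cell)
    \int[leb3 R]_(p in inbox (cbox T)) dot (wgrad T v) (wgrad T v)).

Definition stab_norm (rho : R) (v : Vb) : R :=
  Num.sqrt (rho * meshsize^-1 * stab v v).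

Definition piecewise_constant (A : R * R * R -> 'M[R]_3) : Prop :=
  forall (T : cell) p q, inbox (cbox T) p -> inbox (cbox T) q -> A p = A q.

End Mesh.

Definition coefficient (R : realType) (A : R * R * R -> 'M[R]_3) : Prop :=
  [/\ forall i j, measurable_fun (@Omega R) (fun p => A p i j),
      exists K : R, forall p i j, Omega p -> `|A p i j| <= K,
      forall p, Omega p -> (A p)^T = A p
    & forall p (xi : 'cV[R]_3), Omega p -> xi != 0 -> 0 < dot (A p *m xi) xi].

Definition grad (R : realType) (u : R * R * R -> R) (p : R * R * R) : 'cV[R]_3 :=
  \col_i wderiv (@Omega R) [:: i] u p.

Definition flux (R : realType) (A : R * R * R -> 'M[R]_3) (u : R * R * R -> R)
    (k : 'I_3) (p : R * R * R) : R :=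
  (A p *m grad u p) k 0.

(* -div (A grad u) = f in Omega in the sense of distributions, and u = g on the
   boundary in the sense of traces. *)
Definition dirichlet_solution (R : realType) (A : R * R * R -> 'M[R]_3)
    (u f g : R * R * R -> R) : Prop :=
  (forall phi, test_fun (@Omega R) phi ->
     \int[leb3 R]_(p in @Omega R)
       dot (A p *m grad u p) (\col_i pderiv [:: i] phi p) =
     \int[leb3 R]_(p in @Omega R) (f p * phi p)) /\
  (forall d b, is_trace (cube R) d b u g).

(* On a face orthogonal to axis d the sums below run over the two other axes.
   The derivative q_{kx_k} of the flux and its trace are those of the element T,
   A being allowed to jump across faces. *)
Definition is_correction (R : realType) (M : mesh R) (rho : R)
    (A : R * R * R -> 'M[R]_3) (u : R * R * R -> R) (w : Vb M) : Prop :=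
  let h := meshsize M in
  forall (T : cell M) (d : 'I_3) (b : bool),
    let B := cbox T in
    w (lface T d b) =
      12^-1 * rho^-1 * h^-1 *
      (rho * h^-1 *
         (\sum_(k < 3 | k != d)
            len B k ^+ 2 * Qface B d b (wderiv (@Omega R) [:: k; k] u))
       - 6 * (\sum_(k < 3 | k != d)
                len B k * Qface B d b (wderiv (inbox B) [:: k] (flux A u k)))).

Definition is_wg_solution (R : realType) (M : mesh R) (rho : R)
    (A : R * R * R -> 'M[R]_3) (f g : R * R * R -> R) (w u : Vb M) : Prop :=
  let h := meshsize M in
  (forall v : Vb M, Vb0 v ->
     wg_form A u v + rho * h^-1 * stab u v = load f v) /\
  (forall (T : cell M) d b, boundary (lface T d b) ->
     u (lface T d b) = fmean (cbox T) d b g + h ^+ 2 * w (lface T d b)).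

(* Main.v *)
Require Import Defs.
From HB Require Import structures.
From mathcomp Require Import all_boot all_order all_algebra.
From mathcomp Require Import all_classical all_reals all_analysis.
From mathcomp Require Import measurable_realfun ring lra.

(** The theorem is an energy estimate for e = Q_b u - u_b + h^2 w, a discrete
    function that vanishes on the boundary of the cube ([error_boundary]).  The
    correction w is designed to cancel the consistency terms of first order.

    On one element the discrete operators are explicit.  The weak gradient of v
    is the vector [dgrad] of difference quotients between opposite faces
    ([wgrad_eq]); S(v) is the affine function with that gradient whose value at
    the center is the area-weighted mean [bmean] of the face values
    ([ext_affine]); hence Q_b S(v) - v takes one value, [defect] d, on both faces
    orthogonal to the axis d, and the area-weighted sum of the three defects is 0
    ([sum_defect]).

    Let q = A grad u.  On each element f = - div q, and the normal component of q
    has the same face averages on both sides of a face ([flux_adj]).  Since e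
    vanishes on the boundary, the fluxes of q weighted by the face values of e
    sum up to 0, and the load (f, S(e)) becomes a sum over elements of averages
    of q and of first moments of its derivatives ([load_formula]).  Compared with
    (A grad_d Q_b u, grad_d e), this leaves three consistency terms
    ([energy_identity]): the defects of e against the averages of the
    d_k q_k, the gradient of e against first moments of the d_k q_k and against
    h^2 grad_d w, and the stabilizer of Q_b u + h^2 w against e.  The second one
    is O(h^2) by integration by parts.  The first and the third one are only O(h)
    for w = 0, but with the correction their sum is, up to O(h^2), the pairing of
    the defects of e with a quantity that does not depend on the axis, which
    [sum_defect] kills ([elt_cancel]).  Young's inequality then absorbs e in the
    energy ([elt_bound]).

    The constant is uniform for two reasons.  A shape regular tensor product mesh
    is quasi-uniform, because edges of distant elements meet in a common element
    ([meshsize_quasi]).  And A is uniformly elliptic, although it is only assumed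
    to be positive definite pointwise, because the elements of one mesh on which
    it is piecewise constant give finitely many values and every element of
    another such mesh meets one of them ([uniform_ellipticity]).

    What remains is the theory of weak derivatives and traces on boxes.
    Multiplying by cut-off functions extends the definition of a weak derivative
    to smooth functions that vanish on two opposite faces only ([green0]).  With
    Fubini's theorem this gives the existence of traces ([trace_exists]) and a
    formula for their face integrals that involves integrals over the box only
    ([fint_trace]).  All face averages are treated through that formula: they
    agree on both sides of a face ([trace_int_adjacent]), they agree with the
    Dirichlet data on the boundary ([boundary_trace]), and integrations by parts
    against polynomials expand them with remainders bounded by third derivatives
    of u. *)

Set Implicit Arguments.
Unset Strict Implicit.
Unset Printing Implicit Defensive.

Import Order.TTheory GRing.Theory Num.Theory.
Import numFieldNormedType.Exports.

Local Open Scope classical_set_scope.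
Local Open Scope ring_scope.

(** * Smooth functions of one variable *)

(** Infinite differentiability is a coinductive property. It is encoded by a
    class [P] that contains [f] and is closed under differentiation, so that a
    proof of smoothness consists in exhibiting such a class. *)
Definition smooth1 (R : realType) (f : R -> R) : Prop :=
  exists P : (R -> R) -> Prop, P f /\
    forall g, P g -> exists g', (forall x : R, is_derive x 1 g (g' x)) /\ P g'.

Lemma smooth1_derive (R : realType) (f : R -> R) : smooth1 f ->
  exists f', (forall x : R, is_derive x 1 f (f' x)) /\ smooth1 f'.
Proof.
move=> [P [Pf PP]]; have [f' [df Pf']] := PP f Pf.
by exists f'; split => //; exists P.
Qed.

(** The class that witnesses the closure properties of [smooth1]: it is closed
    under differentiation by the usual rules, the derivative of an inverse
    being a product of members. *)
Inductive smooth1_closure (R : realType) : (R -> R) -> Prop :=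
| S1base f : smooth1 f -> smooth1_closure f
| S1cst c : smooth1_closure (fun=> c)
| S1add f g : smooth1_closure f -> smooth1_closure g ->
    smooth1_closure (fun x => f x + g x)
| S1mul f g : smooth1_closure f -> smooth1_closure g ->
    smooth1_closure (fun x => f x * g x)
| S1inv f : smooth1 f -> (forall x, f x != 0) -> smooth1_closure (fun x => (f x)^-1)
| S1affine f a b : smooth1 f -> smooth1_closure (fun x => f (a * x + b)).

Lemma smooth1_closureP (R : realType) (f : R -> R) :
  smooth1_closure f -> smooth1 f.
Proof.
move=> Sf; exists (@smooth1_closure R); split=> // {f Sf}.
move=> g; elim=> {g}.
- move=> f /smooth1_derive[f' [df sf']]; exists f'; split=> //.
  exact: S1base.
- by move=> c; exists (fun=> 0); split; [move=> x; exact: is_derive_cst|exact: S1cst].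
- move=> f g _ [f' [df sf]] _ [g' [dg sg]].
  exists (fun x => f' x + g' x); split; last exact: S1add.
  by move=> x; apply: is_deriveD.
- move=> f g cf [f' [df sf]] cg [g' [dg sg]].
  exists (fun x => f x * g' x + g x * f' x); split.
    by move=> x; apply: is_deriveM.
  by apply: S1add; apply: S1mul.
- move=> f sf f0; have [f' [df sf']] := smooth1_derive sf.
  exists (fun x => (-1 * f' x) * ((f x)^-1 * (f x)^-1)); split; last first.
    apply: S1mul; last by apply: S1mul; apply: S1inv.
    by apply: S1mul; [exact: S1cst|exact: S1base].
  move=> x; have := is_deriveV (f0 x) (df x).
  congr (is_derive _ _ _ _); rewrite /GRing.scale/= expr2 invfM; ring.
- move=> f a b sf; have [f' [df sf']] := smooth1_derive sf.
  exists (fun x => f' (a * x + b) * a); split; last first.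
    by apply: S1mul; [exact: S1affine|exact: S1cst].
  move=> x; apply: (@is_derive1_comp _ f (fun x => a * x + b)).
  have h := is_deriveD (is_deriveZ a (is_derive_id x 1)) (is_derive_cst b x 1).
  by apply: is_derive_eq h _; rewrite /GRing.scale/= addr0 mulr1.
Qed.

Section Smooth1Ops.
Variable R : realType.
Implicit Types f g : R -> R.

Lemma smooth1_cst (c : R) : smooth1 (fun _ : R => c).
Proof. by apply: smooth1_closureP; constructor. Qed.

Lemma smooth1D f g : smooth1 f -> smooth1 g -> smooth1 (fun x => f x + g x).
Proof. by move=> sf sg; apply: smooth1_closureP; do 2 constructor. Qed.

Lemma smooth1M f g : smooth1 f -> smooth1 g -> smooth1 (fun x => f x * g x).
Proof. by move=> sf sg; apply: smooth1_closureP; constructor; constructor. Qed.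

Lemma smooth1V f : smooth1 f -> (forall x, f x != 0) ->
  smooth1 (fun x => (f x)^-1).
Proof. by move=> sf sg; apply: smooth1_closureP; constructor. Qed.

Lemma smooth1_affine f a b : smooth1 f -> smooth1 (fun x => f (a * x + b)).
Proof. by move=> sf; apply: smooth1_closureP; constructor. Qed.

Lemma smooth1_id : smooth1 (@id R).
Proof.
exists (fun f => f = id \/ f = (fun=> 1) \/ f = (fun=> 0)); split; first by left.
move=> g [->|[->|->]].
- by exists (fun=> 1); split=> [x|]; [exact: is_derive_id|right; left].
- by exists (fun=> 0); split=> [x|]; [exact: is_derive_cst|right; right].
- by exists (fun=> 0); split=> [x|]; [exact: is_derive_cst|right; right].
Qed.

Lemma smooth1_continuous f : smooth1 f -> continuous f.
Proof.
move=> /smooth1_derive[f' [df _]] x.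
by apply: differentiable_continuous; apply/derivable1_diffP; apply: ex_derive.
Qed.

(** [flat 0] is the classical function exp(-1/x), extended by 0 to x <= 0;
    thanks to the factors x^-k, the derivative of a member of the family is a
    linear combination of members. *)
Definition flat (k : nat) (x : R) : R :=
  if 0 < x then x^-1 ^+ k * expR (- x^-1) else 0.

Lemma expR_ge_pow (n : nat) (y : R) : 0 <= y -> y ^+ n <= n%:R ^+ n * expR y.
Proof.
case: n => [|n] y0; first by rewrite !expr0 mul1r (le_trans _ (expR_ge1Dx y))// lerDl.
have n0 : (n.+1%:R : R) != 0 by rewrite pnatr_eq0.
have -> : expR y = expR (y / n.+1%:R) ^+ n.+1.
  by rewrite -expRM_natl mulrC divfK.
rewrite -exprMn lerXn2r ?nnegrE ?mulr_ge0 ?expR_ge0//.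
have /(ler_wpM2l (ler0n R n.+1)) := expR_ge1Dx (y / n.+1%:R).
rewrite mulrDr mulr1 mulrC divfK//; apply: le_trans.
by rewrite -[X in X <= _]add0r lerD.
Qed.

(** The exponential beats every power. Since [flat k x / x = flat k.+1 x],
    this makes the difference quotients at 0 tend to 0. *)
Lemma flat_le (k : nat) (x : R) : 0 <= x ->
  `|flat k x| <= k.+1%:R ^+ k.+1 * x.
Proof.
rewrite le_eqVlt /flat => /predU1P[<-|x0]; first by rewrite ltxx normr0 mulr0.
rewrite x0 ger0_norm ?mulr_ge0 ?exprn_ge0 ?expR_ge0 ?invr_ge0 ?(ltW x0)//.
have xi : 0 <= x^-1 by rewrite invr_ge0 ltW.
rewrite expRN ler_pdivrMr ?expR_gt0//.
have := expR_ge_pow k.+1 xi.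
rewrite exprS mulrC -ler_pdivlMr ?invr_gt0// invrK => h.
by rewrite -mulrA (mulrC x) mulrA.
Qed.

Lemma is_derive_flat (k : nat) (x : R) :
  is_derive x 1 (flat k) (- k%:R * flat k.+1 x + flat k.+2 x).
Proof.
have [x0|x0|->] := ltgtP x 0.
- rewrite /flat ltNge (ltW x0)/= mulr0 addr0.
  apply: (near_eq_is_derive (f := fun=> 0)).
  near=> y; rewrite ltNge ltW//=; near: y; exact: lt_nbhsl.
- rewrite [flat k.+1 x]/flat [flat k.+2 x]/flat x0.
  have xn0 : x != 0 by rewrite gt_eqF.
  have di : is_derive x 1 (fun y : R => y^-1) (- x ^- 2).
    by have := is_deriveV xn0 (is_derive_id x 1); rewrite /GRing.scale/= mulr1.
  have dk : is_derive x 1 (fun y : R => y^-1 ^+ k) (- k%:R * x^-1 ^+ k.+1).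
    have dX : is_derive (x^-1) 1 (fun y : R => y ^+ k) (k%:R * x^-1 ^+ k.-1).
      have -> : (fun y : R => y ^+ k) = id ^+ k by apply/funext => y; rewrite fctE.
      by have := is_deriveX k (is_derive_id (x^-1) 1); rewrite /GRing.scale/= mulr1.
    have h := is_derive1_comp dX di.
    apply: is_derive_eq h _.
    case: k {dX} => [|k]; first by rewrite oppr0 !mul0r.
    by rewrite /= !exprS expr0; field.
  have de : is_derive x 1 (fun y : R => expR (- y^-1)) (expR (- x^-1) * x ^- 2).
    apply: (is_derive1_comp (f := expR)).
    by have := is_deriveN di; rewrite opprK.
  have dM := is_deriveM dk de.
  have {}dM := near_eq_is_derive (g := flat k) _ dM.
  have -> : - k%:R * (x^-1 ^+ k.+1 * expR (- x^-1)) + x^-1 ^+ k.+2 * expR (- x^-1)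
    = x^-1 ^+ k *: (expR (- x^-1) * x ^- 2) + expR (- x^-1) *: (- k%:R * x^-1 ^+ k.+1).
    by rewrite /GRing.scale/= !exprS; rewrite ?expr0; field.
  apply: dM; near=> y; rewrite /flat; have -> // : 0 < y; near: y; exact: lt_nbhsr.
- have f00 j : flat j 0 = 0 by rewrite /flat ltxx.
  rewrite !f00 mulr0 addr0.
  have cv : h^-1 *: ((flat k \o shift 0) (h *: 1) - flat k 0) @[h --> 0^'] --> (0 : R).
    rewrite f00; apply/cvgr0Pnorm_lt => e e0.
    have K0 : 0 < k.+2%:R ^+ k.+2 + 1 :> R by rewrite ltr_wpDl// exprn_ge0.
    near=> h.
    have hn0 : h != 0 by near: h; exact: nbhs_dnbhs_neq.
    rewrite /= addr0 subr0 /GRing.scale/= mulr1.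
    have -> : h^-1 * flat k h = flat k.+1 h.
      by rewrite /flat; case: ifP => // _; rewrite ?mulr0// exprS mulrA.
    have he : `|h| < e / (k.+2%:R ^+ k.+2 + 1).
      by near: h; apply: dnbhs0_lt; rewrite divr_gt0.
    have [h0|h0] := leP 0 h; last first.
      by rewrite /flat [X in if X then _ else _]ltNge (ltW h0) normr0.
    apply: le_lt_trans (flat_le _ h0) _.
    rewrite ger0_norm// ltr_pdivlMr// in he.
    by apply: le_lt_trans he; rewrite mulrC ler_wpM2l// lerDl.
  by apply: DeriveDef; [apply/cvg_ex; exists 0|apply/cvg_lim].
Unshelve. all: by end_near. Qed.

(** The class is that of the finite linear combinations of the [flat k]. *)
Lemma smooth1_flat : smooth1 (flat 0).
Proof.
pose P (f : R -> R) := exists s : seq (R * nat),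
  f = fun x => \sum_(i <- s) i.1 * flat i.2 x.
exists P; split.
  by exists [:: (1, 0%N)]; apply/funext => x; rewrite big_seq1 mul1r.
move=> _ [s ->].
exists (fun x => \sum_(i <- s) i.1 * (- i.2%:R * flat i.2.+1 x + flat i.2.+2 x)).
split.
  move=> x; elim: s => [|[c k] s IH].
    rewrite big_nil; under [X in is_derive _ _ X _]eq_fun do rewrite big_nil.
    exact: is_derive_cst.
  rewrite big_cons; under [X in is_derive _ _ X _]eq_fun do rewrite big_cons.
  apply: is_deriveD => //=.
  by have := is_deriveZ c (is_derive_flat k x).
exists (flatten [seq [:: (- i.2%:R * i.1, i.2.+1); (i.1, i.2.+2)] | i <- s]).
apply/funext => x; elim: s => [|[c k] s IH]; first by rewrite !big_nil.
by rewrite /= !big_cons/= IH addrA; congr (_ + _); ring.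
Qed.

Lemma flat_gt0 (x : R) : 0 < x -> 0 < flat 0 x.
Proof. by move=> x0; rewrite /flat x0 expr0 mul1r expR_gt0. Qed.

Lemma flat_ge0 (x : R) : 0 <= flat 0 x.
Proof. by rewrite /flat; case: ifP => // _; rewrite expr0 mul1r expR_ge0. Qed.

Lemma flat_eq0 (x : R) : x <= 0 -> flat 0 x = 0.
Proof. by rewrite /flat leNgt => /negbTE ->. Qed.

Definition step (x : R) : R := flat 0 x * (flat 0 x + flat 0 (-1 * x + 1))^-1.

Lemma step_den (x : R) : 0 < flat 0 x + flat 0 (-1 * x + 1).
Proof.
have [x0|x0] := ltP 0 x.
  by rewrite ltr_pwDl ?flat_gt0 ?flat_ge0.
by rewrite ltr_wpDl ?flat_ge0// flat_gt0//; lra.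
Qed.

Lemma smooth1_step : smooth1 step.
Proof.
apply: smooth1M; first exact: smooth1_flat.
apply: smooth1V; last by move=> x; rewrite gt_eqF// step_den.
by apply: smooth1D; [|apply: smooth1_affine]; exact: smooth1_flat.
Qed.

Lemma step0 (x : R) : x <= 0 -> step x = 0.
Proof. by move=> x0; rewrite /step flat_eq0// mul0r. Qed.

Lemma step1 (x : R) : 1 <= x -> step x = 1.
Proof.
move=> x1; rewrite /step (@flat_eq0 (-1 * x + 1)); last by lra.
by rewrite addr0 divff// gt_eqF// flat_gt0//; lra.
Qed.

Lemma step_ge0 (x : R) : 0 <= step x.
Proof. by rewrite mulr_ge0 ?flat_ge0// invr_ge0 ltW// step_den. Qed.

Lemma step_le1 (x : R) : step x <= 1.
Proof. by rewrite ler_pdivrMr ?step_den// mul1r lerDl flat_ge0. Qed.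

End Smooth1Ops.

(** * Smooth functions of three variables *)

Section Space.
Variable R : realType.
Notation pt := (R * R * R)%type.
Implicit Types (p q : pt) (i j k d : 'I_3) (f g : pt -> R).

Lemma ord3P i : [\/ i = 0, i = 1 | i = 2].
Proof.
by case: i => -[|[|[|//]]] lti; [constructor 1|constructor 2|constructor 3];
  exact: val_inj.
Qed.

Lemma co_mkpt (x : 'I_3 -> R) i : co (mkpt x) i = x i.
Proof. by case: (ord3P i) => ->. Qed.

Lemma mkpt_co p : mkpt (co p) = p.
Proof. by case: p => -[]. Qed.

Lemma pt_ext p q : (forall i, co p i = co q i) -> p = q.
Proof. by move=> h; rewrite -(mkpt_co p) -(mkpt_co q); congr mkpt; apply/funext. Qed.

Lemma co_axis i j : co (axis R i) j = (i == j)%:R.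
Proof. by rewrite /axis co_mkpt. Qed.

Lemma co_line p i (t : R) j : co (t *: axis R i + p) j = t * (i == j)%:R + co p j.
Proof. by rewrite -co_axis; case: p => -[x y] z; case: (ord3P j) => ->. Qed.

Definition setco p i (t : R) : pt := mkpt (fun k => if k == i then t else co p k).

Lemma co_setco p i t k : co (setco p i t) k = if k == i then t else co p k.
Proof. by rewrite /setco co_mkpt. Qed.

Lemma setco_id p i : setco p i (co p i) = p.
Proof. by apply: pt_ext => k; rewrite co_setco; case: eqP => // ->. Qed.

Lemma setcoK p i s t : setco (setco p i s) i t = setco p i t.
Proof. by apply: pt_ext => k; rewrite !co_setco; case: eqP. Qed.

Lemma setcoC p i j s t : i != j ->
  setco (setco p i s) j t = setco (setco p j t) i s.
Proof.
move=> ij; apply: pt_ext => k; rewrite !co_setco.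
by case: eqP => // ->; rewrite eq_sym (negbTE ij).
Qed.

Lemma continuous_co i : continuous (fun p : pt => co p i).
Proof.
case: (ord3P i) => -> p.
- by apply: (@continuous_comp _ _ _ fst fst); exact: cvg_fst.
- by apply: (@continuous_comp _ _ _ fst snd); [exact: cvg_fst|exact: cvg_snd].
- exact: cvg_snd.
Qed.

Lemma continuous_mkpt (T : topologicalType) (F : T -> 'I_3 -> R) :
  (forall i, continuous (F ^~ i)) -> continuous (fun t => mkpt (F t)).
Proof.
move=> cF t; suff : (F x 0, F x 1, F x 2) @[x --> t] --> (F t 0, F t 1, F t 2) by [].
by apply: (cvg_pair (G := nbhs (F t 0, F t 1)) (H := nbhs (F t 2))); [apply: (cvg_pair (G := nbhs (F t 0)) (H := nbhs (F t 1)))|]; exact: cF.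
Qed.

Lemma continuous_setco i t : continuous (fun p => setco p i t).
Proof.
apply: continuous_mkpt => k; case: eqP => _; last exact: continuous_co.
by move=> p; exact: cvg_cst.
Qed.

(** Partial derivatives are read on lines, where the one-variable mean value
    theorem and chain rule apply. *)
Lemma line_quotient f p i :
  (fun h : R => h^-1 *: ((f \o shift p) (h *: axis R i) - f p)) =
  (fun h : R => h^-1 *: (((fun t => f (setco p i t)) \o shift (co p i)) (h *: 1)
                           - f (setco p i (co p i)))).
Proof.
apply/funext => h /=; rewrite setco_id; congr (_ *: (f _ - _)).
apply: pt_ext => k; rewrite co_line co_setco /GRing.scale/= mulr1 eq_sym.
by case: eqP => [->|_]; rewrite ?mulr1// mulr0 add0r.
Qed.

Lemma derivable_line f p i :
  derivable f p (axis R i) = derivable (fun t => f (setco p i t)) (co p i) 1.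
Proof. by rewrite /derivable line_quotient. Qed.

Lemma derive_line f p i :
  'D_(axis R i) f p = 'D_1 (fun t => f (setco p i t)) (co p i).
Proof. by rewrite /derive line_quotient. Qed.

Lemma is_derive_line f p i df :
  is_derive (co p i) 1 (fun t => f (setco p i t)) df ->
  derivable f p (axis R i) /\ 'D_(axis R i) f p = df.
Proof.
by move=> h; rewrite derivable_line derive_line; split; [exact: ex_derive|exact: derive_val].
Qed.

(** The three-variable analogue of the encoding of [smooth1]. *)
Lemma smooth_coind (P : (pt -> R) -> Prop) :
  (forall f, P f -> continuous f /\
     forall i, (forall p, derivable f p (axis R i)) /\ P ('D_(axis R i) f)) ->
  forall f, P f -> smooth f.
Proof.
move=> H f Pf s; have Ps : P (pderiv s f).
  by elim: s => //= i s /H[_ /(_ i)[]].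
by have [c d] := H _ Ps; split=> // i p; have [] := d i.
Qed.

Lemma smooth_pderiv s f : smooth f -> smooth (pderiv s f).
Proof.
move=> sf t; have := sf (t ++ s); rewrite /pderiv foldr_cat => -[c d]; split=> //.
Qed.

Lemma smooth_D i f : smooth f -> smooth ('D_(axis R i) f).
Proof. exact: (@smooth_pderiv [:: i]). Qed.

Lemma smooth_continuous f : smooth f -> continuous f.
Proof. by move=> /(_ [::])[]. Qed.

Lemma smooth_derivable f : smooth f -> forall i p, derivable f p (axis R i).
Proof. by move=> /(_ [::])[]. Qed.

Lemma smooth_is_derive f p i (t : R) : smooth f ->
  is_derive t 1 (fun t => f (setco p i t)) ('D_(axis R i) f (setco p i t)).
Proof.
move=> sf; have /= := @smooth_derivable _ sf i (setco p i t).
rewrite derivable_line derive_line co_setco eqxx.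
have -> : (fun u => f (setco (setco p i t) i u)) = (fun u => f (setco p i u)).
  by apply/funext => u; rewrite setcoK.
by move=> h; apply: DeriveDef.
Qed.

Inductive smooth_closure : (pt -> R) -> Prop :=
| Sbase f : smooth f -> smooth_closure f
| Scoord (F : R -> R) k : smooth1 F -> smooth_closure (fun p => F (co p k))
| Sadd f g : smooth_closure f -> smooth_closure g ->
    smooth_closure (fun p => f p + g p)
| Smul f g : smooth_closure f -> smooth_closure g ->
    smooth_closure (fun p => f p * g p)
| Sset f d c : smooth f -> smooth_closure (fun p => f (setco p d c)).

Lemma Scst (c : R) : smooth_closure (fun=> c).
Proof. exact: (Scoord (F := fun=> c) 0 (smooth1_cst c)). Qed.

Lemma D_coord (F F' : R -> R) k i : (forall x : R, is_derive x 1 F (F' x)) ->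
  (forall p, derivable (fun p => F (co p k)) p (axis R i)) /\
  'D_(axis R i) (fun p => F (co p k)) =
    (fun p => if k == i then F' (co p k) else 0).
Proof.
move=> dF; suff h p : derivable (fun p => F (co p k)) p (axis R i) /\
   'D_(axis R i) (fun p => F (co p k)) p = if k == i then F' (co p k) else 0.
  by split=> [p|]; [case: (h p)|apply/funext => p; case: (h p)].
apply: is_derive_line.
have -> : (fun t => F (co (setco p i t) k)) =
   (fun t => if k == i then F t else F (co p k)).
  by apply/funext => t; rewrite co_setco; case: ifP.
by case: eqP => [->|_]; [exact: dF|exact: is_derive_cst].
Qed.

Lemma D_set f d (c : R) i : smooth f ->
  (forall p, derivable (fun p => f (setco p d c)) p (axis R i)) /\
  'D_(axis R i) (fun p => f (setco p d c)) =
    (fun p => if i == d then 0 else 'D_(axis R i) f (setco p d c)).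
Proof.
move=> sf; suff h p : derivable (fun p => f (setco p d c)) p (axis R i) /\
   'D_(axis R i) (fun p => f (setco p d c)) p =
   if i == d then 0 else 'D_(axis R i) f (setco p d c).
  by split=> [p|]; [case: (h p)|apply/funext => p; case: (h p)].
apply: is_derive_line; case: eqP => [->|/eqP id].
  rewrite [X in is_derive _ _ X _](_ : _ = cst (f (setco p d c))).
    exact: is_derive_cst.
  by apply/funext => t; rewrite setcoK.
rewrite [X in is_derive _ _ X _](_ : _ = fun t => f (setco (setco p d c) i t)).
  have E : setco p d c = setco (setco p d c) i (co p i).
    apply: pt_ext => k; rewrite !co_setco.
    by case: (eqVneq k i) => // ->; rewrite (negbTE id).
  have := smooth_is_derive (setco p d c) i (co p i) sf.
  by rewrite -E.
by apply/funext => t; rewrite setcoC.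
Qed.

Lemma smooth_closureP f : smooth_closure f -> smooth f.
Proof.
apply: smooth_coind => {}f; elim=> {f}.
- move=> f sf; split; first exact: smooth_continuous.
  by move=> i; split; [exact: smooth_derivable|exact/Sbase/smooth_D].
- move=> F k sF; split.
    by move=> p; apply: continuous_comp; [exact: continuous_co|exact: smooth1_continuous].
  move=> i; have [F' [dF sF']] := smooth1_derive sF.
  have [h ->] := D_coord k i dF; split=> //.
  by case: (k == i); [exact: Scoord|exact: Scst].
- move=> f g cf [c1 d1] cg [c2 d2]; split.
    by move=> p; apply: cvgD; [exact: c1|exact: c2].
  move=> i; split=> [p|]; first by apply: derivableD; [case: (d1 i)|case: (d2 i)].
  have -> : 'D_(axis R i) (fun p => f p + g p) =
     (fun p => 'D_(axis R i) f p + 'D_(axis R i) g p).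
    by apply/funext => p; apply: deriveD; [case: (d1 i)|case: (d2 i)].
  by apply: Sadd; [case: (d1 i)|case: (d2 i)].
- move=> f g cf [c1 d1] cg [c2 d2]; split.
    by move=> p; apply: cvgM; [exact: c1|exact: c2].
  move=> i; split=> [p|]; first by apply: derivableM; [case: (d1 i)|case: (d2 i)].
  have -> : 'D_(axis R i) (fun p => f p * g p) =
     (fun p => f p * 'D_(axis R i) g p + g p * 'D_(axis R i) f p).
    by apply/funext => p; apply: deriveM; [case: (d1 i)|case: (d2 i)].
  by apply: Sadd; apply: Smul => //; [case: (d2 i)|case: (d1 i)].
- move=> f d c sf; split.
    move=> p; apply: (@continuous_comp _ _ _ (fun p => setco p d c) f).
      exact: continuous_setco.
    exact: smooth_continuous.
  move=> i; have [h ->] := D_set d c i sf; split=> //.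
  by case: (i == d); [exact: Scst|exact: (Sset d c (smooth_D i sf))].
Qed.

Lemma smooth_cst (c : R) : smooth (fun _ : pt => c).
Proof. exact/smooth_closureP/Scst. Qed.

Lemma smooth_coord (F : R -> R) k : smooth1 F -> smooth (fun p => F (co p k)).
Proof. by move=> sF; exact/smooth_closureP/Scoord. Qed.

Lemma smooth_co k : smooth (fun p => co p k).
Proof. exact: (smooth_coord k (@smooth1_id R)). Qed.

Lemma smoothD f g : smooth f -> smooth g -> smooth (fun p => f p + g p).
Proof. by move=> sf sg; apply/smooth_closureP/Sadd; exact: Sbase. Qed.

Lemma smoothM f g : smooth f -> smooth g -> smooth (fun p => f p * g p).
Proof. by move=> sf sg; apply/smooth_closureP/Smul; exact: Sbase. Qed.

Lemma smooth_setco f d c : smooth f -> smooth (fun p => f (setco p d c)).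
Proof. by move=> sf; apply/smooth_closureP/Sset. Qed.

Lemma smoothN f : smooth f -> smooth (fun p => - f p).
Proof.
move=> sf; have -> : (fun p => - f p) = (fun p => -1 * f p).
  by apply/funext => p; rewrite mulN1r.
by apply: smoothM => //; exact: smooth_cst.
Qed.

Lemma smoothB f g : smooth f -> smooth g -> smooth (fun p => f p - g p).
Proof. by move=> sf sg; exact: (smoothD sf (smoothN sg)). Qed.

Lemma smooth_sum (I : Type) (r : seq I) (F : I -> pt -> R) :
  (forall a, smooth (F a)) -> smooth (fun p => \sum_(a <- r) F a p).
Proof.
move=> sF; elim: r => [|a r IH].
  by under eq_fun do rewrite big_nil; exact: smooth_cst.
by under eq_fun do rewrite big_cons; exact: smoothD.
Qed.

Lemma smooth_prod (I : Type) (r : seq I) (F : I -> pt -> R) :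
  (forall a, smooth (F a)) -> smooth (fun p => \prod_(a <- r) F a p).
Proof.
move=> sF; elim: r => [|a r IH].
  by under eq_fun do rewrite big_nil; exact: smooth_cst.
by under eq_fun do rewrite big_cons; exact: smoothM.
Qed.

Lemma DaxisM i f g p : smooth f -> smooth g ->
  'D_(axis R i) (fun p => f p * g p) p =
  f p * 'D_(axis R i) g p + g p * 'D_(axis R i) f p.
Proof. by move=> sf sg; apply: deriveM; exact: smooth_derivable. Qed.

Lemma DaxisD i f g p : smooth f -> smooth g ->
  'D_(axis R i) (fun p => f p + g p) p = 'D_(axis R i) f p + 'D_(axis R i) g p.
Proof. by move=> sf sg; apply: deriveD; exact: smooth_derivable. Qed.

Lemma MVT_axis f p i (a b : R) : smooth f -> a < b ->
  exists2 c, a < c < b &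
    f (setco p i b) - f (setco p i a) = 'D_(axis R i) f (setco p i c) * (b - a).
Proof.
move=> sf ab; have df t := smooth_is_derive p i t sf.
have [|c cab e] := MVT ab (fun x _ => df x); last by exists c.
by apply: derivable_within_continuous => x _; apply: ex_derive; exact: df.
Qed.

(** The mean value theorem along i for the difference of f along j, followed
    by the one along j. *)
Lemma rectangle f p i j (h : R) : smooth f -> i != j -> 0 < h ->
  exists st, (0 < st.1 < h) && (0 < st.2 < h) /\
   let P s t := setco (setco p i (co p i + s)) j (co p j + t) in
   f (P h h) - f (P h 0) - (f (P 0 h) - f (P 0 0)) =
   'D_(axis R j) ('D_(axis R i) f) (P st.1 st.2) * h * h.
Proof.
move=> sf ij h0.
pose g q := f (setco q j (co p j + h)) - f (setco q j (co p j + 0)).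
have sg : smooth g by apply: smoothB; exact: smooth_setco.
have ltx (x : R) : x + 0 < x + h by rewrite ltrD2l.
have [c /andP[c1 c2] e1] := MVT_axis p i sg (ltx (co p i)).
have Dg q : 'D_(axis R i) g q = 'D_(axis R i) f (setco q j (co p j + h))
   - 'D_(axis R i) f (setco q j (co p j + 0)).
  have [d1 e] := D_set j (co p j + h) i sf; have [d2 e'] := D_set j (co p j + 0) i sf.
  have dB := deriveB (d1 q) (d2 q); move: (congr1 (@^~ q) e) (congr1 (@^~ q) e').
  by rewrite (negbTE ij) => <- <-.
have [b /andP[b1 b2] e2] := MVT_axis (setco p i c) j (smooth_D i sf) (ltx (co p j)).
exists (c - co p i, b - co p j); split=> /=.
  by rewrite addr0 in c1; rewrite addr0 in b1; rewrite !subr_gt0 c1 b1/= !ltrBlDr (addrC h) (addrC h) c2 b2.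
rewrite !subrKC; move: e1; rewrite Dg {1 2}/g e2 => ->.
by congr (_ * _ * _); rewrite addr0 addrC addKr.
Qed.

(** Schwarz's theorem. The second difference of f over a small square is, up
    to the area of the square, a value of either mixed derivative at a point
    of the square; both are continuous. *)
Lemma Daxis_comm f i j : smooth f ->
  'D_(axis R i) ('D_(axis R j) f) = 'D_(axis R j) ('D_(axis R i) f).
Proof.
move=> sf; have [->//|ij] := eqVneq i j; apply/funext => p.
apply/eqP; rewrite -subr_eq0 -normr_le0; apply/ler_addgt0Pr => e e0; rewrite add0r.
pose a := 'D_(axis R i) ('D_(axis R j) f); pose b := 'D_(axis R j) ('D_(axis R i) f).
change (`|a p - b p| <= e).
have ca : continuous a by exact/smooth_continuous/smooth_D/smooth_D.
have cb : continuous b by exact/smooth_continuous/smooth_D/smooth_D.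
have e2 : 0 < e / 2 by rewrite divr_gt0.
have /cvgrPdist_lt/(_ _ e2) na := ca p.
have /cvgrPdist_lt/(_ _ e2) nb := cb p.
have [r r0 hr] : exists2 r : R, 0 < r & forall q, (forall k, `|co p k - co q k| < r) ->
    `|a p - a q| < e / 2 /\ `|b p - b q| < e / 2.
  have /nbhs_ballP[r r0 hr] : nbhs p (fun q => `|a p - a q| < e / 2 /\ `|b p - b q| < e / 2).
    exact: (filterI na nb).
  exists r => // q hq; apply: hr.
  by case: p q hq {na nb} => -[p0 p1] p2 [[q0 q1] q2] hq;
    split; [split|]; rewrite /ball/=; [exact: (hq 0)|exact: (hq 1)|exact: (hq 2)].
have r20 : 0 < r / 2 by rewrite divr_gt0.
have near_p s t : 0 <= s < r -> 0 <= t < r -> forall i j, i != j ->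
    forall k, `|co p k - co (setco (setco p i (co p i + s)) j (co p j + t)) k| < r.
  move=> /andP[s0 sr] /andP[t0 tr] i' j' _ k; rewrite !co_setco.
  case: eqP => [->|_]; first by rewrite opprD addrA subrr add0r normrN ger0_norm.
  case: eqP => [->|_]; first by rewrite opprD addrA subrr add0r normrN ger0_norm.
  by rewrite subrr normr0.
have rr : r / 2 < r by rewrite ltr_pdivrMr// ltr_pMr// ltr1n.
have [[s t] [/= /andP[/andP[s0 s1] /andP[t0 t1]] E1]] := rectangle p sf ij r20.
have ji : j != i by rewrite eq_sym.
have [[t' s'] [/= /andP[/andP[t0' t1'] /andP[s0' s1']] E2]] := rectangle p sf ji r20.
have [_ B1] := hr _ (near_p s t (introT andP (conj (ltW s0) (lt_trans s1 rr)))
   (introT andP (conj (ltW t0) (lt_trans t1 rr))) i j ij).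
have [A1 _] := hr _ (near_p t' s' (introT andP (conj (ltW t0') (lt_trans t1' rr)))
   (introT andP (conj (ltW s0') (lt_trans s1' rr))) j i ji).
have E : a (setco (setco p j (co p j + t')) i (co p i + s')) =
         b (setco (setco p i (co p i + s)) j (co p j + t)).
  have rn : r / 2 != 0 by rewrite gt_eqF.
  apply: (mulIf rn); apply: (mulIf rn); refine (etrans (esym E2) (etrans _ E1)).
  have C u v : setco (setco p j v) i u = setco (setco p i u) j v by rewrite setcoC.
  rewrite !C.
  by move: (f _) (f _) (f _) (f _) => x1 x2 x3 x4; rewrite !opprB !addrA; ring.
have {}B1 : `|b p - a (setco (setco p j (co p j + t')) i (co p i + s'))| < e / 2 by rewrite E.
move: A1 B1; move: (a (setco _ _ _)) => z A1 B1; clear E E1 E2.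
have -> : a p - b p = (a p - z) - (b p - z) by ring.
apply: le_trans (ler_normB _ _) _.
by rewrite (splitr e); exact: (lerD (ltW A1) (ltW B1)).
Qed.

Lemma pderiv_cat s t f : pderiv (s ++ t) f = pderiv s (pderiv t f).
Proof. by rewrite /pderiv foldr_cat. Qed.

(** Thus a weak derivative along a list of axes depends on the multi-index of
    the list only. *)
Lemma pderiv_perm s t f : smooth f -> perm_eq s t -> pderiv s f = pderiv t f.
Proof.
move=> sf; have mid i s1 s2 : pderiv (s1 ++ i :: s2) f = pderiv (i :: s1 ++ s2) f.
  elim: s1 => [//|j s1 IH].
  transitivity ('D_(axis R j) (pderiv (i :: s1 ++ s2) f)); first by rewrite -IH.
  exact: (Daxis_comm j i (smooth_pderiv (s1 ++ s2) sf)).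
elim: s t => [|i s IH] t; first by rewrite perm_sym => /perm_nilP ->.
move=> pst; have it : i \in t by rewrite -(perm_mem pst) mem_head.
case/splitPr: it pst => t1 t2 pst; rewrite mid.
transitivity ('D_(axis R i) (pderiv (t1 ++ t2) f)); last by [].
rewrite -(IH (t1 ++ t2)) //.
move: pst; rewrite perm_sym -cat1s perm_catCA/= perm_cons.
by rewrite perm_sym.
Qed.

End Space.

(** * Integrals over sets of finite measure *)

Section Abstract.
Context d (T : measurableType d) (R : realType) (mu : {measure set T -> \bar R}).
Variable D : set T.
Hypotheses (mD : measurable D) (Dfin : (mu D < +oo)%E).
Implicit Types f p : T -> R.

Lemma cst_integrable (c : R) : mu.-integrable D (EFin \o (fun=> c)).
Proof.
apply/integrableP; split; first by apply/measurable_EFinP; exact: measurable_cst.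
under eq_integral do rewrite /=.
by rewrite integral_cst// lte_mul_pinfty// ?lee_fin//; exact: fin_numP.
Qed.

(** On a set of finite measure, use |f| <= 1 + f^2. *)
Lemma sq_integrable f : measurable_fun D f ->
  mu.-integrable D (fun x => (f x ^+ 2)%:E) -> mu.-integrable D (EFin \o f).
Proof.
move=> mf if2; have i1 := integrableD mD (cst_integrable 1) if2.
apply: (le_integrable mD _ _ i1); first exact/measurable_EFinP.
move=> x Dx /=; rewrite lee_fin [leRHS]ger0_norm ?addr_ge0 ?sqr_ge0//.
rewrite -(real_normK (num_real (f x))); have := normr_ge0 (f x).
by move: `|f x| => a a0; nra.
Qed.

Lemma integrable_bdM f p : mu.-integrable D (EFin \o f) -> forall M : R,
  measurable_fun D p -> (forall x, D x -> `|p x| <= M) ->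
  mu.-integrable D (EFin \o (fun x => f x * p x)).
Proof.
move=> fi M mp pM.
have iMf : mu.-integrable D (fun x => (M%:E * (f x)%:E)%E) by apply: integrableZl.
apply: (le_integrable mD _ _ iMf).
  apply/measurable_EFinP; apply: measurable_funM => //.
  exact/measurable_EFinP/measurable_int/fi.
move=> x Dx /=; rewrite lee_fin !normrM mulrC ler_wpM2r//.
exact: le_trans (pM x Dx) (ler_norm _).
Qed.

(** Dominated convergence, with M |f| as dominating function. *)
Lemma Rintegral_bdd_cvg f (p_ : nat -> T -> R) p (M : R) :
  mu.-integrable D (EFin \o f) ->
  (forall n, measurable_fun D (p_ n)) -> 
  (forall n x, D x -> `|p_ n x| <= M) ->
  (forall x, D x -> p_ ^~ x @ \oo --> p x) ->
  (\int[mu]_(x in D) (f x * p_ n x))%R @[n --> \oo] -->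
  (\int[mu]_(x in D) (f x * p x))%R.
Proof.
move=> fi mp pM pc.
have mf : measurable_fun D f by exact/measurable_EFinP/measurable_int/fi.
have mpl : measurable_fun D p by apply: (measurable_fun_cvg (h := p_)).
have plM x : D x -> `|p x| <= M.
  move=> Dx; apply: (@closed_cvg _ _ \oo _ (fun n => `|p_ n x|) (fun y => y <= M)).
  - by apply: closed_le.
  - by near=> n; exact: pM.
  - by apply: cvg_norm; exact: pc.
have fpi := integrable_bdM fi mpl plM.
have iMf : mu.-integrable D (fun x => (`|M%:E * (f x)%:E|)%E).
  by apply: integrable_abse; apply: integrableZl.
have [] := @dominated_convergence _ _ _ mu D mD (fun n x => (f x * p_ n x)%:E)
  (fun x => (f x * p x)%:E) _ _ _ _ iMf.
- by move=> n; apply/measurable_EFinP; exact: measurable_funM.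
- by apply/measurable_EFinP; exact: measurable_funM.
- apply: aeW => x Dx; apply: cvg_EFin; first by near=> n.
  by apply: cvgM; [exact: cvg_cst|exact: pc].
- apply: aeW => x n Dx; rewrite -EFinM /= lee_fin !normrM mulrC ler_wpM2r//.
  exact: le_trans (pM n x Dx) (ler_norm _).
move=> _ _; rewrite /Rintegral => h; apply: fine_cvg; rewrite fineK//.
exact: integrable_fin_num.
Unshelve. all: by end_near. Qed.

Lemma integrable_lin f g (a b : R) : mu.-integrable D (EFin \o f) -> mu.-integrable D (EFin \o g) ->
  mu.-integrable D (EFin \o (fun x => a * f x + b * g x)).
Proof.
move=> fi gi; apply: (@eq_integrable _ _ _ mu D mD
  ((fun x => (a%:E * (f x)%:E)%E) \+ (fun x => (b%:E * (g x)%:E)%E))%E).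
  by [].
by apply: integrableD => //; apply: integrableZl.
Qed.

Lemma Rintegral_lin f g (a b : R) : mu.-integrable D (EFin \o f) -> mu.-integrable D (EFin \o g) ->
  (\int[mu]_(x in D) (a * f x + b * g x) =
   a * \int[mu]_(x in D) f x + b * \int[mu]_(x in D) g x)%R.
Proof.
move=> fi gi; rewrite RintegralD//.
- by rewrite !RintegralZl.
- exact: (integrableZl mD a fi).
- exact: (integrableZl mD b gi).
Qed.

(** Cauchy-Schwarz against the constant 1: the integral of (f - c)^2 is
    nonnegative for all c, and the best c is the mean of f. *)
Lemma Rintegral_sq_le f : measurable_fun D f ->
  mu.-integrable D (fun x => (f x ^+ 2)%:E) ->
  ((\int[mu]_(x in D) f x)^+2 <= fine (mu D) * \int[mu]_(x in D) (f x ^+ 2))%R.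
Proof.
move=> mf f2; have fi := sq_integrable mf f2.
set I := (\int[mu]_(x in D) f x)%R; set J := (\int[mu]_(x in D) (f x ^+ 2))%R.
have key c : (0 <= J + (- 2 * c) * I + c ^+ 2 * fine (mu D))%R.
  have -> : J + (- 2 * c) * I + c ^+ 2 * fine (mu D)
    = (\int[mu]_(x in D) ((f x - c) ^+ 2))%R.
    have e : (\int[mu]_(x in D) ((f x - c) ^+ 2) =
      \int[mu]_(x in D) (1 * (1 * f x ^+ 2 + (- 2 * c) * f x) + c ^+ 2 * 1))%R.
      by apply: eq_Rintegral => x _; ring.
    rewrite e (Rintegral_lin 1 _ (integrable_lin _ _ f2 fi) (cst_integrable 1)).
    by rewrite (Rintegral_lin _ _ f2 fi) Rintegral_cst// -/I -/J; ring.
  by apply: Rintegral_ge0 => x _; exact: sqr_ge0.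
have m0 : 0 <= fine (mu D) by rewrite fine_ge0.
(* If mu D = 0, the inequality is affine in c, which forces I = 0. *)
have [m00|mn0] := eqVneq (fine (mu D)) 0.
  rewrite m00 mul0r; have [->|I0] := eqVneq I 0; first by rewrite expr0n.
  have := key ((J + 1) / (2 * I)); rewrite m00 mulr0 addr0.
  have -> : J + - 2 * ((J + 1) / (2 * I)) * I = -1 by field.
  by rewrite ler0N1.
have := key (I / fine (mu D)).
have -> : J + - 2 * (I / fine (mu D)) * I + (I / fine (mu D)) ^+ 2 * fine (mu D)
  = (fine (mu D) * J - I ^+ 2) / fine (mu D) by field.
rewrite pmulr_lge0 ?invr_gt0 ?lt_def ?mn0//.
by rewrite subr_ge0.
Qed.

End Abstract.

(** * Cut-off functions of an interval *)

Section Cut.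
Variable R : realType.
Implicit Types (a b t : R) (n : nat).

(** The derivative is continuous and vanishes outside [0, 1], hence it is
    bounded. *)
Lemma step_derive : exists s' : R -> R, exists C : R,
  [/\ forall x : R, is_derive x 1 (@step R) (s' x), 0 <= C, forall x, `|s' x| <= C
    & forall x, x < 0 \/ 1 < x -> s' x = 0].
Proof.
have [s' [ds /smooth1_continuous cs]] := smooth1_derive (smooth1_step R).
have z x : x < 0 \/ 1 < x -> s' x = 0.
  move=> hx; have dx := ds x; rewrite -(@derive_val _ _ _ _ _ _ _ dx).
  case: hx => hx.
  - have c := is_derive_cst (0 : R) x 1.
    rewrite -[RHS](@derive_val _ _ _ _ _ _ _ c); apply: near_eq_derive.
    by near=> y; rewrite step0// ltW//; near: y; exact: lt_nbhsl.
  - have c := is_derive_cst (1 : R) x 1.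
    rewrite -[RHS](@derive_val _ _ _ _ _ _ _ c); apply: near_eq_derive.
    by near=> y; rewrite step1// ltW//; near: y; exact: lt_nbhsr.
have cn : {within `[0, 1], continuous (fun x => `|s' x|)}.
  apply: continuous_subspaceT => x.
  by apply: (@continuous_comp _ _ _ s' Num.norm); [exact: cs|exact: norm_continuous].
have [c _ hc] := EVT_max ler01 cn.
exists s', `|s' c|; split=> // x; have [x0|x0] := ltP x 0.
  by rewrite z ?normr0//; left.
have [x1|x1] := ltP 1 x; first by rewrite z ?normr0//; right.
by apply: hc; rewrite in_itv/= x0 x1.
Unshelve. all: by end_near. Qed.

(** With ramps of slope of order n: 0 up to distance 1/(n+1) from the ends of
    [a, b], and 1 from distance 2/(n+1) on. *)
Definition cut n a b t : R :=
  step (n.+1%:R * t + (- (n.+1%:R * a) - 1)) *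
  step (- n.+1%:R * t + (n.+1%:R * b - 1)).

Lemma smooth1_cut n a b : smooth1 (cut n a b).
Proof. by apply: smooth1M; apply: smooth1_affine; exact: smooth1_step. Qed.

Lemma cut_ge0 n a b t : 0 <= cut n a b t.
Proof. by rewrite mulr_ge0 ?step_ge0. Qed.

Lemma cut_le1 n a b t : cut n a b t <= 1.
Proof. by rewrite mulr_ile1 ?step_ge0 ?step_le1. Qed.

Lemma cut_supp n a b t : cut n a b t != 0 ->
  a + n.+1%:R^-1 <= t <= b - n.+1%:R^-1.
Proof.
move=> h; have n0 : 0 < n.+1%:R :> R by rewrite ltr0n.
have nV : n.+1%:R * n.+1%:R^-1 = 1 :> R by rewrite divff// gt_eqF.
apply/andP; split; rewrite leNgt; apply/negP => k; move/eqP: h; apply; rewrite /cut.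
  rewrite step0 ?mul0r//; move: k; rewrite -(ltr_pM2l n0) mulrDr nV; lra.
rewrite [X in _ * X]step0 ?mulr0//; move: k; rewrite -(ltr_pM2l n0) mulrBr nV; lra.
Qed.

Lemma cut_out n a b t : t <= a \/ b <= t -> cut n a b t = 0.
Proof.
move=> h; apply/eqP/negP => /negP /cut_supp /andP[h1 h2].
have n0 : 0 < n.+1%:R^-1 :> R by rewrite invr_gt0 ltr0n.
by case: h => h; move: (n.+1%:R^-1) n0 h1 h2 => m; lra.
Qed.

Lemma near_big (t c : R) : 0 < t -> \forall n \near \oo, c <= n.+1%:R * t.
Proof.
move=> t0; near=> n; rewrite -ler_pdivrMr//.
apply: (@le_trans _ _ n%:R); last by rewrite ler_nat.
by near: n; exact: nbhs_infty_ger.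
Unshelve. all: by end_near. Qed.

Lemma cut_cvg a b t : a < t < b -> cut n a b t @[n --> \oo] --> (1 : R).
Proof.
move=> /andP[at_ tb]; apply: cvg_near_cst.
have h1 : 0 < t - a by rewrite subr_gt0.
have h2 : 0 < b - t by rewrite subr_gt0.
near=> n; rewrite /cut !step1 ?mulr1//.
  have : 2 <= n.+1%:R * (b - t) by near: n; exact: near_big.
  by lra.
have : 2 <= n.+1%:R * (t - a) by near: n; exact: near_big.
by lra.
Unshelve. all: by end_near. Qed.

(** The derivative is of size n but lives within distance 2/(n+1) of the ends,
    so that its product with the distance to the ends stays bounded. This is
    what integration by parts against functions that vanish at the ends
    requires. *)
Lemma cut_derive a b : exists c' : nat -> R -> R, exists C : R,
  [/\ 0 <= C, forall n (t : R), is_derive t 1 (cut n a b) (c' n t),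
     forall n t, a < t < b -> `|c' n t| * Num.min (t - a) (b - t) <= C
    & forall t, a < t < b -> \forall n \near \oo, c' n t = 0].
Proof.
have [s' [C [ds C0 sC sz]]] := step_derive.
pose A n t := n.+1%:R * t + (- (n.+1%:R * a) - 1).
pose B n t := - n.+1%:R * t + (n.+1%:R * b - 1).
exists (fun n t => step (A n t) * (s' (B n t) * - n.+1%:R) +
   step (B n t) * (s' (A n t) * n.+1%:R)).
exists (4 * C); split.
- by lra.
- move=> n t; apply: is_deriveM.
  + apply: (is_derive1_comp (f := @step R)).
    have h := is_deriveD (is_deriveZ (n.+1%:R : R) (is_derive_id t 1)) (is_derive_cst (- (n.+1%:R * a) - 1) t 1).
    by apply: is_derive_eq h _; rewrite /GRing.scale/= addr0 mulr1.
  + apply: (is_derive1_comp (f := @step R)).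
    have h := is_deriveD (is_deriveZ (- n.+1%:R : R) (is_derive_id t 1)) (is_derive_cst (n.+1%:R * b - 1) t 1).
    by apply: is_derive_eq h _; rewrite /GRing.scale/= addr0 mulr1.
- move=> n t /andP[at_ tb].
  have n0 : 0 < n.+1%:R :> R by rewrite ltr0n.
  have m1 : Num.min (t - a) (b - t) <= t - a by rewrite ge_min lexx.
  have m2 : Num.min (t - a) (b - t) <= b - t by rewrite ge_min lexx orbT.
  have m0 : 0 <= Num.min (t - a) (b - t) by rewrite le_min !subr_ge0 !ltW.
  move: (Num.min _ _) m0 m1 m2 => m m0 m1 m2.
  (* either s' vanishes or the distance is at most 2 / n.+1 *)
  have bnd x y : (s' x != 0 -> n.+1%:R * m <= 2) ->
      `|step y * (s' x * n.+1%:R)| * m <= 2 * C.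
    move=> h; rewrite normrM (ger0_norm (step_ge0 _)) normrM (ger0_norm (ltW n0)).
    have [->|s0] := eqVneq (s' x) 0; first by rewrite normr0 mul0r mulr0 mul0r mulr_ge0.
    apply: (@le_trans _ _ (1 * (C * n.+1%:R) * m)); last by have := h s0; nra.
    apply: ler_wpM2r => //; rewrite mul1r; apply: le_trans (ler_piMl _ (step_le1 _)) _; first by rewrite pmulr_lge0.
    by rewrite ler_pM2r.
  apply: le_trans (ler_wpM2r m0 (ler_normD _ _)) _; rewrite mulrDl.
  rewrite (_ : 4 * C = 2 * C + 2 * C); last by ring.
  apply: lerD; first rewrite mulrN mulrN normrN; apply: bnd => s0.
  + rewrite leNgt; apply/negP => h; move/eqP: s0; apply; apply: sz; right.
    have : n.+1%:R * m <= n.+1%:R * (b - t) by rewrite ler_wpM2l// ltW.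
    by rewrite /B; lra.
  + rewrite leNgt; apply/negP => h; move/eqP: s0; apply; apply: sz; right.
    have : n.+1%:R * m <= n.+1%:R * (t - a) by rewrite ler_wpM2l// ltW.
    by rewrite /A; lra.
- move=> t /andP[at_ tb].
  have h1 : 0 < t - a by rewrite subr_gt0.
  have h2 : 0 < b - t by rewrite subr_gt0.
  near=> n; rewrite !sz ?mul0r ?mulr0 ?addr0//; right.
    have : 3 <= n.+1%:R * (t - a) by near: n; exact: near_big.
    by rewrite /A; lra.
  have : 3 <= n.+1%:R * (b - t) by near: n; exact: near_big.
  by rewrite /B; lra.
Unshelve. all: by end_near. Qed.

End Cut.

(** * Boxes *)

Section Boxes.
Variable R : realType.
Notation pt := (R * R * R)%type.
Implicit Types (B : box R) (p q : pt) (i j k d : 'I_3) (f g : pt -> R).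

Definition proper B := forall i, lo B i < hi B i.
Definition vol B : R := \prod_i len B i.

Lemma prod3 (F : 'I_3 -> R) : \prod_i F i = F 0 * F 1 * F 2.
Proof.
rewrite !big_ord_recl big_ord0 mulr1 mulrA.
by congr (F _ * F _ * F _); apply: val_inj.
Qed.

Lemma sum3 (F : 'I_3 -> R) : \sum_i F i = F 0 + F 1 + F 2.
Proof.
rewrite !big_ord_recl big_ord0 addr0 addrA.
by congr (F _ + F _ + F _); apply: val_inj.
Qed.

Lemma forall3 (P : 'I_3 -> Prop) : P 0 -> P 1 -> P 2 -> forall i, P i.
Proof. by move=> P0 P1 P2 i; case: (ord3P i) => ->. Qed.

Lemma inboxE B : inbox B = (`]lo B 0, hi B 0[ `*` `]lo B 1, hi B 1[) `*` `]lo B 2, hi B 2[.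
Proof.
apply/seteqP; split=> [p h|p [[h0 h1] h2]].
  by split; [split|]; rewrite /= in_itv/=; [exact: (h 0)|exact: (h 1)|exact: (h 2)].
by apply: forall3; [move: h0|move: h1|move: h2]; rewrite /= in_itv.
Qed.

Lemma measurable_inbox B : measurable (inbox B : set pt).
Proof. by rewrite inboxE; apply: measurableX => //; apply: measurableX. Qed.

Lemma leb1_itv B i : proper B -> lebesgue_measure `]lo B i, hi B i[%classic = (len B i)%:E.
Proof. by move=> pB; rewrite lebesgue_measure_itv/= lte_fin pB -EFinB. Qed.

Lemma leb3_inbox B : proper B -> (leb3 R) (inbox B) = (vol B)%:E.
Proof.
move=> pB; rewrite inboxE product_measure1E//; last exact: measurableX.
rewrite [X in (X * _)%E](_ : _ = (len B 0 * len B 1)%:E); last first.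
  apply: (etrans (product_measure1E lebesgue_measure lebesgue_measure (measurable_itv _) (measurable_itv _))).
  by rewrite EFinM; congr (_ * _)%E; exact: leb1_itv.
transitivity ((len B 0 * len B 1)%:E * (len B 2)%:E)%E.
  by congr (_ * _)%E; exact: leb1_itv.
by rewrite -EFinM /vol prod3.
Qed.

Lemma leb3_inbox_fin B : proper B -> ((leb3 R) (inbox B) < +oo)%E.
Proof. by move=> pB; rewrite leb3_inbox// ltry. Qed.

Lemma vol_gt0 B : proper B -> 0 < vol B.
Proof. by move=> pB; rewrite /vol prodr_gt0// => i _; rewrite subr_gt0. Qed.

Lemma len_gt0 B i : proper B -> 0 < len B i.
Proof. by move=> pB; rewrite subr_gt0. Qed.

Lemma ball_box p q (r : R) : (forall k, `|co p k - co q k| < r) -> ball p r q.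
Proof.
case: p q => -[p0 p1] p2 [[q0 q1] q2] h.
by split; [split|]; rewrite /ball/=; [exact: (h 0)|exact: (h 1)|exact: (h 2)].
Qed.

(** The sigma-algebra is that of the product, so that measurability of open
    sets has to be derived: an open set is the union of the countably many
    boxes with vertices on the grids Z/(n+1) that it contains. *)
Lemma open_measurable3 (U : set pt) : open U -> measurable U.
Proof.
move=> oU.
pose bx (x : nat * (int * int * int)) : box R :=
  let z (k : 'I_3) : int := if k == 0 then x.2.1.1 else if k == 1 then x.2.1.2 else x.2.2 in
  Box (fun k => ((z k)%:~R - 1) / x.1.+1%:R) (fun k => ((z k)%:~R + 1) / x.1.+1%:R).
pose F x : set pt := if `[< inbox (bx x) `<=` U >] then inbox (bx x) else set0.
have -> : U = \bigcup_x F x.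
  apply/seteqP; split=> [p Up|p [x _]]; last first.
    by rewrite /F; case: asboolP => // h /h.
  have /nbhs_ballP[r /= r0 hr] : nbhs p U by exact: open_nbhs_nbhs.
  have [n hn] : exists n : nat, 2 < n.+1%:R * r.
    have [N _ /(_ N (leqnn N)) h] := near_big 3 r0.
    by exists N; apply: lt_le_trans h; rewrite ltr_nat.
  have n0 : 0 < n.+1%:R :> R by [].
  pose z k := Num.floor (n.+1%:R * co p k).
  have zp k : (z k)%:~R <= n.+1%:R * co p k < (z k)%:~R + 1.
    by rewrite /z ge_floor -intrD1 floorD1_gt.
  have bE k : lo (bx (n, (z 0, z 1, z 2))) k = ((z k)%:~R - 1) / n.+1%:R /\
              hi (bx (n, (z 0, z 1, z 2))) k = ((z k)%:~R + 1) / n.+1%:R.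
    by case: (ord3P k) => ->.
  exists (n, (z 0, z 1, z 2)) => //; rewrite /F asboolT.
    move=> k; case: (bE k) => -> ->; rewrite ltr_pdivrMr// ltr_pdivlMr// mulrC.
    by have /andP[h1 h2] := zp k; rewrite h2 andbT; apply: lt_le_trans h1; rewrite ltrBlDr ltrDl.
  move=> q hq; apply: hr; apply: ball_box => k.
  have := hq k; case: (bE k) => -> ->; rewrite ltr_pdivrMr// ltr_pdivlMr// !(mulrC (co q k)).
  move=> /andP[q1 q2]; have /andP[h1 h2] := zp k.
  rewrite -(ltr_pM2l n0); apply: le_lt_trans hn.
  rewrite -[X in X * _](ger0_norm (ltW n0)) -normrM mulrBr ler_norml.
  by move: (_ * co p k) (_ * co q k) h1 h2 q1 q2 => a b; move: ((z k)%:~R) => c *; lra.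
apply: countable_bigcupT_measurable => [|x]; first exact: countableP.
by rewrite /F; case: asboolP => _; [exact: measurable_inbox|exact: measurable0].
Qed.

Lemma continuous_measurable3 (D : set pt) f : measurable D -> continuous f -> measurable_fun D f.
Proof.
move=> mD /continuousP cf; apply: (measurable_funS measurableT) => //.
apply: (measurability _ (RGenOpens.measurableE R)).
move=> _ [U [a [b ->]] <-]; rewrite setTI; apply: open_measurable3; apply: cf.
exact: interval_open.
Qed.

Definition closedbox B : set pt := [set p | forall i, lo B i <= co p i <= hi B i].

Lemma compact_closedbox B : compact (closedbox B).
Proof.
have -> : closedbox B = (`[lo B 0, hi B 0] `*` `[lo B 1, hi B 1]) `*` `[lo B 2, hi B 2].
  apply/seteqP; split=> [p h|p [[h0 h1] h2]].
    by split; [split|]; rewrite /= in_itv/=; [exact: (h 0)|exact: (h 1)|exact: (h 2)].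
  by apply: forall3; [move: h0|move: h1|move: h2]; rewrite /= in_itv.
by apply: compact_setX; [apply: compact_setX|]; exact: segment_compact.
Qed.

Lemma continuous_bounded B f : continuous f ->
  exists2 M : R, 0 <= M & forall p, closedbox B p -> `|f p| <= M.
Proof.
move=> cf; have /compact_bounded[M [_ hM]] : compact (f @` closedbox B).
  apply: continuous_compact; last exact: compact_closedbox.
  exact: continuous_subspaceT.
have M1 : M < `|M| + 1 by apply: le_lt_trans (ler_norm M) _; rewrite ltrDl.
exists (`|M| + 1); first by rewrite addr_ge0.
by move=> p Bp; apply: hM => //; exists p.
Qed.

Lemma inbox_closedbox B : inbox B `<=` closedbox B.
Proof. by move=> p h i; have /andP[/ltW -> /ltW ->] := h i. Qed.

Lemma L2_integrable B f : proper B -> L2 (inbox B) f -> (leb3 R).-integrable (inbox B) (EFin \o f).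
Proof.
move=> pB [mf f2]; apply: sq_integrable => //; first exact: measurable_inbox.
exact: leb3_inbox_fin.
Qed.

Lemma integrable_smoothM B f g : proper B -> L2 (inbox B) f -> continuous g ->
  (leb3 R).-integrable (inbox B) (EFin \o (fun p => f p * g p)).
Proof.
move=> pB Lf cg; have [M _ hM] := continuous_bounded B cg.
have hM' p : inbox B p -> `|g p| <= M by move=> /inbox_closedbox; exact: hM.
have mg : measurable_fun (inbox B : set pt) g.
  by apply: continuous_measurable3 => //; exact: measurable_inbox.
exact: (integrable_bdM (mu := leb3 R) (measurable_inbox B) (L2_integrable pB Lf) mg hM').
Qed.

End Boxes.

(** * Test functions of a box and integration by parts *)

Section Green.
Variable R : realType.
Notation pt := (R * R * R)%type.
Implicit Types (B : box R) (p q : pt) (i j k d : 'I_3) (f g psi : pt -> R).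

Definition bump B n p : R := \prod_i cut n (lo B i) (hi B i) (co p i).

Lemma smooth_bump B n : smooth (bump B n).
Proof. by apply: smooth_prod => i; apply: smooth_coord; exact: smooth1_cut. Qed.

Lemma prod_cut_le1 B n p (P : pred 'I_3) :
  0 <= \prod_(i | P i) cut n (lo B i) (hi B i) (co p i) <= 1.
Proof.
apply: (big_ind (fun x : R => 0 <= x <= 1)) => [|x y /andP[x0 x1] /andP[y0 y1]|i _].
- by rewrite ler01 lexx.
- by rewrite mulr_ge0// mulr_ile1.
- by rewrite cut_ge0 cut_le1.
Qed.

Lemma bump_norm B n p : `|bump B n p| <= 1.
Proof. by have /andP[h0 h1] := prod_cut_le1 B n p xpredT; rewrite ger0_norm. Qed.

Lemma bump_cvg B p : inbox B p -> bump B n p @[n --> \oo] --> (1 : R).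
Proof.
move=> Bp; under eq_fun do rewrite /bump prod3.
have h := cvgM (cvgM (cut_cvg (Bp 0)) (cut_cvg (Bp 1))) (cut_cvg (Bp 2)).
have {}h := h _ _; rewrite !mulr1 in h; exact: h.
Qed.

Lemma test_fun_bump B n psi : smooth psi ->
  test_fun (inbox B) (fun p => bump B n p * psi p).
Proof.
move=> spsi; split; first by apply: smoothM => //; exact: smooth_bump.
exists (closedbox (Box (fun i => lo B i + n.+1%:R^-1) (fun i => hi B i - n.+1%:R^-1))).
have n0 : 0 < n.+1%:R^-1 :> R by rewrite invr_gt0 ltr0n.
split.
- exact: compact_closedbox.
- move=> p h i; have /andP[/= h1 h2] := h i.
  by apply/andP; split; [apply: lt_le_trans h1; rewrite ltrDl
    |apply: le_lt_trans h2 _; rewrite ltrBlDr ltrDl].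
- move=> p h; have [i] : exists i, ~ (lo B i + n.+1%:R^-1 <= co p i <= hi B i - n.+1%:R^-1).
    by apply/existsNP.
  move=> ni; rewrite /bump (bigD1 i)//=.
  by have [->|/cut_supp//] := eqVneq (cut n (lo B i) (hi B i) (co p i)) 0; rewrite !mul0r.
Qed.

Lemma D_bump B n d p (c' : R -> R) :
  (forall t : R, is_derive t 1 (cut n (lo B d) (hi B d)) (c' t)) ->
  'D_(axis R d) (bump B n) p =
  c' (co p d) * \prod_(i | i != d) cut n (lo B i) (hi B i) (co p i).
Proof.
move=> dc; set r := \prod_(i | _) _.
have [] // := @is_derive_line _ (bump B n) p d (c' (co p d) * r) _.
rewrite [X in is_derive _ _ X _](_ : _ = fun t => r * cut n (lo B d) (hi B d) t).
  have h := is_deriveZ r (dc (co p d)).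
  by apply: is_derive_eq h _; rewrite /GRing.scale/= mulrC.
apply/funext => t; rewrite /bump (bigD1 d)//= co_setco eqxx mulrC; congr (_ * _).
by apply: eq_bigr => i /negbTE id; rewrite co_setco id.
Qed.

(** By the mean value theorem along the axis d. *)
Lemma smooth_lipschitz B d psi : proper B -> smooth psi ->
  (forall p, co p d = lo B d \/ co p d = hi B d -> psi p = 0) ->
  exists2 L : R, 0 <= L & forall p, inbox B p ->
    `|psi p| <= L * Num.min (co p d - lo B d) (hi B d - co p d).
Proof.
move=> pB spsi z.
have [L L0 hL] := continuous_bounded B (smooth_continuous (smooth_D d spsi)).
exists L => // p Bp; have /andP[p1 p2] := Bp d.
have q1 : 0 <= co p d - lo B d by rewrite subr_ge0 ltW.
have q2 : 0 <= hi B d - co p d by rewrite subr_ge0 ltW.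
have cl c : lo B d <= c <= hi B d -> closedbox B (setco p d c).
  move=> hc k; rewrite co_setco; case: eqP => [->//|_].
  exact: (inbox_closedbox Bp).
rewrite minr_pMr//; rewrite le_min; apply/andP; split.
  have [c /andP[c1 c2]] := MVT_axis p d spsi p1.
  rewrite setco_id (z (setco _ _ _)) ?subr0; last by left; rewrite co_setco eqxx.
  move=> ->; rewrite normrM (ger0_norm q1) ler_wpM2r//.
  by apply: hL; apply: cl; rewrite !ltW// (lt_trans c2).
have [c /andP[c1 c2]] := MVT_axis p d spsi p2.
rewrite setco_id (z (setco _ _ _)) ?sub0r; last by right; rewrite co_setco eqxx.
move=> e; rewrite -normrN e normrM (ger0_norm q2) ler_wpM2r//.
by apply: hL; apply: cl; rewrite !ltW// (lt_trans p1).
Qed.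

Lemma bump_int_cvg B f psi : proper B -> L2 (inbox B) f -> smooth psi ->
  \int[leb3 R]_(p in inbox B) (f p * (bump B n p * psi p)) @[n --> \oo] -->
  \int[leb3 R]_(p in inbox B) (f p * psi p).
Proof.
move=> pB Lf spsi; have [M M0 hM] := continuous_bounded B (smooth_continuous spsi).
apply: (Rintegral_bdd_cvg (mu := leb3 R) (measurable_inbox B)
  (p_ := fun n p => bump B n p * psi p) (p := psi) (M := M) (L2_integrable pB Lf)).
- move=> n; apply: continuous_measurable3; first exact: measurable_inbox.
  by apply: smooth_continuous; apply: smoothM => //; exact: smooth_bump.
- move=> n p Bp; rewrite normrM -[M]mul1r; apply: ler_pM => //; first exact: bump_norm.
  by apply: hM; exact: inbox_closedbox.
- move=> p Bp; rewrite -[X in _ --> X]mul1r; apply: cvgM; first exact: bump_cvg.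
  exact: cvg_cst.
Qed.

(** Products with cut-off functions are test functions, and they converge by
    dominated convergence. *)
Lemma test_dense B f g psi : proper B -> L2 (inbox B) f -> L2 (inbox B) g ->
  (forall phi, test_fun (inbox B) phi ->
    \int[leb3 R]_(p in inbox B) (f p * phi p) = \int[leb3 R]_(p in inbox B) (g p * phi p)) ->
  smooth psi ->
  \int[leb3 R]_(p in inbox B) (f p * psi p) = \int[leb3 R]_(p in inbox B) (g p * psi p).
Proof.
move=> pB Lf Lg fg spsi; have cf := bump_int_cvg pB Lf spsi.
have cg := bump_int_cvg pB Lg spsi.
have e : (fun n => \int[leb3 R]_(p in inbox B) (f p * (bump B n p * psi p))) =
         (fun n => \int[leb3 R]_(p in inbox B) (g p * (bump B n p * psi p))).
  by apply/funext => n; apply: fg; exact: test_fun_bump.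
rewrite e in cf; exact: (cvg_unique _ cf cg).
Qed.

(** The cut-off [bump] times psi is a test function. In its derivative the
    only singular term is psi times the derivative of the cut-off; it tends to
    0 pointwise, and it is bounded because psi vanishes linearly where the
    derivative of the cut-off is large ([smooth_lipschitz], [cut_derive]). *)
Lemma green0 B d v dv psi : proper B -> L2 (inbox B) v ->
  is_wderiv (inbox B) [:: d] v dv -> smooth psi ->
  (forall p, co p d = lo B d \/ co p d = hi B d -> psi p = 0) ->
  \int[leb3 R]_(p in inbox B) (v p * 'D_(axis R d) psi p) =
  - \int[leb3 R]_(p in inbox B) (dv p * psi p).
Proof.
move=> pB Lv [Ldv hw] spsi z.
have [L L0 hL] := smooth_lipschitz pB spsi z.
have [c' [C [C0 dc cC cz]]] := cut_derive (lo B d) (hi B d).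
have [M M0 hM] := continuous_bounded B (smooth_continuous (smooth_D d spsi)).
have Db n p : 'D_(axis R d) (fun p => bump B n p * psi p) p =
   bump B n p * 'D_(axis R d) psi p +
   psi p * (c' n (co p d) * \prod_(i | i != d) cut n (lo B i) (hi B i) (co p i)).
  rewrite (DaxisM _ _ (smooth_bump B n) spsi); congr (_ + _ * _).
  exact: D_bump.
have c1 : \int[leb3 R]_(p in inbox B) (v p * 'D_(axis R d) (fun p => bump B n p * psi p) p)
   @[n --> \oo] --> \int[leb3 R]_(p in inbox B) (v p * 'D_(axis R d) psi p).
  apply: (Rintegral_bdd_cvg (mu := leb3 R) (measurable_inbox B)
   (p_ := fun n p => 'D_(axis R d) (fun p => bump B n p * psi p) p) (p := 'D_(axis R d) psi)
   (M := M + L * C) (L2_integrable pB Lv)).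
  - move=> n; apply: continuous_measurable3; first exact: measurable_inbox.
    by apply: smooth_continuous; apply: smooth_D; apply: smoothM => //; exact: smooth_bump.
  - move=> n p Bp; rewrite Db; apply: le_trans (ler_normD _ _) _; apply: lerD.
      rewrite normrM -[M]mul1r; apply: ler_pM => //; first exact: bump_norm.
      by apply: hM; exact: inbox_closedbox.
    have h1 := hL p Bp; have /andP[r0 r1] := prod_cut_le1 B n p (fun i => i != d).
    have h2 := cC n (co p d) (Bp d).
    rewrite !normrM (ger0_norm r0).
    apply: le_trans (ler_wpM2r _ h1) _; first by rewrite mulr_ge0.
    rewrite -mulrA ler_wpM2l// mulrA mulrC -[C]mul1r; apply: ler_pM => //.
      rewrite mulr_ge0// le_min !subr_ge0; have /andP[b1 b2] := Bp d.
      by rewrite !ltW.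
    by rewrite mulrC.
  - move=> p Bp; have -> : 'D_(axis R d) psi p = 1 * 'D_(axis R d) psi p + 0.
      by rewrite mul1r addr0.
    under eq_fun do rewrite Db.
    apply: cvgD; first by apply: cvgM; [exact: bump_cvg|exact: cvg_cst].
    apply: cvg_near_cst; have [N _ hN] := cz (co p d) (Bp d).
    by exists N => // n Nn /=; rewrite hN// mul0r mulr0.
have c2 : (- \int[leb3 R]_(p in inbox B) (dv p * (bump B n p * psi p))) @[n --> \oo] -->
    - \int[leb3 R]_(p in inbox B) (dv p * psi p).
  by apply: cvgN; exact: bump_int_cvg.
have e : (fun n => \int[leb3 R]_(p in inbox B) (v p * 'D_(axis R d) (fun p => bump B n p * psi p) p)) =
  (fun n => - \int[leb3 R]_(p in inbox B) (dv p * (bump B n p * psi p))).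
  apply/funext => n; have := hw _ (test_fun_bump B n spsi).
  by rewrite /= expr1 mulN1r.
rewrite e in c1; exact: (cvg_unique _ c1 c2).
Qed.

End Green.

(** * Fubini along an axis *)

Section ProdSigmaFinite.
Context d1 d2 (T1 : measurableType d1) (T2 : measurableType d2) (R : realType).
Variables (m1 : {sigma_finite_measure set T1 -> \bar R})
  (m2 : {sigma_finite_measure set T2 -> \bar R}).

(** Iterating Fubini's theorem on a triple product needs the product of two
    sigma-finite measures as a sigma-finite measure again. *)
Definition prod_measure : set (T1 * T2) -> \bar R := (m1 \x m2)%E.

HB.instance Definition _ := Measure.on prod_measure.

Lemma prod_measure_sigma_finite : sigma_finite setT prod_measure.
Proof.
have [F FT Fm] := sigma_finiteT m1; have [G GT Gm] := sigma_finiteT m2.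
pose ij n : nat * nat := odflt (0%N, 0%N) (unpickle n).
exists (fun n => F (ij n).1 `*` G (ij n).2).
  apply/seteqP; split=> // -[x y] _.
  have [i _ Fx] : (\bigcup_i F i) x by rewrite -FT.
  have [j _ Gy] : (\bigcup_i G i) y by rewrite -GT.
  by exists (pickle (i, j)) => //; rewrite /ij pickleK.
move=> n; have [mF Foo] := Fm (ij n).1; have [mG Goo] := Gm (ij n).2.
split; first exact: measurableX.
by rewrite /prod_measure product_measure1E// lte_mul_pinfty// ge0_fin_numE.
Qed.

HB.instance Definition _ := Measure_isSigmaFinite.Build _ _ _ prod_measure
  prod_measure_sigma_finite.

End ProdSigmaFinite.

Section Swap.
Context d1 d2 d3 (T1 : measurableType d1) (T2 : measurableType d2)
  (T3 : measurableType d3) (R : realType).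
Variables (m1 : {sigma_finite_measure set T1 -> \bar R})
  (m2 : {sigma_finite_measure set T2 -> \bar R})
  (m3 : {sigma_finite_measure set T3 -> \bar R}).

Definition swap12 (p : T2 * T1 * T3) : T1 * T2 * T3 := (p.1.2, p.1.1, p.2).
Definition swap23 (p : T1 * T3 * T2) : T1 * T2 * T3 := (p.1.1, p.2, p.1.2).

Lemma measurable_swap12 : measurable_fun setT swap12.
Proof.
apply: measurable_fun_pair; last exact: measurable_snd.
apply: measurable_fun_pair.
  exact: (measurableT_comp measurable_snd measurable_fst).
exact: (measurableT_comp measurable_fst measurable_fst).
Qed.

Lemma measurable_swap23 : measurable_fun setT swap23.
Proof.
apply: measurable_fun_pair.
  apply: measurable_fun_pair; last exact: measurable_snd.
  exact: (measurableT_comp measurable_fst measurable_fst).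
exact: (measurableT_comp measurable_snd measurable_fst).
Qed.

Lemma integral_swap12 (F : T1 * T2 * T3 -> \bar R) :
  measurable_fun setT F -> (forall x, 0 <= F x)%E ->
  (\int[m1 \x m2 \x m3]_x F x = \int[m2 \x m1 \x m3]_x F (swap12 x))%E.
Proof.
move=> mF F0.
have mFs : measurable_fun setT (F \o swap12) by apply: measurableT_comp => //; exact: measurable_swap12.
pose G (p : T1 * T2) := (\int[m3]_y F (p, y))%E.
have mG : measurable_fun setT G by apply: measurable_fun_fubini_tonelli_F.
have G0 p : (0 <= G p)%E by apply: integral_ge0.
pose Dflux := G \o (fun p : T2 * T1 => (p.2, p.1)).
have mGs : measurable_fun setT Dflux.
  by apply: measurableT_comp => //; apply: measurable_fun_pair.
refine (etrans (@fubini_tonelli1 _ _ (T1 * T2)%type T3 R (prod_measure m1 m2) m3 F mF F0) _).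
refine (etrans _ (esym (@fubini_tonelli1 _ _ (T2 * T1)%type T3 R (prod_measure m2 m1) m3 (F \o swap12) mFs (fun x => F0 _)))).
refine (etrans (@fubini_tonelli1 _ _ _ _ R m1 m2 G mG G0) _).
exact: (esym (@fubini_tonelli2 _ _ _ _ R m2 m1 Dflux mGs (fun x => G0 _))).
Qed.

Lemma integral_swap23 (F : T1 * T2 * T3 -> \bar R) :
  measurable_fun setT F -> (forall x, 0 <= F x)%E ->
  (\int[m1 \x m2 \x m3]_x F x = \int[m1 \x m3 \x m2]_x F (swap23 x))%E.
Proof.
move=> mF F0.
have mFs : measurable_fun setT (F \o swap23) by apply: measurableT_comp => //; exact: measurable_swap23.
pose G := fubini_F m3 F; pose Dflux := fubini_F m2 (F \o swap23).
have mG : measurable_fun setT G by apply: measurable_fun_fubini_tonelli_F.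
have mGs : measurable_fun setT Dflux by apply: measurable_fun_fubini_tonelli_F => // x; exact: F0.
have G0 p : (0 <= G p)%E by apply: integral_ge0.
have Gs0 p : (0 <= Dflux p)%E by apply: integral_ge0 => x _; exact: F0.
refine (etrans (@fubini_tonelli1 _ _ (T1 * T2)%type T3 R (prod_measure m1 m2) m3 F mF F0) _).
refine (etrans _ (esym (@fubini_tonelli1 _ _ (T1 * T3)%type T2 R (prod_measure m1 m3) m2 (F \o swap23) mFs (fun x => F0 _)))).
refine (etrans (@fubini_tonelli1 _ _ _ _ R m1 m2 G mG G0) _).
refine (etrans _ (esym (@fubini_tonelli1 _ _ _ _ R m1 m3 Dflux mGs Gs0))).
apply: eq_integral => x _; rewrite /fubini_F /=.
apply: (fubini_tonelli (fun yz : T2 * T3 => F (x, yz.1, yz.2))) => //.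
apply: (measurableT_comp mF).
by apply: measurable_fun_pair => //; apply: measurable_fun_pair.
Qed.

End Swap.

Section Invariant.
Context d (T : measurableType d) (R : realType) (mu : {measure set T -> \bar R}).

Definition invariant (h : T -> T) := measurable_fun setT h /\
  forall F : T -> \bar R, measurable_fun setT F -> (forall x, 0 <= F x)%E ->
  (\int[mu]_x F x = \int[mu]_x F (h x))%E.

Lemma invariant_comp h k : invariant h -> invariant k -> invariant (h \o k).
Proof.
move=> [mh ih] [mk ik]; split; first exact: measurableT_comp.
move=> F mF F0; have mFh : measurable_fun setT (F \o h) by exact: measurableT_comp.
by rewrite ih// (ik (F \o h) mFh (fun x => F0 _)).
Qed.

Lemma invariant_id : invariant id.
Proof. by split. Qed.

Lemma invariant_integrable h (f : T -> \bar R) : invariant h -> mu.-integrable setT f ->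
  mu.-integrable setT (f \o h) /\ (\int[mu]_x f x = \int[mu]_x f (h x))%E.
Proof.
move=> [mh ih] /[dup] fi /integrableP[mf foo]; split.
  apply/integrableP; split; first exact: measurableT_comp.
  by rewrite -(ih (fun x => `|f x|%E))//; exact: measurableT_comp.
rewrite integralE [RHS]integralE; congr (_ - _)%E.
  rewrite ih//; last exact: measurable_funepos.
  by apply: eq_integral => x _; rewrite !funeposE.
rewrite ih//; last exact: measurable_funeneg.
by apply: eq_integral => x _; rewrite !funenegE.
Qed.

End Invariant.

Section Fubini3.
Variable R : realType.
Notation pt := (R * R * R)%type.
Implicit Types (B : box R) (p q : pt) (i j k d : 'I_3) (f g psi : pt -> R).

(** Coordinates adapted to the faces orthogonal to [d]: the face parameter
    first, the coordinate along [d] last. *)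
Definition alongax d (z : pt) : pt :=
  mkpt (fun k => if unlift d k is Some j then (if j == ord0 then z.1.1 else z.1.2) else z.2).

Lemma alongaxE d z : alongax d z =
  if d == 0 then (z.2, z.1.1, z.1.2) else if d == 1 then (z.1.1, z.2, z.1.2) else z.
Proof.
have l d' : unlift d' d' = None by rewrite unlift_none.
have lS d' k (j : 'I_2) : lift d' j = k -> unlift d' k = Some j.
  by move=> <-; rewrite liftK.
case: z => -[a b] c; case: (ord3P d) => -> /=; rewrite /alongax /mkpt.
- rewrite l (lS 0 1 ord0) ?(lS 0 2 ord_max)//; exact: val_inj.
- rewrite l (lS 1 0 ord0) ?(lS 1 2 ord_max)//; exact: val_inj.
- rewrite l (lS 2 0 ord0) ?(lS 2 1 ord_max)//; exact: val_inj.
Qed.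

Lemma invariant_alongax d : invariant (leb3 R) (alongax d).
Proof.
have i12 : invariant (leb3 R) (fun z : pt => (z.1.2, z.1.1, z.2)).
  split; first exact: measurable_swap12.
  by move=> F mF F0; exact: integral_swap12.
have i23 : invariant (leb3 R) (fun z : pt => (z.1.1, z.2, z.1.2)).
  split; first exact: measurable_swap23.
  by move=> F mF F0; exact: integral_swap23.
have -> : alongax d = if d == 0 then (fun z : pt => (z.1.2, z.1.1, z.2)) \o (fun z : pt => (z.1.1, z.2, z.1.2))
   else if d == 1 then (fun z : pt => (z.1.1, z.2, z.1.2)) else id.
  by apply/funext => z; rewrite alongaxE; case: ifP => // _; case: ifP.
case: ifP => _; first exact: invariant_comp.
by case: ifP => _ //; exact: invariant_id.
Qed.

End Fubini3.

Section Slice.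
Variable R : realType.
Notation pt := (R * R * R)%type.
Implicit Types (B : box R) (p q : pt) (i j k d : 'I_3) (f g psi : pt -> R) (y : R * R) (t : R).

Lemma faceptE B d b y : facept B d b y = alongax d (y, level B d b).
Proof. by []. Qed.

Lemma co_alongax d y t : co (alongax d (y, t)) d = t.
Proof. by rewrite co_mkpt unlift_none. Qed.

Lemma co_alongax0 d y t : co (alongax d (y, t)) (lift d ord0) = y.1.
Proof. by rewrite co_mkpt liftK. Qed.

Lemma co_alongax1 d y t : co (alongax d (y, t)) (lift d ord_max) = y.2.
Proof. by rewrite co_mkpt liftK. Qed.

Lemma ord2P (j : 'I_2) : j = ord0 \/ j = ord_max.
Proof. by case: j => -[|[|//]] h; [left|right]; exact: val_inj. Qed.

Lemma axis_cases d i : [\/ i = d, i = lift d ord0 | i = lift d ord_max].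
Proof.
case: (unliftP d i) => [j ->|->]; last by constructor 1.
by case: (ord2P j) => ->; [constructor 2|constructor 3].
Qed.

Lemma setco_alongax d y s t : setco (alongax d (y, s)) d t = alongax d (y, t).
Proof.
apply: pt_ext => k; rewrite co_setco; case: (axis_cases d k) => ->.
- by rewrite eqxx co_alongax.
- by rewrite eq_sym (negbTE (neq_lift _ _)) !co_alongax0.
- by rewrite eq_sym (negbTE (neq_lift _ _)) !co_alongax1.
Qed.

Lemma inbox_alongax B d y t :
  inbox B (alongax d (y, t)) <-> facedom B d y /\ lo B d < t < hi B d.
Proof.
split=> [h|[[h1 h2] h3] i].
  split; last by have := h d; rewrite co_alongax.
  by split; [have := h (lift d ord0)|have := h (lift d ord_max)];
    rewrite ?co_alongax0 ?co_alongax1.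
by case: (axis_cases d i) => ->; rewrite ?co_alongax ?co_alongax0 ?co_alongax1.
Qed.

Lemma facedomE B d : facedom B d =
  `]lo B (lift d ord0), hi B (lift d ord0)[ `*` `]lo B (lift d ord_max), hi B (lift d ord_max)[.
Proof. by apply/seteqP; split=> y /= [h1 h2]; move: h1 h2; rewrite /= !in_itv. Qed.

Lemma measurable_facedom B d : measurable (facedom B d : set (R * R)).
Proof. by rewrite facedomE; apply: measurableX. Qed.

Definition slice B d f y : R :=
  \int[@lebesgue_measure R]_(t in `]lo B d, hi B d[) f (alongax d (y, t)).

Let leb : {sigma_finite_measure set (measurableTypeR R) -> \bar R} := @lebesgue_measure R.
Let mu2 := prod_measure leb leb.

(** Fubini's theorem after the measure-preserving change of coordinates
    [alongax]. *)
Lemma slice_fubini B d f : (leb3 R).-integrable (inbox B) (EFin \o f) ->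
  [/\ (leb2 R).-integrable (facedom B d) (EFin \o slice B d f),
      \int[leb3 R]_(p in inbox B) f p = \int[leb2 R]_(y in facedom B d) slice B d f y
    & {ae leb2 R, forall y, facedom B d y -> (@lebesgue_measure R).-integrable
        `]lo B d, hi B d[ (fun t => (f (alongax d (y, t)))%:E)}].
Proof.
move=> fi; pose I := `]lo B d, hi B d[%classic : set R.
have mI : measurable I by exact: measurable_itv.
pose F := (EFin \o f) \_ (inbox B).
have FI : (leb3 R).-integrable setT F.
  exact: (proj1 (integrable_mkcond (mu := leb3 R) (EFin \o f) (measurable_inbox B)) fi).
have [Fai Fae] := invariant_integrable (invariant_alongax R d) FI.
pose F' (z : R * R * R) := F (alongax d z).
have F'I : (product_measure1 mu2 leb).-integrable setT F' by exact: Fai.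
have secE y : facedom B d y -> (fun t => F' (y, t)) = (fun t => (f (alongax d (y, t)))%:E) \_ I.
  move=> Dy; apply/funext => t; rewrite /F' /F /patch.
  have -> : (alongax d (y, t) \in inbox B) = (t \in I).
    apply/idP/idP => /set_mem h; apply/mem_set.
      by have /inbox_alongax[_] := h; rewrite /I /= in_itv.
    by apply/inbox_alongax; split=> //; move: h; rewrite /I /= in_itv.
  by [].
have sec0 y : ~ facedom B d y -> (fun t => F' (y, t)) = cst 0%E.
  move=> Dy; apply/funext => t; rewrite /F' /F /patch.
  by case: ifP => // /set_mem /inbox_alongax[].
pose G := fubini_F leb F'.
have GE y : facedom B d y -> G y = (\int[leb]_(t in I) (f (alongax d (y, t)))%:E)%E.
  by move=> Dy; rewrite /G /fubini_F (secE y Dy) -integral_mkcond.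
have G0 y : ~ facedom B d y -> G y = 0%E.
  by move=> Dy; rewrite /G /fubini_F (sec0 y Dy) integral0.
have GI : mu2.-integrable setT G by apply: integrable_fubini_F F'I.
have aeI : {ae leb2 R, forall y, facedom B d y -> leb.-integrable I (fun t => (f (alongax d (y, t)))%:E)}.
  have := ae_integrable1 F'I; apply: filterS => y h Dy; rewrite (secE y Dy) in h.
  exact: (proj2 (integrable_mkcond (mu := leb) _ mI) h).
have GD : (leb2 R).-integrable (facedom B d) G.
  by apply: (integrableS measurableT) => //; exact: measurable_facedom.
have sE y : facedom B d y -> slice B d f y = fine (G y) by move=> Dy; rewrite GE.
have ms : measurable_fun (facedom B d) (slice B d f).
  apply: (eq_measurable_fun (fine \o G)).
    by move=> y /set_mem Dy /=; rewrite sE.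
  have mG := measurable_int _ GD.
  exact: (measurableT_comp (fine_measurable measurableT) mG).
have sI : (leb2 R).-integrable (facedom B d) (EFin \o slice B d f).
  apply: (@le_integrable _ _ _ (leb2 R) _ (measurable_facedom B d) _ G _ _ GD).
    exact/measurable_EFinP.
  move=> y Dy; rewrite /= sE//; case: (G y) => //=; by rewrite normr0 leey.
split => //.
rewrite /Rintegral; congr fine; rewrite integral_mkcond -/F Fae.
rewrite -(integral12_prod_meas1 F'I) -/G.
have -> : (\int[mu2]_x G x = \int[leb2 R]_(x in facedom B d) G x)%E.
  rewrite [RHS]integral_mkcond; apply: eq_integral => y _; rewrite /patch.
  by case: ifPn => // /negP h; apply: G0 => Dy; apply: h; apply/mem_set.
apply: ae_eq_integral.
- exact: measurable_facedom.
- exact: (measurable_int _ GD).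
- exact: (measurable_int _ sI).
- move: aeI; apply: (@filterS _ _ (ae_filter_ringOfSetsType (leb2 R))) => y h Dy; rewrite /= sE// fineK// GE//.
  by apply: integrable_fin_num => //; exact: h.
Qed.

End Slice.

(** * Existence of traces *)

Section Trace.
Variable R : realType.
Notation pt := (R * R * R)%type.
Implicit Types (B : box R) (D : set pt) (p q : pt) (i j k d : 'I_3) (f g psi v dv : pt -> R) (y : R * R) (t : R).

Lemma L2_sq_ub D f (h : pt -> R) : measurable D -> measurable_fun D f ->
  (leb3 R).-integrable D (EFin \o h) -> (forall p, D p -> f p ^+ 2 <= h p) -> L2 D f.
Proof.
move=> mD mf hi fh; split=> //.
apply: (@le_integrable _ _ _ (leb3 R) _ mD _ (EFin \o h) _ _ hi).
  by apply/measurable_EFinP; exact: measurable_funX.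
move=> p Dp /=; rewrite lee_fin ger0_norm ?sqr_ge0//.
exact: le_trans (fh p Dp) (ler_norm _).
Qed.

Lemma L2D D f g : measurable D -> L2 D f -> L2 D g -> L2 D (fun p => f p + g p).
Proof.
move=> mD [mf f2] [mg g2].
apply: (L2_sq_ub mD _ (integrable_lin (mu := leb3 R) mD 2 2 f2 g2)).
  exact: measurable_funD.
by move=> p _; have := sqr_ge0 (f p - g p); nra.
Qed.

Lemma L2_bdM D f g (M : R) : measurable D -> L2 D f -> measurable_fun D g ->
  (forall p, D p -> `|g p| <= M) -> L2 D (fun p => f p * g p).
Proof.
move=> mD [mf f2] mg gM.
apply: (L2_sq_ub mD _ (integrable_lin (mu := leb3 R) mD (M ^+ 2) 0 f2 f2)).
  exact: measurable_funM.
move=> p Dp; rewrite mul0r addr0 exprMn mulrC ler_wpM2r ?sqr_ge0//.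
rewrite -(real_normK (num_real (g p))).
by have := gM p Dp; have := normr_ge0 (g p); nra.
Qed.

Lemma L2_cst D (c : R) : measurable D -> ((leb3 R) D < +oo)%E -> L2 D (fun=> c).
Proof.
move=> mD Doo; split; first exact: measurable_cst.
exact: (cst_integrable (mu := leb3 R) mD Doo (c ^+ 2)).
Qed.

Lemma L2S D D' f : measurable D -> measurable D' -> D `<=` D' -> L2 D' f -> L2 D f.
Proof.
move=> mD mD' DD' [mf f2]; split; first exact: measurable_funS mf.
exact: (integrableS (mu := leb3 R) mD' mD).
Qed.

Lemma L2_smoothM B f g : L2 (inbox B) f -> continuous g -> L2 (inbox B) (fun p => f p * g p).
Proof.
move=> Lf cg; have [M _ hM] := continuous_bounded B cg.
apply: (L2_bdM (M := M)) => //; first exact: measurable_inbox.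
  by apply: continuous_measurable3 => //; exact: measurable_inbox.
by move=> p /inbox_closedbox; exact: hM.
Qed.

Lemma L2Z D f (c : R) : measurable D -> L2 D f -> L2 D (fun p => c * f p).
Proof.
move=> mD Lf; have -> : (fun p => c * f p) = (fun p => f p * c) by apply/funext => p; rewrite mulrC.
by apply: (L2_bdM (M := `|c|)) => //; exact: measurable_cst.
Qed.

(** Cauchy-Schwarz on almost every line along d, then Fubini's theorem for
    f^2. *)
Lemma slice_sq_integrable B d f : proper B -> L2 (inbox B) f ->
  measurable_fun (facedom B d) (slice B d f) /\
  (leb2 R).-integrable (facedom B d) (fun y => (slice B d f y ^+ 2)%:E).
Proof.
move=> pB Lf; have [sI _ _] := slice_fubini d (L2_integrable pB Lf).
have ms : measurable_fun (facedom B d) (slice B d f). exact: (proj1 (measurable_EFinP _ _) (measurable_int _ sI)).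
split=> //; have [s2I _ ae2] := slice_fubini d Lf.2.
pose I := `]lo B d, hi B d[%classic : set R.
have ae1 : {ae leb2 R, forall y, facedom B d y -> measurable_fun I (fun t => f (alongax d (y, t)))}.
  have [_ _] := slice_fubini d (L2_integrable pB Lf).
  apply: (@filterS _ _ (ae_filter_ringOfSetsType (leb2 R))) => y h Dy.
  exact: (proj1 (measurable_EFinP _ _) (measurable_int _ (h Dy))).
have mf := measurable_facedom B d.
have lI : (@lebesgue_measure R I = (len B d)%:E)%E by exact: leb1_itv.
have ubI : (leb2 R).-integrable (facedom B d) (EFin \o (fun y => len B d * slice B d (fun p => f p ^+ 2) y)).
  exact: (integrableZl (mu := leb2 R) mf (len B d) s2I).
apply/integrableP; split; first by apply/measurable_EFinP; exact: measurable_funX.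
have /integrableP[mub uboo] := ubI.
apply: le_lt_trans uboo; apply: (ae_ge0_le_integral (mu := leb2 R) mf) => //.
- by apply: measurableT_comp => //; apply/measurable_EFinP; exact: measurable_funX.
- exact: measurableT_comp.
- have := (@filterI _ _ (ae_filter_ringOfSetsType (leb2 R))) _ _ ae1 ae2.
  apply: (@filterS _ _ (ae_filter_ringOfSetsType (leb2 R))) => y [m1 h] Dy /=.
  rewrite lee_fin ger0_norm ?sqr_ge0//; apply: le_trans (ler_norm _).
  have Ioo : (@lebesgue_measure R I < +oo)%E by rewrite lI ltry.
  have := Rintegral_sq_le (mu := @lebesgue_measure R) (measurable_itv _) Ioo (m1 Dy) (h Dy).
  by rewrite [X in fine X]lI.
Qed.

Lemma level_diff B d b : level B d b - level B d (~~ b) = nsign R b * len B d.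
Proof. by case: b => /=; rewrite /nsign /len ?mul1r// mulN1r opprB. Qed.

Lemma nsign_neq0 b : nsign R b != 0.
Proof. by case: b; rewrite /nsign ?oppr_eq0 oner_neq0. Qed.

Lemma nsignV b : (nsign R b)^-1 = nsign R b.
Proof. by case: b; rewrite /nsign ?invrN invr1. Qed.

Lemma measurable_facept B d b psi : continuous psi ->
  measurable_fun (facedom B d) (fun y => psi (facept B d b y)).
Proof.
move=> cpsi; have m1 : measurable_fun setT psi by exact: continuous_measurable3.
have [m2 _] := invariant_alongax R d.
have m3 : measurable_fun setT (fun y : R * R => (y, level B d b)).
  by apply: measurable_fun_pair => //; exact: measurable_cst.
apply: (measurable_funS (measurableT)) => //.
exact: (measurableT_comp m1 (measurableT_comp m2 m3)).
Qed.

Lemma smooth_linear d (c : R) : smooth (fun p : pt => co p d - c).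
Proof. by apply: smoothB; [exact: smooth_co|exact: smooth_cst]. Qed.

Lemma D_linear d (c : R) p : 'D_(axis R d) (fun p : pt => co p d - c) p = 1.
Proof.
have [_ e2] := D_coord d d (fun x : R => is_deriveB (is_derive_id x 1) (is_derive_cst c x 1)).
by have := congr1 (@^~ p) e2; rewrite /= eqxx subr0.
Qed.

Lemma L2_green B d v dv (c : R) : L2 (inbox B) v -> L2 (inbox B) dv ->
  L2 (inbox B) (fun p => v p + dv p * (co p d - c)).
Proof.
move=> Lv Ldv.
exact: (L2D (measurable_inbox B) Lv (L2_smoothM Ldv (smooth_continuous (smooth_linear d c)))).
Qed.

(** Green's formula for phi is reduced to [green0] by subtracting its
    interpolant between the two faces, which is affine along d: the values of
    phi on the face (d, b) are those of P, which is constant along d, and phi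
    vanishes on the opposite face. The boundary term is thereby expressed by
    an integral over the box. *)
Lemma green_interp B d b v dv phi P : proper B -> L2 (inbox B) v ->
  is_wderiv (inbox B) [:: d] v dv -> smooth phi -> smooth P ->
  (forall p, 'D_(axis R d) P p = 0) ->
  (forall p, co p d = level B d b -> phi p = P p) ->
  (forall p, co p d = level B d (~~ b) -> phi p = 0) ->
  \int[leb3 R]_(p in inbox B) (v p * 'D_(axis R d) phi p + dv p * phi p) =
  (nsign R b * len B d)^-1 *
    \int[leb3 R]_(p in inbox B) ((v p + dv p * (co p d - level B d (~~ b))) * P p).
Proof.
move=> pB Lv wdv sphi sP DP phiP phi0; have Ldv := wdv.1; have mB := measurable_inbox B.
set l' := level B d (~~ b); set l := level B d b in phiP.
have ll : l - l' = nsign R b * len B d by rewrite level_diff.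
have ll0 : l - l' != 0 by rewrite ll mulf_neq0 ?nsign_neq0// gt_eqF// len_gt0.
rewrite -ll; pose c := (l - l')^-1.
have slin := smooth_linear d l'; have sL := smoothM sP slin.
(* c * (x_d - l') is 1 on the face (d, b) and 0 on the opposite face. *)
pose psi p := phi p + (- c) * (P p * (co p d - l')).
have scL := smoothM (smooth_cst (- c)) sL.
have spsi : smooth psi by exact: (smoothD sphi scL).
have zpsi p : co p d = lo B d \/ co p d = hi B d -> psi p = 0.
  move=> h; have [e|e] : co p d = l \/ co p d = l'.
    by move: h; rewrite /l /l'; case: (b) => /= -[->|->]; [right|left|left|right].
    by rewrite /psi phiP// e /c mulNr mulrCA mulVf// mulr1 subrr.
  by rewrite /psi phi0// e subrr !mulr0 addr0.
have Dpsi p : 'D_(axis R d) psi p = 'D_(axis R d) phi p - c * P p.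
  rewrite (DaxisD d p sphi scL) (DaxisM d p (smooth_cst (- c)) sL) (DaxisM d p sP slin).
  have [_ e] := D_coord d d (fun x : R => is_derive_cst (- c) x 1).
  have -> : 'D_(axis R d) (fun _ : pt => - c) p = 0.
    by have := congr1 (@^~ p) e; rewrite /= eqxx.
  by rewrite D_linear DP mulr0 mulr1 addr0 mulr0 addr0 mulNr.
have G := green0 pB Lv wdv spsi zpsi.
have i1 := integrable_smoothM pB Lv (smooth_continuous (smooth_D d sphi)).
have i2 := integrable_smoothM pB Ldv (smooth_continuous sphi).
have i3 := integrable_smoothM pB (L2_green d l' Lv Ldv) (smooth_continuous sP).
have i4 := integrable_smoothM pB Lv (smooth_continuous (smooth_D d spsi)).
have i5 := integrable_smoothM pB Ldv (smooth_continuous spsi).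
have i12 := integrable_lin (mu := leb3 R) mB 1 1 i1 i2.
have := Rintegral_lin (mu := leb3 R) mB 1 (- c) i12 i3.
under eq_Rintegral => p _.
  rewrite (_ : _ + _ = 1 * (v p * 'D_(axis R d) psi p) + 1 * (dv p * psi p)); last first.
    by rewrite Dpsi /psi; ring.
  over.
rewrite (Rintegral_lin (mu := leb3 R) mB 1 1 i4 i5) G !mul1r addNr mulNr.
move=> /esym/eqP; rewrite subr_eq0 => /eqP <-.
by apply: eq_Rintegral => p _; rewrite !mul1r.
Qed.

(** [green_interp] suggests the trace: at a point of the face it is the mean
    of v + dv (x_d - l') over the line along d through that point, l' being
    the level of the opposite face. Fubini's theorem turns the right-hand side
    of [green_interp] into an integral over the face. *)
Lemma trace_exists B d b v dv : proper B -> L2 (inbox B) v ->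
  is_wderiv (inbox B) [:: d] v dv -> exists g, is_trace B d b v g.
Proof.
move=> pB Lv wdv; have Ldv := wdv.1; have mB := measurable_inbox B.
set l := level B d b; set l' := level B d (~~ b).
pose w p := v p + dv p * (co p d - l').
have Lw : L2 (inbox B) w by exact: L2_green.
have [ms s2] := slice_sq_integrable d pB Lw.
pose a := len B d.
pose g p := a^-1 * slice B d w (co p (lift d ord0), co p (lift d ord_max)).
have gE y : g (facept B d b y) = a^-1 * slice B d w y.
  by rewrite /g faceptE co_alongax0 co_alongax1 -surjective_pairing.
exists g; split.
  have e : g \o facept B d b = (fun y => a^-1 * slice B d w y) by apply/funext => y; exact: gE.
  rewrite /L2face e; split; first exact: measurable_funM.
  have -> : (fun y => (g (facept B d b y) ^+ 2)%:E) =
     (fun y => ((a^-1 ^+ 2)%:E * (slice B d w y ^+ 2)%:E)%E).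
    by apply/funext => y; rewrite gE exprMn.
  exact: (integrableZl (mu := leb2 R) (measurable_facedom B d) _ s2).
exists dv => // phi sphi phi0.
pose P p := phi (setco p d l).
have sP : smooth P by exact: smooth_setco.
have DP p : 'D_(axis R d) P p = 0.
  by have [_ /(congr1 (@^~ p))] := D_set d l d sphi; rewrite /= eqxx.
have phiP p : co p d = l -> phi p = P p by move=> e; rewrite /P -e setco_id.
rewrite /= (green_interp pB Lv wdv sphi sP DP phiP phi0) -/l' -/a invfM nsignV.
have cphi := smooth_continuous sphi.
have i3 := integrable_smoothM pB Lw (smooth_continuous sP).
have i6 : (leb3 R).-integrable (inbox B) (EFin \o (fun p => a^-1 * (w p * P p))).
  exact: (integrableZl (mu := leb3 R) mB a^-1 i3).
have [sI6 e6 ae6] := slice_fubini d i6.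
rewrite -mulrA -(RintegralZl (mu := leb3 R) a^-1 mB i3) e6; congr (_ * _).
rewrite /fint /Rintegral; congr fine.
have [sIw _ aew] := slice_fubini d (L2_integrable pB Lw).
apply: (ae_eq_integral (mu := leb2 R)).
- exact: measurable_facedom.
- exact: (measurable_int _ sI6).
- apply/measurable_EFinP; apply: measurable_funM; last exact: measurable_facept.
  rewrite (_ : (fun y => g (facept B d b y)) = (fun y => a^-1 * slice B d w y)); last first.
    by apply/funext => y; rewrite gE.
  exact: measurable_funM.
move: aew; apply: (@filterS _ _ (ae_filter_ringOfSetsType (leb2 R))) => y h Dy /=.
congr EFin; rewrite gE /slice.
transitivity (\int[@lebesgue_measure R]_(t in `]lo B d, hi B d[) (a^-1 * phi (facept B d b y) * w (alongax d (y, t)))).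
  by apply: eq_Rintegral => t _; rewrite /P setco_alongax faceptE -/l; ring.
rewrite (RintegralZl (mu := @lebesgue_measure R) _ (measurable_itv _) (h Dy)).
by rewrite mulrAC.
Qed.

End Trace.

(** * Weak derivatives *)

Lemma Rintegral_sub d (T : measurableType d) (R : realType) (mu : {measure set T -> \bar R})
  (D D' : set T) (f : T -> R) : D `<=` D' -> (forall p, D' p -> ~ D p -> f p = 0) ->
  \int[mu]_(p in D') f p = \int[mu]_(p in D) f p.
Proof.
move=> DD f0; rewrite Rintegral_mkcond [RHS]Rintegral_mkcond.
apply: eq_Rintegral => p _; rewrite /patch.
case: ifPn => [/set_mem D'p|/negP h]; case: ifPn => [/set_mem Dp|/negP h'] //.
  by apply: f0 => // Dp; apply: h'; apply/mem_set.
by exfalso; apply: h; apply/mem_set; exact: DD.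
Qed.

Section Weak.
Variable R : realType.
Notation pt := (R * R * R)%type.
Implicit Types (B : box R) (D : set pt) (p q : pt) (i j k d : 'I_3) (f g psi v dv u w phi : pt -> R) (s : seq 'I_3).

Lemma pderiv_open0 (U : set pt) phi s : open U -> (forall p, U p -> phi p = 0) ->
  forall p, U p -> pderiv s phi p = 0.
Proof.
move=> oU phi0; elim: s => [|i s IH] p Up; first exact: phi0.
have h : \near p, pderiv s phi p = (cst 0 : pt -> R) p.
  have := open_nbhs_nbhs (conj oU Up); apply: filterS => q /IH; exact.
transitivity ('D_(axis R i) (cst 0 : pt -> R) p); first exact: near_eq_derive.
by rewrite derive_cst.
Qed.

Lemma test_fun_supp D phi s : test_fun D phi -> forall p, ~ D p -> pderiv s phi p = 0.
Proof.
move=> [sphi [K [cK KD K0]]] p nD.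
apply: (@pderiv_open0 (~` K)) => //; last by move=> energy_const; apply: nD; exact: KD.
by apply: closed_openC; apply: compact_closed.
Qed.

Lemma test_funS D D' phi : D `<=` D' -> test_fun D phi -> test_fun D' phi.
Proof.
move=> DD [sphi [K [cK KD K0]]]; split => //; exists K; split=> //.
exact: subset_trans KD DD.
Qed.

Lemma test_fun_pderiv D phi s : test_fun D phi -> test_fun D (pderiv s phi).
Proof.
move=> t; have [sphi [K [cK KD K0]]] := t; split; first exact: smooth_pderiv.
exists K; split=> // p nK; apply: (@pderiv_open0 (~` K)) => //.
by apply: closed_openC; apply: compact_closed.
Qed.

Lemma is_wderivS D D' s u v : measurable D -> measurable D' -> D `<=` D' ->
  is_wderiv D' s u v -> is_wderiv D s u v.
Proof.
move=> mD mD' DD [Lv h]; split; first exact: L2S Lv.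
move=> phi tphi; have := h phi (test_funS DD tphi).
rewrite (@Rintegral_sub _ _ _ (leb3 R) D D')//; last first.
  by move=> p _ nD; rewrite (test_fun_supp s tphi) ?mulr0.
rewrite (@Rintegral_sub _ _ _ (leb3 R) D D')//.
by move=> p _ nD; have /= -> := test_fun_supp [::] tphi nD; rewrite mulr0.
Qed.

(** The derivative [pderiv t phi] of a test function is a test function. *)
Lemma is_wderiv_chain D s t u a b : is_wderiv D s u a -> is_wderiv D (s ++ t) u b ->
  is_wderiv D t a b.
Proof.
move=> [La ha] [Lb hb]; split=> // phi tphi.
have := ha _ (test_fun_pderiv t tphi); have := hb _ tphi.
rewrite pderiv_cat => -> /eqP; rewrite size_cat exprD -mulrA (inj_eq (mulfI _)).
  by move=> /eqP ->.
by rewrite expf_neq0// oppr_eq0 oner_eq0.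
Qed.

Lemma is_wderiv_perm D s t u a : perm_eq s t -> is_wderiv D s u a -> is_wderiv D t u a.
Proof.
move=> st [La h]; split=> // phi tphi.
by have := h phi tphi; rewrite (pderiv_perm tphi.1 st) (perm_size st).
Qed.

Lemma integrable_test B f phi : proper B -> L2 (inbox B) f -> test_fun (inbox B) phi ->
  (leb3 R).-integrable (inbox B) (EFin \o (fun p => f p * phi p)).
Proof. by move=> pB Lf [sphi _]; apply: integrable_smoothM => //; exact: smooth_continuous. Qed.

Lemma is_wderiv_lin B s u v a b (c e : R) : proper B -> L2 (inbox B) u -> L2 (inbox B) v ->
  is_wderiv (inbox B) s u a -> is_wderiv (inbox B) s v b ->
  is_wderiv (inbox B) s (fun p => c * u p + e * v p) (fun p => c * a p + e * b p).
Proof.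
move=> pB Lu Lv [La ha] [Lb hb]; have mB := measurable_inbox B; split.
  exact: (L2D mB (L2Z c mB La) (L2Z e mB Lb)).
move=> phi tphi; have tps := test_fun_pderiv s tphi.
transitivity (\int[leb3 R]_(p in inbox B) (c * (u p * pderiv s phi p) + e * (v p * pderiv s phi p))).
  by apply: eq_Rintegral => p _; ring.
rewrite (Rintegral_lin (mu := leb3 R) mB c e (integrable_test pB Lu tps) (integrable_test pB Lv tps)).
rewrite ha// hb//.
transitivity ((-1) ^+ size s * \int[leb3 R]_(p in inbox B) (c * (a p * phi p) + e * (b p * phi p))).
  rewrite (Rintegral_lin (mu := leb3 R) mB c e (integrable_test pB La tphi) (integrable_test pB Lb tphi)).
  by ring.
by congr (_ * _); apply: eq_Rintegral => p _; ring.
Qed.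

Lemma L2_eq D f g : measurable D -> (forall p, D p -> f p = g p) -> L2 D f -> L2 D g.
Proof.
move=> mD fg [mf f2]; split.
  by apply: eq_measurable_fun mf => p /set_mem; exact: fg.
apply: (eq_integrable (mu := leb3 R) mD _ _ _ f2).
by move=> p /set_mem Dp /=; rewrite fg.
Qed.

Lemma is_wderiv_eq D s u u' v v' : measurable D -> (forall p, D p -> u p = u' p) ->
  (forall p, D p -> v p = v' p) -> is_wderiv D s u v -> is_wderiv D s u' v'.
Proof.
move=> mD uu vv [Lv h]; split; first exact: L2_eq vv Lv.
move=> phi tphi; have := h phi tphi.
under eq_Rintegral => p Dp do rewrite (uu p (set_mem Dp)).
by under [X in _ = _ * X]eq_Rintegral => p Dp do rewrite (vv p (set_mem Dp)).
Qed.

(** Uniqueness is stated in the form in which it is used, tested with smooth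
    functions: by definition both derivatives agree against test functions,
    which are dense. *)
Lemma is_wderiv_unique B s u v v' psi : proper B ->
  is_wderiv (inbox B) s u v -> is_wderiv (inbox B) s u v' -> smooth psi ->
  \int[leb3 R]_(p in inbox B) (v p * psi p) = \int[leb3 R]_(p in inbox B) (v' p * psi p).
Proof.
move=> pB [Lv h] [Lv' h'] spsi; apply: test_dense => // phi tphi.
have := h phi tphi; rewrite h'// => /mulfI e; apply/esym/e.
by rewrite expf_neq0// oppr_eq0 oner_eq0.
Qed.

(** The integral of the trace of v over the face (d, b) ([fint_trace]),
    expressed on the box by Green's formula with the test function (x_d - l')
    / len, where l' is the level of the opposite face. *)
Definition trace_int B d b v dv : R := (len B d)^-1 *
  \int[leb3 R]_(p in inbox B) (v p + dv p * (co p d - level B d (~~ b))).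

Lemma green_axis B d b v dv (F F' : R -> R) : proper B -> L2 (inbox B) v ->
  is_wderiv (inbox B) [:: d] v dv -> smooth1 F -> smooth1 F' ->
  (forall x : R, is_derive x 1 F (F' x)) -> F (level B d (~~ b)) = 0 ->
  \int[leb3 R]_(p in inbox B) (v p * F' (co p d) + dv p * F (co p d)) =
  nsign R b * F (level B d b) * trace_int B d b v dv.
Proof.
move=> pB Lv wdv sF sF' dF F0; pose c := F (level B d b).
have [_ DF] := D_coord d d dF; have [_ Dc] := D_coord d d (fun x : R => is_derive_cst c x 1).
transitivity (\int[leb3 R]_(p in inbox B)
    (v p * 'D_(axis R d) (fun p => F (co p d)) p + dv p * F (co p d))).
  apply: eq_Rintegral => p _; congr (_ * _ + _).
  by have := congr1 (@^~ p) DF; rewrite /= eqxx.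
have DP p : 'D_(axis R d) (fun _ : pt => c) p = 0.
  by have := congr1 (@^~ p) Dc; rewrite /= eqxx.
rewrite (green_interp (b := b) (P := fun=> c) pB Lv wdv (smooth_coord d sF) (smooth_cst c) DP); first last.
- by move=> p ->.
- by move=> p ->.
have i := L2_integrable pB (L2_green d (level B d (~~ b)) Lv wdv.1).
rewrite (RintegralZr (mu := leb3 R) c (measurable_inbox B) i) /trace_int invfM nsignV -/c; ring.
Qed.

End Weak.

(** * Face integrals of traces *)

Section Faces.
Variable R : realType.
Notation pt := (R * R * R)%type.
Implicit Types (B : box R) (D : set pt) (p q : pt) (i j k d : 'I_3) (f g psi v dv u w phi : pt -> R) (s : seq 'I_3).

Definition farea B d : R := len B (lift d ord0) * len B (lift d ord_max).

Lemma farea_gt0 B d : proper B -> 0 < farea B d.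
Proof. by move=> pB; rewrite mulr_gt0 ?len_gt0. Qed.

Lemma prod_axis (F : 'I_3 -> R) d : \prod_i F i = F d * (F (lift d ord0) * F (lift d ord_max)).
Proof.
rewrite (bigD1_ord d)//=; congr (_ * _).
by rewrite big_ord_recl big_ord1; congr (F _ * F _); apply: val_inj.
Qed.

Lemma vol_farea B d : vol B = len B d * farea B d.
Proof. exact: prod_axis. Qed.

Lemma leb2_facedom B d : proper B -> (leb2 R) (facedom B d) = (farea B d)%:E.
Proof.
move=> pB; rewrite facedomE product_measure1E// EFinM.
by congr (_ * _)%E; exact: leb1_itv.
Qed.

Lemma facedom_fin B d : proper B -> ((leb2 R) (facedom B d) < +oo)%E.
Proof. by move=> pB; rewrite leb2_facedom// ltry. Qed.

Lemma fint1 B d b : proper B -> fint B d b (fun=> 1) = farea B d.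
Proof.
move=> pB; rewrite /fint (Rintegral_cst (leb2 R) (measurable_facedom B d)) mul1r.
by rewrite [X in fine X]leb2_facedom.
Qed.

Lemma L2face_integrable B d b g : proper B -> L2face B d b g ->
  (leb2 R).-integrable (facedom B d) (EFin \o (fun y => g (facept B d b y))).
Proof.
move=> pB [mg g2].
exact: (sq_integrable (mu := leb2 R) (measurable_facedom B d) (facedom_fin d pB) mg g2).
Qed.

Lemma trace_int_unique B d b v dv dv' : proper B -> L2 (inbox B) v -> is_wderiv (inbox B) [:: d] v dv ->
  is_wderiv (inbox B) [:: d] v dv' -> trace_int B d b v dv = trace_int B d b v dv'.
Proof.
move=> pB Lv w1 w2; congr (_ * _); have mB := measurable_inbox B.
have slin := smooth_linear d (level B d (~~ b)).
have i0 := L2_integrable pB Lv.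
have i1 := integrable_smoothM pB w1.1 (smooth_continuous slin).
have i2 := integrable_smoothM pB w2.1 (smooth_continuous slin).
rewrite (RintegralD (mu := leb3 R) mB i0 i1) (RintegralD (mu := leb3 R) mB i0 i2).
by congr (_ + _); exact: (is_wderiv_unique pB w1 w2).
Qed.

(** The test function x_d - l' vanishes on the opposite face and is constant
    on the face (d, b). *)
Lemma fint_trace B d b v dv : proper B -> L2 (inbox B) v -> is_wderiv (inbox B) [:: d] v dv ->
  fint B d b (trace B d b v) = trace_int B d b v dv.
Proof.
move=> pB Lv wdv; have := xgetPex (fun=> 0) (trace_exists b pB Lv wdv).
rewrite -/(trace B d b v) => -[Lt [dv' wdv' hg]].
rewrite (trace_int_unique b pB Lv wdv wdv'); set l' := level B d (~~ b).
have z p : co p d = l' -> co p d - l' = 0 by move=> ->; rewrite subrr.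
have := hg _ (smooth_linear d l') z.
rewrite /trace_int -/l'.
have -> : \int[leb3 R]_(p in inbox B) (v p * pderiv [:: d] (fun p0 => co p0 d - l') p + dv' p * (co p d - l'))
  = \int[leb3 R]_(p in inbox B) (v p + dv' p * (co p d - l')).
  by apply: eq_Rintegral => p _; rewrite [pderiv _ _ _]D_linear mulr1.
move=> ->; rewrite /fint.
transitivity ((len B d)^-1 * (nsign R b * \int[leb2 R]_(y in facedom B d) ((nsign R b * len B d) * trace B d b v (facept B d b y)))); last first.
  congr (_ * (_ * _)); apply: eq_Rintegral => y _.
  by rewrite faceptE co_alongax level_diff mulrC.
rewrite (RintegralZl (mu := leb2 R) _ (measurable_facedom B d) (L2face_integrable pB Lt)).
rewrite mulrA mulrA mulrCA -mulrA.
have := len_gt0 d pB => a0; have : nsign R b * nsign R b = 1 by case: b {Lt hg z l' wdv'}; rewrite /nsign; ring.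
by move: (nsign R b) (\int[_]_(_ in _) _) => s I ss; rewrite [RHS](_ : _ = (s * s) * ((len B d)^-1 * len B d) * I); [rewrite ss mulVf ?gt_eqF// !mul1r|ring].
Qed.

Lemma Qface_trace_int B d b v dv : proper B -> L2 (inbox B) v -> is_wderiv (inbox B) [:: d] v dv ->
  Qface B d b v = trace_int B d b v dv / farea B d.
Proof. by move=> pB Lv wdv; rewrite /Qface /fmean fint1// (fint_trace b pB Lv wdv). Qed.

Definition sethi B d (m : R) : box R := Box (lo B) (fun i => if i == d then m else hi B i).
Definition setlo B d (m : R) : box R := Box (fun i => if i == d then m else lo B i) (hi B).

Lemma proper_sethi B d m : proper B -> lo B d < m -> proper (sethi B d m).
Proof. by move=> pB lm i /=; case: eqP => [->|_] //; exact: pB. Qed.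

Lemma proper_setlo B d m : proper B -> m < hi B d -> proper (setlo B d m).
Proof. by move=> pB lm i /=; case: eqP => [->|_] //; exact: pB. Qed.

Lemma inbox_sethi B d m : m <= hi B d -> inbox (sethi B d m) `<=` inbox B.
Proof.
move=> mh p h i; have := h i; rewrite /=; case: eqP => [->|_] // /andP[-> h2].
exact: lt_le_trans h2 mh.
Qed.

Lemma inbox_setlo B d m : lo B d <= m -> inbox (setlo B d m) `<=` inbox B.
Proof.
move=> mh p h i; have := h i; rewrite /=; case: eqP => [->|_] // /andP[h2 ->].
by rewrite (le_lt_trans mh h2).
Qed.

(** The part of the box outside the two halves is a null set because their
    volumes add up to that of the box. *)
Lemma box_split B d m f : proper B -> lo B d < m < hi B d ->
  (leb3 R).-integrable (inbox B) (EFin \o f) ->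
  \int[leb3 R]_(p in inbox B) f p =
  \int[leb3 R]_(p in inbox (sethi B d m)) f p + \int[leb3 R]_(p in inbox (setlo B d m)) f p.
Proof.
move=> pB /andP[lm mh] fi.
set D1 := inbox (sethi B d m); set D2 := inbox (setlo B d m).
have m1 : measurable (D1 : set pt) by exact: measurable_inbox.
have m2 : measurable (D2 : set pt) by exact: measurable_inbox.
have mB := measurable_inbox B.
have dis : [disjoint D1 & D2].
  apply/disj_setPS => p [h1 h2]; have /andP[_ /=] := h1 d; have /andP[/= + _] := h2 d.
  by rewrite eqxx => a b; have := lt_trans a b; rewrite ltxx.
have sub : D1 `|` D2 `<=` inbox B.
  by move=> p [/inbox_sethi|/inbox_setlo]; apply; exact: ltW.
set N := inbox B `\` (D1 `|` D2).
have m12 := measurableU _ _ m1 m2.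
have mN : measurable (N : set pt) by exact: measurableD.
have N0 : (leb3 R) N = 0%E.
  rewrite measureD//; last exact: leb3_inbox_fin.
  rewrite setIC (setIidl sub) measureU//; last by apply/disj_set2P.
  rewrite [X in (X - _)%E]leb3_inbox//.
  rewrite [X in (_ - (X + _))%E]leb3_inbox; last exact: proper_sethi.
  rewrite [X in (_ - (_ + X))%E]leb3_inbox; last exact: proper_setlo.
  transitivity (vol B - (vol (sethi B d m) + vol (setlo B d m)))%:E; first by [].
  congr EFin.
  rewrite !(vol_farea _ d) /farea /len /= eqxx ![_ == d]eq_sym !(negbTE (neq_lift _ _)).
  ring.
have BE : inbox B = (D1 `|` D2) `|` N by rewrite setDUK.
rewrite {1}BE Rintegral_setU//; last 2 first.
- by rewrite -BE.
- by rewrite disj_set2E setDIK.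
rewrite Rintegral_setU//; last exact: (integrableS (mu := leb3 R) mB m12 sub fi).
have Nsub : N `<=` inbox B by move=> p [].
have iN := integrableS (mu := leb3 R) mB mN Nsub fi.
rewrite [X in _ + X](_ : _ = 0) ?addr0// /Rintegral.
by rewrite (null_set_integral (mu := leb3 R) mN (measurable_int _ iN) N0).
Qed.

End Faces.

(** * Traces on adjacent boxes *)

Section Adjacent.
Variable R : realType.
Notation pt := (R * R * R)%type.
Implicit Types (B C : box R) (D : set pt) (p q : pt) (i j k d : 'I_3) (f g psi v dv u w phi : pt -> R) (s : seq 'I_3).

Definition quad (a b t : R) : R := (t - a) * (t - b).
Definition quad' (a b t : R) : R := (t - a) + (t - b).

Lemma smooth1_shift (a : R) : smooth1 (fun t : R => t - a).
Proof. exact: (smooth1D (smooth1_id R) (smooth1_cst (- a))). Qed.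

Lemma smooth1_quad (a b : R) : smooth1 (quad a b).
Proof. exact: (smooth1M (smooth1_shift a) (smooth1_shift b)). Qed.

Lemma smooth1_quad' (a b : R) : smooth1 (quad' a b).
Proof. exact: (smooth1D (smooth1_shift a) (smooth1_shift b)). Qed.

Lemma is_derive_shiftl (a t : R) : is_derive t 1 (fun t : R => t - a) 1.
Proof.
have h := is_deriveB (is_derive_id t 1) (is_derive_cst a t 1).
by apply: is_derive_eq h _; rewrite subr0.
Qed.

Lemma is_derive_quad (a b t : R) : is_derive t 1 (quad a b) (quad' a b t).
Proof.
have h := is_deriveM (is_derive_shiftl a t) (is_derive_shiftl b t).
by apply: is_derive_eq h _; rewrite /GRing.scale/= !mulr1.
Qed.

Lemma green_quad B d b v dv (a c : R) : proper B -> L2 (inbox B) v ->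
  is_wderiv (inbox B) [:: d] v dv -> quad a c (level B d (~~ b)) = 0 ->
  \int[leb3 R]_(p in inbox B) (v p * quad' a c (co p d) + dv p * quad a c (co p d)) =
  nsign R b * quad a c (level B d b) * trace_int B d b v dv.
Proof.
move=> pB Lv wdv z.
exact: (green_axis pB Lv wdv (smooth1_quad a c) (smooth1_quad' a c) (is_derive_quad a c) z).
Qed.

Lemma green_quad_int B d v dv (a c : R) : proper B -> L2 (inbox B) v -> L2 (inbox B) dv ->
  (leb3 R).-integrable (inbox B) (EFin \o (fun p => v p * quad' a c (co p d) + dv p * quad a c (co p d))).
Proof.
move=> pB Lv Ldv; have mB := measurable_inbox B.
have i1 := integrable_smoothM pB Lv (smooth_continuous (smooth_coord d (smooth1_quad' a c))).
have i2 := integrable_smoothM pB Ldv (smooth_continuous (smooth_coord d (smooth1_quad a c))).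
exact: (integrableD (mu := leb3 R) mB i1 i2).
Qed.

Lemma wderiv_sethi B d m s v dv : proper B -> m <= hi B d -> is_wderiv (inbox B) s v dv ->
  is_wderiv (inbox (sethi B d m)) s v dv.
Proof.
by move=> pB mh; apply: is_wderivS; [exact: measurable_inbox|exact: measurable_inbox|exact: inbox_sethi].
Qed.

Lemma wderiv_setlo B d m s v dv : proper B -> lo B d <= m -> is_wderiv (inbox B) s v dv ->
  is_wderiv (inbox (setlo B d m)) s v dv.
Proof.
by move=> pB mh; apply: is_wderivS; [exact: measurable_inbox|exact: measurable_inbox|exact: inbox_setlo].
Qed.

Lemma L2_sethi B d m f : m <= hi B d -> L2 (inbox B) f -> L2 (inbox (sethi B d m)) f.
Proof. by move=> h; apply: L2S; [exact: measurable_inbox|exact: measurable_inbox|exact: inbox_sethi]. Qed.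

Lemma L2_setlo B d m f : lo B d <= m -> L2 (inbox B) f -> L2 (inbox (setlo B d m)) f.
Proof. by move=> h; apply: L2S; [exact: measurable_inbox|exact: measurable_inbox|exact: inbox_setlo]. Qed.

Section Split.
Variables (B : box R) (d : 'I_3) (m : R) (v dv : pt -> R).
Hypotheses (pB : proper B) (lm : lo B d < m) (mh : m < hi B d)
  (Lv : L2 (inbox B) v) (wdv : is_wderiv (inbox B) [:: d] v dv).

Let B1 := sethi B d m.
Let B2 := setlo B d m.
Let p1 : proper B1 := proper_sethi pB lm.
Let p2 : proper B2 := proper_setlo pB mh.
Let L1 : L2 (inbox B1) v := L2_sethi (ltW mh) Lv.
Let L2_ : L2 (inbox B2) v := L2_setlo (ltW lm) Lv.
Let w1 : is_wderiv (inbox B1) [:: d] v dv := wderiv_sethi pB (ltW mh) wdv.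
Let w2 : is_wderiv (inbox B2) [:: d] v dv := wderiv_setlo pB (ltW lm) wdv.

Let splitq (a c : R) := @box_split R B d m _ pB (introT andP (conj lm mh)) (green_quad_int d a c pB Lv wdv.1).

Let l1 : level B1 d true = m. Proof. by rewrite /= eqxx. Qed.
Let l2 : level B2 d false = m. Proof. by rewrite /= eqxx. Qed.

(** Green's formula with the quadratic polynomial that vanishes at both ends
    of B, on B and on its two halves: only the terms on the common face
    remain, and they have opposite signs. *)
Lemma trace_int_adjacent : trace_int B1 d true v dv = trace_int B2 d false v dv.
Proof.
pose a := lo B d; pose c := hi B d.
have qa : quad a c a = 0 by rewrite /quad subrr mul0r.
have qc : quad a c c = 0 by rewrite /quad subrr mulr0.
have := splitq a c.
rewrite (@green_quad B d true)// (@green_quad B1 d true)// (@green_quad B2 d false)//.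
rewrite l1 l2 [level B d true]/= qc /nsign !mulr0 mul0r mul1r mulN1r mulNr.
have qm : quad a c m != 0 by rewrite /quad mulf_neq0// subr_eq0 ?(gt_eqF lm) ?(lt_eqF mh).
by move=> /esym/eqP; rewrite subr_eq0 => /eqP /(mulfI qm).
Qed.

(** As for [trace_int_adjacent], but with the polynomial that vanishes on the
    cutting plane and on the opposite face, so that only the face that B and
    its half share remains. *)
Lemma trace_int_sethi : trace_int B d false v dv = trace_int B1 d false v dv.
Proof.
pose a := m; pose c := hi B d.
have qa : quad a c a = 0 by rewrite /quad subrr mul0r.
have qc : quad a c c = 0 by rewrite /quad subrr mulr0.
have := splitq a c.
rewrite (@green_quad B d false)// (@green_quad B1 d false) ?[level _ _ _]l1// (@green_quad B2 d false)//.
rewrite l2 qa mulr0 mul0r addr0.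
have ql : nsign R false * quad a c (lo B d) != 0.
  by rewrite mulf_neq0 ?nsign_neq0// /quad mulf_neq0// subr_eq0 ?(lt_eqF lm) ?(lt_eqF (lt_trans lm mh)).
exact: (mulfI ql).
Qed.

Lemma trace_int_setlo : trace_int B d true v dv = trace_int B2 d true v dv.
Proof.
pose a := m; pose c := lo B d.
have qa : quad a c a = 0 by rewrite /quad subrr mul0r.
have qc : quad a c c = 0 by rewrite /quad subrr mulr0.
have := splitq a c.
rewrite (@green_quad B d true)// (@green_quad B1 d true)// (@green_quad B2 d true) ?[level _ _ _]l2//.
rewrite l1 qa mulr0 mul0r add0r.
have ql : nsign R true * quad a c (hi B d) != 0.
  by rewrite mulf_neq0 ?nsign_neq0// /quad mulf_neq0// subr_eq0 ?(gt_eqF mh) ?(gt_eqF (lt_trans lm mh)).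
exact: (mulfI ql).
Qed.

End Split.

(** Cut-off in the two directions orthogonal to [d], constant along [d]. *)
Definition chi d C n p : R := \prod_i (if i == d then 1 else cut n (lo C i) (hi C i) (co p i)).

Lemma smooth_chi d C n : smooth (chi d C n).
Proof.
apply: smooth_prod => i; case: eqP => _; first exact: smooth_cst.
by apply: smooth_coord; exact: smooth1_cut.
Qed.

Lemma chi01 d C n p : 0 <= chi d C n p <= 1.
Proof.
apply: (big_ind (fun x : R => 0 <= x <= 1)) => [|x y /andP[x0 x1] /andP[y0 y1]|i _].
- by rewrite ler01 lexx.
- by rewrite mulr_ge0// mulr_ile1.
- by case: eqP => _; rewrite ?ler01 ?lexx// cut_ge0 cut_le1.
Qed.

Lemma chi_norm d C n p : `|chi d C n p| <= 1.
Proof. by have /andP[h0 h1] := chi01 d C n p; rewrite ger0_norm. Qed.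

Lemma chi_axis d C n p : chi d C n p =
  cut n (lo C (lift d ord0)) (hi C (lift d ord0)) (co p (lift d ord0)) *
  cut n (lo C (lift d ord_max)) (hi C (lift d ord_max)) (co p (lift d ord_max)).
Proof.
by rewrite /chi (prod_axis _ d) eqxx mul1r ![_ == d]eq_sym !(negbTE (neq_lift _ _)).
Qed.

Lemma chi_cvg d C p : lo C (lift d ord0) < co p (lift d ord0) < hi C (lift d ord0) ->
  lo C (lift d ord_max) < co p (lift d ord_max) < hi C (lift d ord_max) ->
  chi d C n p @[n --> \oo] --> (1 : R).
Proof.
move=> h1 h2; under eq_fun do rewrite chi_axis.
have h := cvgM (cut_cvg h1) (cut_cvg h2).
by have {}h := h _ _; rewrite mulr1 in h; exact: h.
Qed.

Lemma chi_out d C n p : ~ (lo C (lift d ord0) < co p (lift d ord0) < hi C (lift d ord0) /\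
  lo C (lift d ord_max) < co p (lift d ord_max) < hi C (lift d ord_max)) -> chi d C n p = 0.
Proof.
have c0 k : ~ (lo C k < co p k < hi C k) -> cut n (lo C k) (hi C k) (co p k) = 0.
  move=> h; apply: cut_out; have [|h1] := leP (co p k) (lo C k); first by left.
  by right; rewrite leNgt; apply/negP => h2; apply: h; rewrite h1 h2.
by move=> /not_andP[/c0|/c0] h; rewrite chi_axis h ?mul0r ?mulr0.
Qed.

Lemma D_chi d C n p : 'D_(axis R d) (chi d C n) p = 0.
Proof.
have [] // := @is_derive_line _ (chi d C n) p d 0 _.
rewrite [X in is_derive _ _ X _](_ : _ = cst (chi d C n p)); first exact: is_derive_cst.
apply/funext => t; rewrite !chi_axis !co_setco.
by rewrite ![_ == d]eq_sym !(negbTE (neq_lift _ _)).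
Qed.

End Adjacent.

(** * Traces on the boundary of the cube *)

Section Boundary.
Variable R : realType.
Notation pt := (R * R * R)%type.
Implicit Types (B C : box R) (D : set pt) (p q : pt) (i j k d : 'I_3) (f g psi v dv u du w phi : pt -> R) (s : seq 'I_3).

Definition subunit B := forall i, 0 <= lo B i /\ hi B i <= 1.

Lemma proper_cube : proper (cube R).
Proof. by move=> i /=; exact: ltr01. Qed.

Lemma inbox_Omega B : subunit B -> inbox B `<=` @Omega R.
Proof.
move=> sB p h i /=; have /andP[h1 h2] := h i; have [b1 b2] := sB i.
by rewrite (le_lt_trans b1 h1) (lt_le_trans h2 b2).
Qed.

(** C is a column that joins two opposite faces of the cube. The Green formula
    that defines the trace g is tested with (x_d - l') times the cut-off [chi]
    of C; as the cut-offs tend to the indicator function of C, both sides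
    converge. *)
Lemma column_trace C d b u du g : proper C -> subunit C -> lo C d = 0 -> hi C d = 1 ->
  L2 (@Omega R) u -> is_wderiv (@Omega R) [:: d] u du -> is_trace (cube R) d b u g ->
  fint C d b g = trace_int C d b u du.
Proof.
move=> pC sC lC hC Lu wdu [Lg [du' wdu' hg]].
have measurable_Omega : measurable (@Omega R : set pt) by exact: measurable_inbox.
have mC := measurable_inbox C.
have CO := inbox_Omega sC.
have LuC : L2 (inbox C) u by exact: L2S Lu.
have wC : is_wderiv (inbox C) [:: d] u du by exact: is_wderivS wdu.
have wC' : is_wderiv (inbox C) [:: d] u du' by exact: is_wderivS wdu'.
rewrite (trace_int_unique b pC LuC wC wC').
have lvl b' : level C d b' = level (cube R) d b' by case: b' => /=; rewrite ?lC ?hC.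
set L' := level C d (~~ b).
pose w p := u p + du' p * (co p d - L').
have Lw : L2 (inbox C) w by exact: L2_green LuC wC'.1.
pose phi n p := chi d C n p * (co p d - L').
have sphi n : smooth (phi n) by exact: (smoothM (smooth_chi d C n) (smooth_linear d L')).
have Dphi n p : pderiv [:: d] (phi n) p = chi d C n p.
  rewrite /= (DaxisM d p (smooth_chi d C n) (smooth_linear d L')) D_chi D_linear.
  by rewrite mulr1 mulr0 addr0.
have zphi n p : co p d = level (cube R) d (~~ b) -> phi n p = 0.
  by move=> e; rewrite /phi e -lvl subrr mulr0.
have fc y : facept (cube R) d b y = facept C d b y by rewrite !faceptE lvl.
have chiD n y : ~ facedom C d y -> chi d C n (facept C d b y) = 0.
  by move=> nD; apply: chi_out; rewrite faceptE co_alongax0 co_alongax1.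
have sub2 : facedom C d `<=` facedom (cube R) d.
  move=> y [/andP[a1 a2] /andP[a3 a4]]; have [b1 b2] := sC (lift d ord0); have [b3 b4] := sC (lift d ord_max).
  by rewrite /facedom /= (le_lt_trans b1 a1) (lt_le_trans a2 b2) (le_lt_trans b3 a3) (lt_le_trans a4 b4).
have mf := measurable_facedom C d.
have ig : (leb2 R).-integrable (facedom C d) (EFin \o (fun y => g (facept C d b y))).
  have ig0 := L2face_integrable proper_cube Lg.
  have := integrableS (mu := leb2 R) (measurable_facedom (cube R) d) mf sub2 ig0.
  by apply: eq_integrable => // y _ /=; rewrite fc.
have E n : \int[leb3 R]_(p in inbox C) (w p * chi d C n p) =
   \int[leb2 R]_(y in facedom C d) (len C d * g (facept C d b y) * chi d C n (facept C d b y)).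
  have := hg (phi n) (sphi n) (zphi n).
  have -> : \int[leb3 R]_(p in inbox (cube R)) (u p * pderiv [:: d] (phi n) p + du' p * phi n p)
     = \int[leb3 R]_(p in inbox C) (w p * chi d C n p).
    rewrite (@Rintegral_sub _ _ _ (leb3 R) (inbox C) (inbox (cube R)))//; last first.
      move=> p Op nC; rewrite Dphi /phi.
      have -> : chi d C n p = 0; last by rewrite mul0r !mulr0 addr0.
      apply: chi_out => -[h1 h2]; apply: nC => i.
      by case: (axis_cases d i) => ->//; rewrite lC hC; exact: Op.
    by apply: eq_Rintegral => p _; rewrite Dphi /phi /w; ring.
  move=> ->; rewrite /fint.
  rewrite (@Rintegral_sub _ _ _ (leb2 R) (facedom C d))//; last first.
    by move=> y _ nD; rewrite fc /phi chiD// mul0r mulr0.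
  have nn : nsign R b * nsign R b = 1 by case: (b); rewrite /nsign; ring.
  have ichi : (leb2 R).-integrable (facedom C d) (EFin \o (fun y => g (facept C d b y) * phi n (facept C d b y))).
    have mphi : measurable_fun (facedom C d) (fun y => phi n (facept C d b y)).
      by apply: measurable_facept; exact: smooth_continuous.
    apply: (integrable_bdM (mu := leb2 R) mf ig mphi (M := 1 * `|len C d|)) => y _.
    rewrite /phi normrM ler_pM ?chi_norm// faceptE co_alongax /L' level_diff normrM.
    by rewrite -[leRHS]mul1r ler_wpM2r// /nsign; case: (b); rewrite ?normrN normr1.
  under eq_Rintegral do rewrite fc.
  rewrite -(RintegralZl (mu := leb2 R) (nsign R b) mf ichi).
  apply: eq_Rintegral => y _; rewrite /phi faceptE co_alongax /L' level_diff.
  by rewrite -[RHS]mul1r -nn; ring.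
have cw : \int[leb3 R]_(p in inbox C) (w p * chi d C n p) @[n --> \oo] -->
    \int[leb3 R]_(p in inbox C) (w p * 1).
  apply: (Rintegral_bdd_cvg (mu := leb3 R) mC (p_ := chi d C) (p := fun=> 1) (M := 1) (L2_integrable pC Lw)).
  - by move=> n; apply: continuous_measurable3 => //; exact: (smooth_continuous (smooth_chi d C n)).
  - by move=> n p _; exact: chi_norm.
  - by move=> p Cp; apply: chi_cvg; exact: Cp.
have ilg : (leb2 R).-integrable (facedom C d) (EFin \o (fun y => len C d * g (facept C d b y))).
  exact: (integrableZl (mu := leb2 R) mf (len C d) ig).
have cg : \int[leb2 R]_(y in facedom C d) (len C d * g (facept C d b y) * chi d C n (facept C d b y)) @[n --> \oo] -->
    \int[leb2 R]_(y in facedom C d) (len C d * g (facept C d b y) * 1).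
  apply: (Rintegral_bdd_cvg (mu := leb2 R) mf (p_ := fun n y => chi d C n (facept C d b y)) (p := fun=> 1) (M := 1) ilg).
  - by move=> n; apply: measurable_facept; exact: (smooth_continuous (smooth_chi d C n)).
  - by move=> n y _; exact: chi_norm.
  - by move=> y [h1 h2]; apply: chi_cvg; rewrite faceptE ?co_alongax0 ?co_alongax1.
rewrite (funext E) in cw; have e : \int[leb3 R]_(p in inbox C) (w p * 1) =
    \int[leb2 R]_(y in facedom C d) (len C d * g (facept C d b y) * 1).
  exact: (cvg_unique _ cw cg).
have {}e : \int[leb3 R]_(p in inbox C) w p = len C d * fint C d b g.
  rewrite /fint -(RintegralZl (mu := leb2 R) (len C d) mf ig).
  transitivity (\int[leb3 R]_(p in inbox C) (w p * 1)).
    by apply: eq_Rintegral => p _; rewrite mulr1.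
  by rewrite e; apply: eq_Rintegral => y _; rewrite mulr1.
by rewrite /trace_int -/L' e mulKf// gt_eqF// len_gt0.
Qed.

Lemma box_eq B C : (forall i, lo B i = lo C i) -> (forall i, hi B i = hi C i) -> B = C.
Proof. by case: B C => lB hB [lC hC] /= /funext -> /funext ->. Qed.

(** B is extended to a column that joins two opposite faces of the cube, to
    which [column_trace] applies; [trace_int_sethi] and [trace_int_setlo] show
    that the extension does not change [trace_int]. *)
Lemma boundary_trace B d b u du g : proper B -> subunit B -> level B d b = level (cube R) d b ->
  L2 (@Omega R) u -> is_wderiv (@Omega R) [:: d] u du -> is_trace (cube R) d b u g ->
  fint B d b g = trace_int B d b u du.
Proof.
move=> pB sB lB Lu wdu tg.
pose C := Box (fun i => if i == d then 0 else lo B i) (fun i => if i == d then 1 else hi B i).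
have pC : proper C by move=> i /=; case: eqP => _; [exact: ltr01|exact: pB].
have sC : subunit C by move=> i /=; case: eqP => _; [rewrite !lexx|exact: sB].
have lC : lo C d = 0 by rewrite /= eqxx.
have hC : hi C d = 1 by rewrite /= eqxx.
have measurable_Omega : measurable (@Omega R : set pt) by exact: measurable_inbox.
have mC := measurable_inbox C.
have CO := inbox_Omega sC.
have LuC : L2 (inbox C) u by exact: L2S Lu.
have wC : is_wderiv (inbox C) [:: d] u du by exact: is_wderivS wdu.
have ljd (j : 'I_2) : (lift d j == d) = false by rewrite eq_sym (negbTE (neq_lift _ _)).
have -> : fint B d b g = fint C d b g.
  have -> : fint C d b g = \int[leb2 R]_(y in facedom B d) g (facept C d b y).
    by rewrite /fint /facedom /= !ljd.
  apply: eq_Rintegral => y _; rewrite !faceptE lB; congr (g (alongax d (y, _))).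
  by case: (b); rewrite /= eqxx.
rewrite (column_trace pC sC lC hC Lu wdu tg).
case: b lB {tg} => /= lB.
- have [l0|l0] := eqVneq (lo B d) 0.
    by congr trace_int; apply: box_eq => i /=; case: eqP => // ->.
  have l0' : 0 < lo B d by rewrite lt_neqAle eq_sym l0; case: (sB d).
  have h1 : lo C d < lo B d by rewrite lC.
  have h2 : lo B d < hi C d by rewrite hC -lB; exact: pB.
  rewrite (trace_int_setlo pC h1 h2 LuC wC).
  by congr trace_int; apply: box_eq => i /=; case: eqP => // ->.
- have [l0|l0] := eqVneq (hi B d) 1.
    by congr trace_int; apply: box_eq => i /=; case: eqP => // ->.
  have l0' : hi B d < 1 by rewrite lt_neqAle l0; case: (sB d).
  have h1 : lo C d < hi B d by rewrite lC -lB; exact: pB.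
  have h2 : hi B d < hi C d by rewrite hC.
  rewrite (trace_int_sethi pC h1 h2 LuC wC).
  by congr trace_int; apply: box_eq => i /=; case: eqP => // ->.
Qed.

End Boundary.

(** * Averages over a box *)

Section Averages.
Variable R : realType.
Notation pt := (R * R * R)%type.
Implicit Types (B : box R) (p q : pt) (i j k d : 'I_3) (f g v dv : pt -> R).

Definition mid B d : R := (lo B d + hi B d) / 2.
Definition avg B f : R := (\int[leb3 R]_(p in inbox B) f p) / vol B.

Lemma avg_eq B f g : (forall p, inbox B p -> f p = g p) -> avg B f = avg B g.
Proof.
by move=> fg; congr (_ / _); apply: eq_Rintegral => p /set_mem; exact: fg.
Qed.

Lemma avg_lin B f g (a b : R) : proper B -> L2 (inbox B) f -> L2 (inbox B) g ->
  avg B (fun p => a * f p + b * g p) = a * avg B f + b * avg B g.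
Proof.
move=> pB Lf Lg; rewrite /avg.
rewrite (Rintegral_lin (mu := leb3 R) (measurable_inbox B) a b (L2_integrable pB Lf) (L2_integrable pB Lg)).
by rewrite mulrDl !mulrA.
Qed.

Lemma avgD B f g : proper B -> L2 (inbox B) f -> L2 (inbox B) g ->
  avg B (fun p => f p + g p) = avg B f + avg B g.
Proof.
move=> pB Lf Lg; have := avg_lin 1 1 pB Lf Lg; rewrite !mul1r => <-.
by apply: avg_eq => p _; rewrite !mul1r.
Qed.

Lemma avgZ B f (a : R) : proper B -> L2 (inbox B) f ->
  avg B (fun p => a * f p) = a * avg B f.
Proof.
move=> pB Lf; have := avg_lin a 0 pB Lf Lf; rewrite mul0r addr0 => <-.
by apply: avg_eq => p _; rewrite mul0r addr0.
Qed.

Lemma L2_sum B (I : Type) (r : seq I) (F : I -> pt -> R) : proper B ->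
  (forall a, L2 (inbox B) (F a)) -> L2 (inbox B) (fun p => \sum_(a <- r) F a p).
Proof.
move=> pB LF; have mB := measurable_inbox B; elim: r => [|a r IH].
  apply: (L2_eq mB _ (L2_cst 0 mB (leb3_inbox_fin pB))) => p _.
  by rewrite big_nil.
apply: (L2_eq mB _ (L2D mB (LF a) IH)) => p _.
by rewrite big_cons.
Qed.

Lemma avg_sum B (I : Type) (r : seq I) (F : I -> pt -> R) : proper B ->
  (forall a, L2 (inbox B) (F a)) ->
  avg B (fun p => \sum_(a <- r) F a p) = \sum_(a <- r) avg B (F a).
Proof.
move=> pB LF; have mB := measurable_inbox B; elim: r => [|a r IH].
  rewrite big_nil (@avg_eq _ _ (fun=> 0)); last by move=> p _; rewrite big_nil.
  by rewrite /avg (Rintegral_cst (leb3 R) mB) !mul0r.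
rewrite big_cons -IH -avgD//; last exact: L2_sum.
by apply: avg_eq => p _; rewrite big_cons.
Qed.

(** The cubic polynomial that vanishes at both ends and at the midpoint,
    normalized so that [quad = 2 cub' - len^2 / 6]: in an average against
    [quad] it isolates the mean value from a remainder with one more
    derivative. *)
Definition cub (B : box R) d (t : R) : R := 6^-1 * (quad (lo B d) (hi B d) t * (t - mid B d)).
Definition cub' (B : box R) d (t : R) : R :=
  6^-1 * (quad (lo B d) (hi B d) t + quad' (lo B d) (hi B d) t * (t - mid B d)).

Lemma smooth1_cub B d : smooth1 (cub B d).
Proof.
exact: (smooth1M (smooth1_cst _) (smooth1M (smooth1_quad _ _) (smooth1_shift _))).
Qed.

Lemma smooth1_cub' B d : smooth1 (cub' B d).
Proof.
exact: (smooth1M (smooth1_cst _) (smooth1D (smooth1_quad _ _)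
  (smooth1M (smooth1_quad' _ _) (smooth1_shift _)))).
Qed.

Lemma is_derive_cub B d (t : R) : is_derive t 1 (cub B d) (cub' B d t).
Proof.
have h := is_deriveZ (6^-1 : R) (is_deriveM (is_derive_quad (lo B d) (hi B d) t)
  (is_derive_shiftl (mid B d) t)).
by apply: is_derive_eq h _; rewrite /GRing.scale/= /cub' mulr1 (mulrC (quad' _ _ _)).
Qed.

Lemma quad_ends B d b : quad (lo B d) (hi B d) (level B d b) = 0.
Proof. by case: b; rewrite /quad /= subrr ?mul0r ?mulr0. Qed.

Lemma avg_ibp B d v dv (F F' : R -> R) : proper B -> L2 (inbox B) v ->
  is_wderiv (inbox B) [:: d] v dv -> smooth1 F -> smooth1 F' ->
  (forall x : R, is_derive x 1 F (F' x)) -> F (lo B d) = 0 -> F (hi B d) = 0 ->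
  avg B (fun p => v p * F' (co p d)) = - avg B (fun p => dv p * F (co p d)).
Proof.
move=> pB Lv wdv sF sF' dF F0 F1; have mB := measurable_inbox B.
have h := green_axis (b := true) pB Lv wdv sF sF' dF F0.
rewrite /= F1 mulr0 mul0r in h.
have L1 := L2_smoothM Lv (smooth_continuous (smooth_coord d sF')).
have L2_ := L2_smoothM wdv.1 (smooth_continuous (smooth_coord d sF)).
have := avgD pB L1 L2_; rewrite /avg h mul0r => /esym/eqP.
by rewrite addr_eq0 => /eqP.
Qed.

Lemma avg_ibp_linear B d v dv : proper B -> L2 (inbox B) v ->
  is_wderiv (inbox B) [:: d] v dv ->
  avg B (fun p => v p * (co p d - mid B d)) =
  - (2^-1 * avg B (fun p => dv p * quad (lo B d) (hi B d) (co p d))).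
Proof.
move=> pB Lv wdv.
have h := avg_ibp pB Lv wdv (smooth1_quad _ _) (smooth1_quad' _ _)
   (is_derive_quad (lo B d) (hi B d)) (quad_ends B d false) (quad_ends B d true).
have Ll := L2_smoothM Lv (smooth_continuous (smooth_linear d (mid B d))).
have -> : avg B (fun p => v p * (co p d - mid B d)) =
   2^-1 * avg B (fun p => v p * quad' (lo B d) (hi B d) (co p d)).
  rewrite -avgZ//; last first.
    exact: (L2_smoothM Lv (smooth_continuous (smooth_coord d (smooth1_quad' _ _)))).
  by apply: avg_eq => p _; rewrite /quad' /mid; field.
by rewrite h mulrN.
Qed.

Lemma avg_ibp_quad B d v dv : proper B -> L2 (inbox B) v ->
  is_wderiv (inbox B) [:: d] v dv ->
  avg B (fun p => v p * quad (lo B d) (hi B d) (co p d)) =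
  - (6^-1 * len B d ^+ 2 * avg B v) - 2 * avg B (fun p => dv p * cub B d (co p d)).
Proof.
move=> pB Lv wdv.
have c0 b : cub B d (level B d b) = 0 by rewrite /cub quad_ends mul0r mulr0.
have h := avg_ibp pB Lv wdv (smooth1_cub B d) (smooth1_cub' B d) (is_derive_cub B d)
  (c0 false) (c0 true).
have L' := L2_smoothM Lv (smooth_continuous (smooth_coord d (smooth1_cub' B d))).
have -> : avg B (fun p => v p * quad (lo B d) (hi B d) (co p d)) =
  2 * avg B (fun p => v p * cub' B d (co p d)) + - (6^-1 * len B d ^+ 2) * avg B v.
  rewrite -avg_lin//; apply: avg_eq => p _.
  by rewrite /cub' /quad' /quad /mid /len; field.
by rewrite h; ring.
Qed.

(** [trace_int] rewritten around the midpoint of the box. Every face average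
    in the error analysis is expanded in this way. *)
Lemma Qface_avg B d b v dv : proper B -> L2 (inbox B) v -> is_wderiv (inbox B) [:: d] v dv ->
  Qface B d b v = avg B v + avg B (fun p => dv p * (co p d - mid B d)) +
    nsign R b * (len B d / 2) * avg B dv.
Proof.
move=> pB Lv wdv; have Ldv := wdv.1.
have Ll := L2_smoothM Ldv (smooth_continuous (smooth_linear d (mid B d))).
rewrite (Qface_trace_int b pB Lv wdv).
have -> : trace_int B d b v dv / farea B d = avg B (fun p => v p + dv p * (co p d - level B d (~~ b))).
  by rewrite /trace_int /avg (vol_farea B d) (invfM (len B d)) mulrAC mulrC.
rewrite -addrA -avgZ// -avgD//; last exact: (L2Z _ (measurable_inbox B) Ldv).
rewrite -avgD//; last exact: (L2D (measurable_inbox B) Ll (L2Z _ (measurable_inbox B) Ldv)).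
apply: avg_eq => p _; congr (_ + _).
by case: b; rewrite /level /mid /len /nsign /=; field.
Qed.

Lemma Qface_diff B d v dv : proper B -> L2 (inbox B) v -> is_wderiv (inbox B) [:: d] v dv ->
  Qface B d true v - Qface B d false v = len B d * avg B dv.
Proof.
by move=> pB Lv wdv; rewrite !(Qface_avg _ pB Lv wdv) /nsign; field.
Qed.

Lemma Qface_mean B d v dv : proper B -> L2 (inbox B) v -> is_wderiv (inbox B) [:: d] v dv ->
  (Qface B d true v + Qface B d false v) / 2 = avg B v + avg B (fun p => dv p * (co p d - mid B d)).
Proof.
by move=> pB Lv wdv; rewrite !(Qface_avg _ pB Lv wdv) /nsign; field.
Qed.

Lemma avg_bound B f g (M : R) : proper B -> L2 (inbox B) f -> continuous g -> 0 <= M ->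
  (forall p, inbox B p -> `|g p| <= M) ->
  `|avg B (fun p => f p * g p)| <= M * Num.sqrt (avg B (fun p => f p ^+ 2)).
Proof.
move=> pB Lf cg M0 gM; have Lfg := L2_smoothM Lf cg.
have v0 := vol_gt0 pB; have mB := measurable_inbox B.
have := Rintegral_sq_le (mu := leb3 R) mB (leb3_inbox_fin pB) Lfg.1 Lfg.2.
rewrite [X in fine X]leb3_inbox// [fine _]/= => h.
have i1 : \int[leb3 R]_(p in inbox B) ((f p * g p) ^+ 2) <= M ^+ 2 * \int[leb3 R]_(p in inbox B) (f p ^+ 2).
  rewrite -(RintegralZl (mu := leb3 R) _ mB Lf.2).
  apply: (le_Rintegral (mu := leb3 R) mB Lfg.2 (integrableZl (mu := leb3 R) mB (M ^+ 2) Lf.2)).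
  move=> p Bp; rewrite exprMn mulrC ler_wpM2r ?sqr_ge0//.
  rewrite -(real_normK (num_real (g p))).
  by have := gM p Bp; have := normr_ge0 (g p); nra.
have a2 : 0 <= avg B (fun p => f p ^+ 2).
  by rewrite divr_ge0 ?(ltW v0)//; apply: Rintegral_ge0 => p _; exact: sqr_ge0.
rewrite -(ler_pXn2r (n := 2))// ?nnegrE ?mulr_ge0 ?sqrtr_ge0//.
rewrite exprMn sqr_sqrtr// real_normK ?num_real// /avg expr_div_n.
rewrite ler_pdivrMr ?exprn_gt0//.
apply: (le_trans h); apply: (le_trans (ler_wpM2l (ltW v0) i1)).
move: (\int[_]_(_ in _) _) => I; rewrite (_ : _ * (I / _) * _ = vol B * (M ^+ 2 * I)) //.
by field; rewrite gt_eqF.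
Qed.

Lemma linear_bound B d p : inbox B p -> `|co p d - mid B d| <= len B d.
Proof.
move=> /(_ d)/andP[h1 h2]; rewrite ler_norml /mid /len.
by apply/andP; split; lra.
Qed.

Lemma quad_bound B d p : inbox B p -> `|quad (lo B d) (hi B d) (co p d)| <= len B d ^+ 2.
Proof.
move=> /(_ d)/andP[h1 h2]; rewrite /quad normrM expr2 /len.
by apply: ler_pM => //; rewrite ler_norml; apply/andP; split; lra.
Qed.

Lemma cub_bound B d p : inbox B p -> `|cub B d (co p d)| <= len B d ^+ 3.
Proof.
move=> Bp; have l0 : 0 <= len B d by have /andP[h1 h2] := Bp d; rewrite /len; lra.
rewrite /cub normrM exprSr (normrM (quad _ _ _)) -[leRHS]mul1r.
apply: ler_pM => //; first by rewrite ger0_norm ?invr_ge0// invf_le1// ler1n.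
by apply: ler_pM => //; [exact: quad_bound|exact: linear_bound].
Qed.

End Averages.

(** * The discrete operators on one element *)

Section FaceAlgebra.
Variable R : realType.
Notation pt := (R * R * R)%type.
Implicit Types (B : box R) (p q : pt) (i j k d : 'I_3) (f g : pt -> R).

Lemma facept_closedbox B d b y : proper B -> facedom B d y -> closedbox B (facept B d b y).
Proof.
move=> pB [/andP[h1 h2] /andP[h3 h4]] i; rewrite faceptE.
case: (axis_cases d i) => ->.
- by rewrite co_alongax; case: b; rewrite /= lexx (ltW (pB d)).
- by rewrite co_alongax0 (ltW h1) (ltW h2).
- by rewrite co_alongax1 (ltW h3) (ltW h4).
Qed.

Lemma integrable_face B d b f : proper B -> continuous f ->
  (leb2 R).-integrable (facedom B d) (EFin \o (fun y => f (facept B d b y))).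
Proof.
move=> pB cf; have [M M0 hM] := continuous_bounded B cf.
have mf := measurable_facedom B d.
have i1 := cst_integrable (mu := leb2 R) mf (facedom_fin d pB) 1.
have := integrable_bdM (mu := leb2 R) mf i1 (measurable_facept b cf)
  (fun y Dy => hM _ (facept_closedbox b pB Dy)).
by apply: eq_integrable => // y _ /=; rewrite mul1r.
Qed.

Lemma itv_linear0 (a b : R) : a < b ->
  \int[@lebesgue_measure R]_(t in `]a, b[) (t - (a + b) / 2) = 0.
Proof.
move=> ab.
have c1 : continuous (fun t : R => t - (a + b) / 2) by exact: (smooth1_continuous (smooth1_shift _)).
have c2 : continuous (quad a b) by exact: (smooth1_continuous (smooth1_quad _ _)).
have d1 (t : R) : is_derive t 1 (fun t => 2^-1 * quad a b t) (t - (a + b) / 2).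
  have h := is_deriveZ (2^-1 : R) (is_derive_quad a b t).
  by apply: is_derive_eq h _; rewrite /GRing.scale/= /quad'; field.
have F := @continuous_FTC2 R (fun t => t - (a + b) / 2) (fun t => 2^-1 * quad a b t) a b ab.
have {}F : (\int[@lebesgue_measure R]_(x in `[a, b]) (x - (a + b) / 2)%:E =
  (2^-1 * quad a b b)%:E - (2^-1 * quad a b a)%:E)%E.
  apply: F.
  - exact: continuous_subspaceT.
  - split=> [t _||].
    + by apply: ex_derive.
    + by apply: cvg_at_right_filter; apply: cvgM; [exact: cvg_cst|exact: c2].
    + by apply: cvg_at_left_filter; apply: cvgM; [exact: cvg_cst|exact: c2].
  - by move=> t _; rewrite derive1E; apply: derive_val.
rewrite {2}/quad subrr mul0r mulr0 {1}/quad subrr !mulr0 subee// in F.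
have mt (D : set R) : measurable D -> measurable_fun D (fun t : R => (t - (a + b) / 2)%:E).
  move=> mD; apply/measurable_EFinP; apply: (measurable_funS measurableT) => //.
  exact: continuous_measurable_fun.
rewrite /Rintegral integral_itv_obnd_cbnd; last exact: mt.
by rewrite integral_itv_bndo_bndc ?F//; exact: mt.
Qed.

Lemma int_linear0 B k : proper B -> \int[leb3 R]_(p in inbox B) (co p k - mid B k) = 0.
Proof.
move=> pB; have mB := measurable_inbox B.
have Lc : L2 (inbox B) (fun=> (1 : R)) by exact: (L2_cst 1 mB (leb3_inbox_fin pB)).
have i1 := integrable_smoothM pB Lc (smooth_continuous (smooth_linear k (mid B k))).
have [_ e _] := slice_fubini k i1.
transitivity (\int[leb3 R]_(p in inbox B) (1 * (co p k - mid B k))).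
  by apply: eq_Rintegral => p _; rewrite mul1r.
rewrite e; transitivity (\int[leb2 R]_(y in facedom B k) 0); last first.
  by rewrite (Rintegral_cst (leb2 R) (measurable_facedom B k)) mul0r.
apply: eq_Rintegral => y _; rewrite /slice -(itv_linear0 (pB k)).
by apply: eq_Rintegral => t _; rewrite mul1r co_alongax.
Qed.

(** The integrand does not depend on x_d, so that its integral over the box is
    the length along d times that over the face. *)
Lemma fint_linear0 B d b k : proper B -> k != d -> fint B d b (fun p => co p k - mid B k) = 0.
Proof.
move=> pB kd; have mB := measurable_inbox B.
have Lc : L2 (inbox B) (fun=> (1 : R)) by exact: (L2_cst 1 mB (leb3_inbox_fin pB)).
have i1 := integrable_smoothM pB Lc (smooth_continuous (smooth_linear k (mid B k))).
have [_ e _] := slice_fubini d i1.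
have i2 := integrable_face d b pB (smooth_continuous (smooth_linear k (mid B k))).
have : \int[leb3 R]_(p in inbox B) (1 * (co p k - mid B k)) = 0.
  rewrite -[RHS](int_linear0 k pB); apply: eq_Rintegral => p _; by rewrite mul1r.
have l0 := len_gt0 d pB.
have mI : measurable (`]lo B d, hi B d[%classic : set R) by exact: measurable_itv.
rewrite e => h; apply: (mulfI (lt0r_neq0 l0)); rewrite mulr0 -h.
rewrite /fint -(RintegralZl (mu := leb2 R) (len B d) (measurable_facedom B d) i2).
apply: eq_Rintegral => y _; rewrite /slice.
transitivity (\int[@lebesgue_measure R]_(t in `]lo B d, hi B d[) (co (facept B d b y) k - mid B k)).
  rewrite (Rintegral_cst (@lebesgue_measure R) mI) mulrC.
  by congr (_ * _); rewrite [X in fine X](leb1_itv d pB).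
apply: eq_Rintegral => t _; rewrite mul1r faceptE.
by case: (axis_cases d k) kd => ->; rewrite ?eqxx// ?co_alongax0 ?co_alongax1.
Qed.

(** Centering at the center of the box makes the linear part have mean 0. *)
Definition affine B (a : R) (c : 'I_3 -> R) p : R := a + \sum_k c k * (co p k - mid B k).

Lemma smooth_affine B a c : smooth (affine B a c).
Proof.
apply: (smoothD (smooth_cst a) (smooth_sum _ _)) => k.
exact: (smoothM (smooth_cst _) (smooth_linear k _)).
Qed.

Lemma fint_affine B d b a c : proper B ->
  fint B d b (affine B a c) = farea B d * (a + c d * (nsign R b * (len B d / 2))).
Proof.
move=> pB; have mf := measurable_facedom B d.
pose k0 := lift d (ord0 : 'I_2); pose k1 := lift d (ord_max : 'I_2).
have ik k := integrable_face d b pB (smooth_continuous (smooth_linear k (mid B k))).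
have k0d : k0 != d by rewrite eq_sym neq_lift.
have k1d : k1 != d by rewrite eq_sym neq_lift.
have i1 := cst_integrable (mu := leb2 R) mf (facedom_fin d pB) 1.
set A := a + c d * (nsign R b * (len B d / 2)).
have E : fint B d b (affine B a c) = \int[leb2 R]_(y in facedom B d)
   (1 * (c k0 * (co (facept B d b y) k0 - mid B k0) + c k1 * (co (facept B d b y) k1 - mid B k1)) + A * 1).
  apply: eq_Rintegral => y _; rewrite /affine.
  have -> (F : 'I_3 -> R) : \sum_k F k = F d + (F k0 + F k1).
    rewrite (bigD1_ord d)//=; congr (_ + _).
    by rewrite big_ord_recl big_ord1; congr (F _ + F _); apply: val_inj.
  rewrite {1}faceptE co_alongax /A.
  have -> : level B d b - mid B d = nsign R b * (len B d / 2).
    by case: b {A i1 ik}; rewrite /level /mid /len /nsign; field.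
  by ring.
have i01 := integrable_lin (mu := leb2 R) mf (c k0) (c k1) (ik k0) (ik k1).
rewrite E (Rintegral_lin (mu := leb2 R) mf 1 A i01 i1).
rewrite (Rintegral_lin (mu := leb2 R) mf (c k0) (c k1) (ik k0) (ik k1)).
have /= := fint_linear0 b pB k0d; rewrite /fint => ->.
have /= := fint_linear0 b pB k1d; rewrite /fint => ->.
have /= := fint1 d b pB; rewrite /fint => ->.
by rewrite !mulr0 addr0 mulr0 add0r mulrC.
Qed.

Lemma P1_affine B s : P1 s -> exists a c, s = affine B a c.
Proof.
move=> [a [c e]]; exists (a + \sum_k c k * mid B k), c; apply/funext => p.
rewrite e /affine -addrA; congr (_ + _); rewrite -big_split/=.
by apply: eq_bigr => k _; ring.
Qed.

Lemma affine_P1 B a c : P1 (affine B a c).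
Proof.
exists (a - \sum_k c k * mid B k), c => p; rewrite /affine -addrA; congr (_ + _).
by rewrite addrC -sumrB; apply: eq_bigr => k _; ring.
Qed.

Lemma affineZ B a c (x : R) : (fun p => affine B a c p * x) = affine B (a * x) (fun k => c k * x).
Proof.
apply/funext => p; rewrite /affine mulrDl big_distrl/=; congr (_ + _).
by apply: eq_bigr => k _; ring.
Qed.

Lemma fmean_affine B d b a c : proper B ->
  fmean B d b (affine B a c) = a + c d * (nsign R b * (len B d / 2)).
Proof.
move=> pB; rewrite /fmean fint1// fint_affine// mulrC mulKf//.
by rewrite gt_eqF// farea_gt0.
Qed.

(** The weak gradient, in terms of the six values [F d b] on the faces of the
    box ([wgrad_eq]). *)
Definition dgrad B (F : 'I_3 -> bool -> R) d : R := (F d true - F d false) / len B d.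
Definition dmean (F : 'I_3 -> bool -> R) d : R := (F d true + F d false) / 2.
(** The value at the center of the box of the extension S of the face values
    ([ext_affine]). *)
Definition bmean B (F : 'I_3 -> bool -> R) : R :=
  (\sum_d farea B d * dmean F d) / \sum_d farea B d.
(** The value of Q_b S(v) - v on both faces orthogonal to d. *)
Definition defect B (F : 'I_3 -> bool -> R) d : R := bmean B F - dmean F d.

Lemma sum_farea_gt0 B : proper B -> 0 < \sum_d farea B d.
Proof. by move=> pB; rewrite sum3 !addr_gt0// farea_gt0. Qed.

(** Consequently a quantity that does not depend on the axis is orthogonal to
    the defects. *)
Lemma sum_defect B F : proper B -> \sum_d farea B d * defect B F d = 0.
Proof.
move=> pB; have s0 := sum_farea_gt0 pB.
under eq_bigr do rewrite /defect mulrBr; rewrite sumrB -big_distrl/=.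
by rewrite /bmean mulrC divfK ?subrr// gt_eqF.
Qed.

(** The equations that define S decouple: the constant [al] tests the value at
    the center, and each slope [be d] tests the slope along the same axis. *)
Lemma bint_affine B F a c al be : proper B ->
  bint B (fun d b p => affine B a c p * fmean B d b (affine B al be)) -
  bint B (fun d b p => F d b * affine B al be p) =
  2 * al * \sum_d farea B d * (a - dmean F d) +
  \sum_d farea B d * be d * len B d ^+ 2 / 2 * (c d - dgrad B F d).
Proof.
move=> pB; rewrite /bint -sumrB mulr_sumr -big_split/=; apply: eq_bigr => d _.
rewrite !big_bool /=; have l0 := len_gt0 d pB.
have cm b : fint B d b (fun p => F d b * affine B al be p) =
   farea B d * (F d b * (al + be d * (nsign R b * (len B d / 2)))).
  have -> : (fun p => F d b * affine B al be p) = (fun p => affine B al be p * F d b).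
    by apply/funext => p; rewrite mulrC.
  by rewrite affineZ fint_affine//; ring.
rewrite !cm !affineZ !fint_affine// !fmean_affine// /nsign /dmean /dgrad.
by field; rewrite gt_eqF.
Qed.

End FaceAlgebra.

Section MeshFormulas.
Variables (R : realType) (M : mesh R).
Notation pt := (R * R * R)%type.
Implicit Types (T : cell M) (u v w : Vb M) (p q : pt) (i j k d : 'I_3).

Lemma proper_cbox T : proper (cbox T).
Proof. by move=> i /=; apply: node_incr. Qed.

Lemma node_mono i (a b : nat) : (a <= b)%N -> (b <= ncell M i)%N -> node M i a <= node M i b.
Proof.
elim: b => [|b IH]; first by rewrite leqn0 => /eqP ->.
rewrite leq_eqVlt => /predU1P[->//|ab] bn.
exact: le_trans (IH ab (ltnW bn)) (ltW (node_incr bn)).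
Qed.

Lemma subunit_cbox T : subunit (cbox T).
Proof.
move=> i /=; have Ti := ltn_ord (T i).
by rewrite -{1}(node_first M i) -(node_last M i); split; apply: node_mono => //; exact: ltnW.
Qed.

Definition face_vals T v : 'I_3 -> bool -> R := fun d b => v (lface T d b).

(** In [bint_affine], psi = 1 determines the value at the center and psi = x_k
    - mid_k the slope along k. *)
Lemma ext_affine T v : ext T v = affine (cbox T) (bmean (cbox T) (face_vals T v)) (dgrad (cbox T) (face_vals T v)).
Proof.
set B := cbox T; set F := face_vals T v; have pB := proper_cbox T.
have s0 := sum_farea_gt0 pB.
have ex : exists s, is_ext T v s.
  exists (affine B (bmean B F) (dgrad B F)); split; first exact: affine_P1.
  move=> psi /(P1_affine B)[al [be ->]]; apply/eqP; rewrite -subr_eq0.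
  have := bint_affine F (bmean B F) (dgrad B F) al be pB; rewrite -/B => ->.
  under [X in _ + X]eq_bigr do rewrite subrr mulr0.
  have := sum_defect F pB; rewrite /defect => ->.
  by rewrite mulr0 add0r big1.
have [/(P1_affine B)[a [c e]] h] := xgetPex (fun=> 0) ex.
rewrite -/(ext T v) in e h; rewrite e.
have key al be : 2 * al * \sum_d farea B d * (a - dmean F d) +
  \sum_d farea B d * be d * len B d ^+ 2 / 2 * (c d - dgrad B F d) = 0.
  rewrite -bint_affine//; have := h _ (affine_P1 B al be); rewrite e => ->.
  by rewrite subrr.
have -> : a = bmean B F.
  have := key 1 (fun=> 0); rewrite [X in _ + X]big1; last by move=> d _; rewrite mulr0 !mul0r.
  rewrite addr0 mulr1 => /eqP; rewrite mulf_eq0 pnatr_eq0/=.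
  under eq_bigr do rewrite mulrBr; rewrite sumrB -big_distrl/= subr_eq0 => /eqP e1.
  by rewrite /bmean -e1 [X in X / _]mulrC mulfK// gt_eqF.
congr affine; apply/funext => k.
have := key 0 (fun d => (d == k)%:R); rewrite mulr0 mul0r add0r (bigD1 k)//= big1; last first.
  by move=> d /negbTE ->; rewrite mulr0 !mul0r.
rewrite addr0 eqxx mulr1 => /eqP; rewrite mulf_eq0 subr_eq0 => /orP[|/eqP//].
by rewrite gt_eqF// divr_gt0// mulr_gt0 ?farea_gt0// exprn_gt0// len_gt0.
Qed.

Lemma int_cst T (c : R) : \int[leb3 R]_(p in inbox (cbox T)) c = vol (cbox T) * c.
Proof.
rewrite (Rintegral_cst (leb3 R) (measurable_inbox _)) mulrC.
by congr (_ * _); rewrite [X in fine X]leb3_inbox//; exact: proper_cbox.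
Qed.

Lemma dotE (a c : 'cV[R]_3) : dot a c = \sum_i a i 0 * c i 0.
Proof. by []. Qed.

Lemma fint_cst B d b (c : R) : proper B -> fint B d b (fun=> c) = farea B d * c.
Proof.
move=> pB; rewrite /fint (Rintegral_cst (leb2 R) (measurable_facedom B d)) mulrC.
by rewrite [X in fine X * _]leb2_facedom.
Qed.

Lemma wgrad_eq T v : wgrad T v = \col_d dgrad (cbox T) (face_vals T v) d.
Proof.
set B := cbox T; set F := face_vals T v; have pB := proper_cbox T.
have v0 := vol_gt0 pB.
have rhs psi : bint B (fun d b _ => v (lface T d b) * dot psi (normal R d b)) =
   vol B * dot (\col_d dgrad B F d) psi.
  rewrite /bint dotE mulr_sumr; apply: eq_bigr => d _.
  have dn b : dot psi (normal R d b) = nsign R b * psi d 0.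
    rewrite dotE (bigD1 d)//= big1; last by move=> i id; rewrite !mxE eqxx (negbTE id) !andbT /= !mulr0.
    by rewrite !mxE !eqxx/= mulr1 addr0 mulrC.
  rewrite big_bool /= !fint_cst// !dn mxE (vol_farea B d) /dgrad /nsign -/(face_vals T v d true) -/(face_vals T v d false) -/F.
  by have := len_gt0 d pB => l0; field; rewrite gt_eqF.
have ex : exists c, is_wgrad T v c.
  by exists (\col_d dgrad B F d) => psi; rewrite rhs int_cst.
have h := xgetPex 0 ex; rewrite -/(wgrad T v) in h.
apply/colP => k; have := h (delta_mx k 0); rewrite rhs int_cst => /(mulfI (lt0r_neq0 v0)).
have dd (c : 'cV[R]_3) : dot c (delta_mx k 0) = c k 0.
  rewrite /dot (bigD1 k)//= big1 ?mxE ?eqxx ?mulr1 ?addr0// => i ik.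
  by rewrite mxE (negbTE ik) mulr0.
by rewrite !dd.
Qed.

Lemma stab_eq u v : stab u v = \sum_T \sum_d 2 * (farea (cbox T) d *
  (defect (cbox T) (face_vals T u) d * defect (cbox T) (face_vals T v) d)).
Proof.
apply: eq_bigr => T _; apply: eq_bigr => d _; have pB := proper_cbox T.
have l0 := len_gt0 d pB.
rewrite big_bool /= !fint_cst// !ext_affine !fmean_affine// /defect /dmean /dgrad /nsign.
rewrite -!/(face_vals T _ d true) -!/(face_vals T _ d false).
by field; rewrite gt_eqF.
Qed.

Definition center (B : box R) : pt := mkpt (mid B).

Lemma inbox_center B : proper B -> inbox B (center B).
Proof.
move=> pB i; rewrite /center co_mkpt /mid; have := pB i => h.
by apply/andP; split; lra.
Qed.

Lemma wg_form_eq (A : pt -> 'M[R]_3) u v : piecewise_constant M A ->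
  wg_form A u v = \sum_T vol (cbox T) * dot (A (center (cbox T)) *m wgrad T u) (wgrad T v).
Proof.
move=> pA; apply: eq_bigr => T _; rewrite -int_cst; apply: eq_Rintegral => p /set_mem Tp.
by rewrite (pA T p (center (cbox T)))//; apply: inbox_center; exact: proper_cbox.
Qed.

Lemma wgrad_norm_eq v : wgrad_norm v = Num.sqrt (\sum_T vol (cbox T) * dot (wgrad T v) (wgrad T v)).
Proof. by congr Num.sqrt; apply: eq_bigr => T _; rewrite int_cst. Qed.

End MeshFormulas.

(** * Derivatives of the solution and of its flux *)

Section Derivs.
Variable R : realType.
Notation pt := (R * R * R)%type.
Implicit Types (B : box R) (p q : pt) (i j k d : 'I_3) (s : seq 'I_3) (A : pt -> 'M[R]_3) (u : pt -> R).

Definition ordle : rel 'I_3 := fun i j => (i <= j)%N.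

(** Sorting makes the chosen representative depend on the multi-index only,
    and makes it the one that occurs in the Sobolev norm. *)
Definition Dw u s : pt -> R := wderiv (@Omega R) (sort ordle s) u.

Lemma Dw_wderiv u s : sobolev 3 u -> (size s <= 3)%N -> is_wderiv (@Omega R) s u (Dw u s).
Proof.
move=> [Lu hu] ss; have ss' : (size (sort ordle s) <= 3)%N by rewrite size_sort.
have := xgetPex (fun=> 0) (hu _ ss').
apply: is_wderiv_perm; exact: (permEl (perm_sort ordle s)).
Qed.

Lemma Dw_L2 u s : sobolev 3 u -> (size s <= 3)%N -> L2 (@Omega R) (Dw u s).
Proof. by move=> su /(Dw_wderiv su)[]. Qed.

Lemma Dw1 u k : Dw u [:: k] = wderiv (@Omega R) [:: k] u.
Proof. by []. Qed.

Lemma Dw2 u k : Dw u [:: k; k] = wderiv (@Omega R) [:: k; k] u.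
Proof.
rewrite /Dw sorted_sort//=; last by rewrite /ordle leqnn.
by move=> a b c; exact: leq_trans.
Qed.

Lemma Dw_chain u s i : sobolev 3 u -> (size s <= 2)%N ->
  is_wderiv (@Omega R) [:: i] (Dw u s) (Dw u (rcons s i)).
Proof.
move=> su ss; apply: (is_wderiv_chain (s := s) (u := u)).
  by apply: Dw_wderiv => //; exact: ltnW.
by rewrite cats1; apply: Dw_wderiv => //; rewrite size_rcons.
Qed.

(** The derivative along [s] of the k-th component of the flux, up to the
    jumps of A: it is a weak derivative on each element, where A is constant.
    *)
Definition Dflux A u k s p : R := \sum_j A p k j * Dw u (j :: s) p.

Lemma flux_Dflux A u k : flux A u k = Dflux A u k [::].
Proof.
apply/funext => p; rewrite /flux mxE; apply: eq_bigr => j _.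
by rewrite mxE -Dw1.
Qed.

Lemma measurable_Omega : measurable (@Omega R : set pt).
Proof. exact: measurable_inbox. Qed.

Lemma Dflux_L2 A u k s : coefficient A -> sobolev 3 u -> (size s <= 2)%N ->
  L2 (@Omega R) (Dflux A u k s).
Proof.
move=> [mA [K AK] _ _] su ss.
have L j : L2 (@Omega R) (fun p => Dw u (j :: s) p * A p k j).
  by apply: (L2_bdM measurable_Omega (Dw_L2 su _) (mA k j) (M := K)) => // p /AK.
apply: (L2_eq measurable_Omega _ (L2_sum (index_enum 'I_3) (@proper_cube R) L)) => p _.
by apply: eq_bigr => j _; rewrite mulrC.
Qed.

Lemma is_wderiv_sum B t (I : Type) (r : seq I) (U V : I -> pt -> R) : proper B ->
  (forall a, L2 (inbox B) (U a)) -> (forall a, is_wderiv (inbox B) t (U a) (V a)) ->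
  is_wderiv (inbox B) t (fun p => \sum_(a <- r) U a p) (fun p => \sum_(a <- r) V a p).
Proof.
move=> pB LU wU; have mB := measurable_inbox B; elim: r => [|a r IH].
  split.
    apply: (L2_eq mB _ (L2_cst 0 mB (leb3_inbox_fin pB))) => p _.
    by rewrite big_nil.
  move=> phi _.
  under eq_Rintegral do rewrite big_nil mul0r.
  under [X in _ = _ * X]eq_Rintegral do rewrite big_nil mul0r.
  by rewrite (Rintegral_cst (leb3 R) mB) mul0r mulr0.
have := is_wderiv_lin 1 1 pB (LU a) (L2_sum r pB LU) (wU a) IH.
by apply: is_wderiv_eq => // p _; rewrite big_cons !mul1r.
Qed.

Lemma is_wderivZ B t (U V : pt -> R) (c : R) : proper B -> L2 (inbox B) U ->
  is_wderiv (inbox B) t U V -> is_wderiv (inbox B) t (fun p => c * U p) (fun p => c * V p).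
Proof.
move=> pB LU wU; have := is_wderiv_lin c 0 pB LU LU wU wU.
by apply: is_wderiv_eq => [|p _|p _]; [exact: measurable_inbox|ring|ring].
Qed.

Lemma L2_sub B f : subunit B -> L2 (@Omega R) f -> L2 (inbox B) f.
Proof.
by move=> sB; apply: L2S; [exact: measurable_inbox|exact: measurable_Omega|exact: inbox_Omega].
Qed.

Lemma wderiv_sub B s u v : subunit B -> is_wderiv (@Omega R) s u v -> is_wderiv (inbox B) s u v.
Proof.
by move=> sB; apply: is_wderivS; [exact: measurable_inbox|exact: measurable_Omega|exact: inbox_Omega].
Qed.

Section OnMesh.
Variables (M : mesh R) (A : pt -> 'M[R]_3) (u : pt -> R).
Hypotheses (cA : coefficient A) (pA : piecewise_constant M A) (su : sobolev 3 u).
Implicit Types (T : cell M).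

Definition A_on T := A (center (cbox T)).

Lemma A_onE T p : inbox (cbox T) p -> A p = A_on T.
Proof.
by move=> Tp; apply: (pA (T := T)) => //; apply: inbox_center; exact: proper_cbox.
Qed.

Lemma Dw_L2T T s : (size s <= 3)%N -> L2 (inbox (cbox T)) (Dw u s).
Proof. by move=> ss; apply: (L2_sub (subunit_cbox T)); exact: Dw_L2. Qed.

Lemma Dw_wderivT T s i : (size s <= 2)%N ->
  is_wderiv (inbox (cbox T)) [:: i] (Dw u s) (Dw u (rcons s i)).
Proof. by move=> ss; apply: (wderiv_sub (subunit_cbox T)); exact: Dw_chain. Qed.

Lemma Dflux_wderivT T k s i : (size s <= 1)%N ->
  is_wderiv (inbox (cbox T)) [:: i] (Dflux A u k s) (Dflux A u k (rcons s i)).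
Proof.
move=> ss; have pT := proper_cbox T; have mT := measurable_inbox (cbox T).
have L j : L2 (inbox (cbox T)) (fun p => A_on T k j * Dw u (j :: s) p).
  by apply: L2Z => //; apply: Dw_L2T; exact: leq_ltn_trans ss _.
have w j : is_wderiv (inbox (cbox T)) [:: i] (fun p => A_on T k j * Dw u (j :: s) p)
    (fun p => A_on T k j * Dw u (j :: rcons s i) p).
  apply: is_wderivZ => //; first by apply: Dw_L2T; exact: leq_ltn_trans ss _.
  exact: (Dw_wderivT T (s := j :: s) i).
apply: is_wderiv_eq (is_wderiv_sum (index_enum 'I_3) pT L w) => // p Tp.
  by apply: eq_bigr => j _; rewrite (A_onE Tp).
by apply: eq_bigr => j _; rewrite (A_onE Tp).
Qed.

Lemma u_wderivT T i : is_wderiv (inbox (cbox T)) [:: i] u (Dw u [:: i]).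
Proof. by apply: (wderiv_sub (subunit_cbox T)); apply: Dw_wderiv. Qed.

Lemma u_L2T T : L2 (inbox (cbox T)) u.
Proof. by apply: (L2_sub (subunit_cbox T)); case: su. Qed.

(** A weak derivative is determined almost everywhere only; but by [Qface_avg]
    the face average of its trace involves it only through integrals against
    smooth functions. *)
Lemma Qface_flux T d b k :
  Qface (cbox T) d b (wderiv (inbox (cbox T)) [:: k] (flux A u k)) =
  Qface (cbox T) d b (Dflux A u k [:: k]).
Proof.
set B := cbox T; have pB := proper_cbox T; have mB := measurable_inbox B.
have w1 : is_wderiv (inbox B) [:: k] (flux A u k) (Dflux A u k [:: k]).
  by rewrite flux_Dflux; exact: (Dflux_wderivT T k (s := [::]) k).
have w2 : is_wderiv (inbox B) [:: k] (flux A u k) (wderiv (inbox B) [:: k] (flux A u k)).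
  by apply: (xgetPex (fun=> 0)); exists (Dflux A u k [:: k]).
set X := wderiv _ _ _ in w2 *.
have w3 : is_wderiv (inbox B) [:: d] (Dflux A u k [:: k]) (Dflux A u k [:: k; d]).
  exact: (Dflux_wderivT T k (s := [:: k]) d).
have w4 : is_wderiv (inbox B) [:: d] X (Dflux A u k [:: k; d]).
  split; first exact: w3.1.
  move=> phi tphi; rewrite -(w3.2 phi tphi).
  by apply: (is_wderiv_unique pB w2 w1); exact: (test_fun_pderiv [:: d] tphi).1.
rewrite (Qface_avg b pB w2.1 w4) (Qface_avg b pB w1.1 w3); congr (_ + _ + _).
have e := is_wderiv_unique pB w2 w1 (smooth_cst 1).
rewrite /avg; congr (_ / _).
transitivity (\int[leb3 R]_(p in inbox B) (X p * 1)).
  by apply: eq_Rintegral => p _; rewrite mulr1.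
by rewrite e; apply: eq_Rintegral => p _; rewrite mulr1.
Qed.

End OnMesh.

End Derivs.

(** * Faces of the mesh *)

Section Topology.
Variables (R : realType) (M : mesh R).
Notation pt := (R * R * R)%type.
Implicit Types (T : cell M) (F : face M) (u v w : Vb M) (p q : pt) (i j k d : 'I_3) (b : bool).

Lemma ncell_gt0 i : (0 < ncell M i)%N.
Proof.
case: (ncell M i) (node_first M i) (node_last M i) => // -> /eqP.
by rewrite eq_sym oner_eq0.
Qed.

Definition fpos F i : nat := tagged F i.

Lemma fpos_lface T d b i : fpos (lface T d b) i = (T i + (b && (i == d)))%N.
Proof. by rewrite /fpos /lface /= ffunE. Qed.

Lemma lface_eq T1 T2 d b1 b2 : lface T1 d b1 = lface T2 d b2 ->
  forall i, (T1 i + (b1 && (i == d)) = T2 i + (b2 && (i == d)))%N.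
Proof. by move=> e i; rewrite -!fpos_lface e. Qed.

Lemma lface_inj T1 T2 d b : lface T1 d b = lface T2 d b -> T1 = T2.
Proof.
move=> /lface_eq e; apply/ffunP => i; apply: val_inj; have /eqP := e i.
by rewrite eqn_add2r => /eqP.
Qed.

Lemma adj_box T1 T2 d : lface T1 d true = lface T2 d false ->
  exists B m, [/\ proper B, lo B d < m < hi B d, sethi B d m = cbox T1,
    setlo B d m = cbox T2 & subunit B].
Proof.
move=> /lface_eq /= e.
have ei i : i != d -> T2 i = T1 i :> nat.
  by move=> /negbTE id; have := e i; rewrite id !addn0.
have ed : T2 d = (T1 d).+1 :> nat by have := e d; rewrite eqxx addn1 addn0.
exists (Box (lo (cbox T1)) (hi (cbox T2))), (node M d (T1 d).+1).
have p1 := proper_cbox T1; have p2 := proper_cbox T2.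
have n1 : node M d (T1 d) < node M d (T1 d).+1 by exact: (p1 d).
have n2 : node M d (T1 d).+1 < node M d (T2 d).+1 by have := p2 d; rewrite /= ed.
split.
- move=> i /=; have [->|id] := eqVneq i d; first exact: lt_trans n2.
  by rewrite (ei _ id); exact: (p1 i).
- by rewrite /= n1 n2.
- by apply: box_eq => i //=; case: eqP => [->//|/eqP /ei ->].
- by apply: box_eq => i //=; case: eqP => [->|/eqP /ei ->] //; rewrite ed.
- by move=> i /=; have [a _] := subunit_cbox T1 i; have [_ c] := subunit_cbox T2 i.
Qed.

Lemma farea_sethi (B : box R) d m : farea (sethi B d m) d = farea B d.
Proof. by rewrite /farea /len /= ![_ == d]eq_sym !(negbTE (neq_lift _ _)). Qed.

Lemma farea_setlo (B : box R) d m : farea (setlo B d m) d = farea B d.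
Proof. by rewrite /farea /len /= ![_ == d]eq_sym !(negbTE (neq_lift _ _)). Qed.

(** [Qb] picks one of the elements that have the face; the choice does not
    matter because the one-sided traces have equal means
    ([trace_int_adjacent]). *)
Lemma Qb_lface T d b (v dv : pt -> R) : L2 (@Omega R) v -> is_wderiv (@Omega R) [:: d] v dv ->
  Qb v (lface T d b) = Qface (cbox T) d b v.
Proof.
move=> Lv wv.
have LT T' : L2 (inbox (cbox T')) v by exact: (L2_sub (subunit_cbox T')).
have wT T' : is_wderiv (inbox (cbox T')) [:: d] v dv by exact: (wderiv_sub (subunit_cbox T')).
have adj T1 T2 : lface T1 d true = lface T2 d false ->
    Qface (cbox T1) d true v = Qface (cbox T2) d false v.
  move=> e; rewrite (Qface_trace_int _ (proper_cbox T1) (LT T1) (wT T1)).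
  rewrite (Qface_trace_int _ (proper_cbox T2) (LT T2) (wT T2)).
  have [B [m [pB /andP[lm mh] e1 e2 sB]]] := adj_box e.
  rewrite -e1 -e2 farea_sethi farea_setlo.
  by rewrite (trace_int_adjacent pB lm mh (L2_sub sB Lv) (wderiv_sub sB wv)).
rewrite /Qb; case: pickP => [[T' b'] /= /eqP|/(_ (T, b))/=]; last by rewrite eqxx.
case: b' b => -[] e; first by rewrite (lface_inj e).
- exact: adj.
- by apply/esym/adj.
- by rewrite (lface_inj e).
Qed.

(** The cyclic successor along [d]. Being a bijection of the elements, it can
    reindex sums; the pairs that it creates by wrapping around concern
    boundary faces only. *)
Definition shift d T : cell M := [ffun i => if i == d then ordS (T i) else T i].

Lemma shift_inj d : injective (shift d).
Proof.
move=> T1 T2 /ffunP e; apply/ffunP => i; have := e i; rewrite !ffunE.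
by case: eqP => // _ /ordS_inj.
Qed.

Lemma face_shift T d : (T d).+1 != ncell M d -> lface T d true = lface (shift d T) d false.
Proof.
move=> Td; rewrite /lface; congr existT; apply/ffunP => i; apply: val_inj.
rewrite !ffunE /= ffunE; have [->|_] := eqVneq i d; last by rewrite ?andbF.
rewrite /= addn1 addn0 modn_small// ltn_neqAle Td /=; exact: ltn_ord.
Qed.

Lemma boundary_lface T d b : boundary (lface T d b) =
  ((T d + b == 0)%N || (T d + b == ncell M d)%N).
Proof. by rewrite /boundary /= ffunE /= eqxx andbT. Qed.

(** Reindexing by [shift] pairs the upper face of each element with the lower
    face of its neighbour, where the terms cancel, or else with boundary
    faces, where v vanishes. *)
Lemma face_sum_cancel d (v : Vb M) (G : cell M -> bool -> R) : Vb0 v ->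
  (forall T1 T2, lface T1 d true = lface T2 d false -> G T1 true = G T2 false) ->
  \sum_T (v (lface T d true) * G T true - v (lface T d false) * G T false) = 0.
Proof.
move=> v0 hG; rewrite sumrB [X in _ - X](reindex_inj (@shift_inj d)) -sumrB.
apply: big1 => T _; have [e|ne] := eqVneq (T d).+1 (ncell M d).
  rewrite !v0 ?mul0r ?subrr// boundary_lface; last by rewrite addn1 e eqxx orbT.
  by rewrite addn0 ffunE eqxx /= e modnn.
by rewrite -(face_shift ne) (hG _ _ (face_shift ne)) subrr.
Qed.

Lemma face_exists F : exists T b, lface T (tag F) b = F.
Proof.
case: F => d F /=.
have lt i : ((if i == d then (F i).-1 else F i) < ncell M i)%N.
  move: (nat_of_ord (F i)) (ltn_ord (F i)) => m.
  case: eqP => [->|_]; last by rewrite addn0.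
  by rewrite addn1 ltnS => h; have n0 := ncell_gt0 d; case: m h.
exists [ffun i => Ordinal (lt i)], (0 < F d)%N.
rewrite /lface; congr existT; apply/ffunP => i; apply: val_inj; rewrite !ffunE /= ffunE /=.
have Fd : i == d -> F i = F d :> nat by move=> /eqP ->.
move: (nat_of_ord (F i)) Fd => m; case: (i == d) => Fd; last by rewrite andbF addn0.
by rewrite andbT -Fd//; case: m {Fd} => [//|m]; rewrite addn1.
Qed.

Lemma boundary_level T d b : boundary (lface T d b) -> level (cbox T) d b = level (cube R) d b.
Proof.
rewrite boundary_lface; have Td := ltn_ord (T d); case: b.
  by rewrite addn1 /= => /eqP ->; rewrite node_last.
by rewrite addn0 (ltn_eqF Td) orbF /= => /eqP ->; rewrite node_first.
Qed.

End Topology.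

(** * Continuity of the normal flux *)

Section Flux.
Variables (R : realType) (M : mesh R).
Notation pt := (R * R * R)%type.
Variables (A : pt -> 'M[R]_3) (u f g : pt -> R).
Hypotheses (cA : coefficient A) (pA : piecewise_constant M A) (su : sobolev 3 u)
  (Lf : L2 (@Omega R) f) (hd : dirichlet_solution A u f g).
Implicit Types (T : cell M) (v w : Vb M) (p q : pt) (i j k d : 'I_3) (b : bool) (B : box R).

Notation q_ := (flux A u).
Notation dq k := (Dflux A u k [:: k]).

Lemma flux_L2 k : L2 (@Omega R) (q_ k).
Proof. by rewrite flux_Dflux; exact: (Dflux_L2 k cA su (s := [::])). Qed.

Lemma dq_L2 k : L2 (@Omega R) (dq k).
Proof. exact: (Dflux_L2 k cA su (s := [:: k])). Qed.

Lemma flux_wderivT T k : is_wderiv (inbox (cbox T)) [:: k] (q_ k) (dq k).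
Proof. by rewrite flux_Dflux; exact: (Dflux_wderivT pA su T k (s := [::]) k). Qed.

Lemma int_sum B (I : Type) (r : seq I) (F : I -> pt -> R) : proper B ->
  (forall a, L2 (inbox B) (F a)) ->
  \int[leb3 R]_(p in inbox B) (\sum_(a <- r) F a p) =
  \sum_(a <- r) \int[leb3 R]_(p in inbox B) F a p.
Proof.
move=> pB LF; have v0 := vol_gt0 pB; have := avg_sum r pB LF.
by rewrite /avg -mulr_suml => /(mulIf _); apply; rewrite invr_neq0// gt_eqF.
Qed.

(** Test functions of B extend by zero to test functions of the cube. *)
Lemma weak_eq B phi : proper B -> subunit B -> test_fun (inbox B) phi ->
  \sum_i \int[leb3 R]_(p in inbox B) (q_ i p * 'D_(axis R i) phi p) =
  \int[leb3 R]_(p in inbox B) (f p * phi p).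
Proof.
move=> pB sB tphi; have BO := inbox_Omega sB.
have sphi := tphi.1.
have := hd.1 phi (test_funS BO tphi).
rewrite [RHS](@Rintegral_sub _ _ _ (leb3 R) _ _ _ BO); last first.
  by move=> p _ nB; have /= -> := test_fun_supp [::] tphi nB; rewrite mulr0.
move=> <-; rewrite (@Rintegral_sub _ _ _ (leb3 R) _ _ _ BO); last first.
  move=> p _ nB; rewrite /dot big1// => i _; rewrite [(\col__ _) _ _]mxE.
  by rewrite (test_fun_supp [:: i] tphi nB) mulr0.
rewrite -int_sum//.
  by apply: eq_Rintegral => p _; apply: eq_bigr => i _; rewrite [(\col__ _) _ _]mxE.
by move=> i; apply: L2_smoothM; [exact: (L2_sub sB (flux_L2 i))|exact: (smooth_continuous (smooth_D i sphi))].
Qed.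

(** Elementwise, f = - div q holds against test functions, hence against
    smooth functions by density. *)
Lemma load_elt T psi : smooth psi ->
  \int[leb3 R]_(p in inbox (cbox T)) (f p * psi p) =
  - \sum_d \int[leb3 R]_(p in inbox (cbox T)) (dq d p * psi p).
Proof.
move=> spsi; have pT := proper_cbox T; have sT := subunit_cbox T; have mT := measurable_inbox (cbox T).
have LT d : L2 (inbox (cbox T)) (dq d) by exact: (L2_sub sT (dq_L2 d)).
pose F p := -1 * \sum_d dq d p.
have LF : L2 (inbox (cbox T)) F by apply: L2Z => //; exact: L2_sum.
have mulsum phi : continuous phi -> \int[leb3 R]_(p in inbox (cbox T)) (F p * phi p) =
    - \sum_d \int[leb3 R]_(p in inbox (cbox T)) (dq d p * phi p).
  move=> cphi; rewrite -int_sum//; last by move=> d; exact: L2_smoothM.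
  rewrite -mulN1r -(RintegralZl (mu := leb3 R) (-1) mT); last first.
    apply: (L2_integrable pT); apply: L2_sum => // d; exact: L2_smoothM.
  by apply: eq_Rintegral => p _; rewrite /F -mulrA mulr_suml.
rewrite -mulsum; last exact: smooth_continuous.
apply: (test_dense pT (L2_sub sT Lf) LF) => // phi tphi.
rewrite mulsum; last exact: (smooth_continuous tphi.1).
rewrite -(weak_eq pT sT tphi) -sumrN; apply: eq_bigr => i _.
by have := (flux_wderivT T i).2 phi tphi; rewrite /= expr1 mulN1r.
Qed.

(** On the union B of the two elements the equation provides a weak derivative
    of q_d along d, namely - f minus the tangential derivatives d_k q_k: for k
    <> d these are weak derivatives on B, since integrating by parts along k
    in each half leaves no term on the common face. So q_d has one trace from
    both sides ([trace_int_adjacent]). *)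
Lemma flux_adj T1 T2 d : lface T1 d true = lface T2 d false ->
  trace_int (cbox T1) d true (q_ d) (dq d) = trace_int (cbox T2) d false (q_ d) (dq d).
Proof.
move=> e; have [B [m [pB lmh e1 e2 sB]]] := adj_box e; have /andP[lm mh] := lmh.
have mB := measurable_inbox B.
pose dv p := dq d p + -1 * (f p + \sum_k dq k p).
have LB k : L2 (inbox B) (dq k) by exact: (L2_sub sB (dq_L2 k)).
have LqB k : L2 (inbox B) (q_ k) by exact: (L2_sub sB (flux_L2 k)).
have Ls : L2 (inbox B) (fun p => \sum_k dq k p) by exact: L2_sum.
have LfB := L2_sub sB Lf.
have Ldv : L2 (inbox B) dv.
  exact: (L2D mB (LB d) (L2Z (-1) mB (L2D mB LfB Ls))).
have wdv : is_wderiv (inbox B) [:: d] (q_ d) dv.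
  split=> // phi tphi; have sphi := tphi.1; have cphi := smooth_continuous sphi.
  (* The faces of both halves that are orthogonal to k lie on the boundary of
     B, where phi vanishes. *)
  have tang k : k != d -> \int[leb3 R]_(p in inbox B) (q_ k p * 'D_(axis R k) phi p) =
      - \int[leb3 R]_(p in inbox B) (dq k p * phi p).
    move=> kd; have i1 := integrable_smoothM pB (LqB k) (smooth_continuous (smooth_D k sphi)).
    have i2 := integrable_smoothM pB (LB k) cphi.
    rewrite (box_split pB lmh i1) (box_split pB lmh i2) e1 e2 opprD.
    have part T : lo (cbox T) k = lo B k -> hi (cbox T) k = hi B k ->
      \int[leb3 R]_(p in inbox (cbox T)) (q_ k p * 'D_(axis R k) phi p) =
      - \int[leb3 R]_(p in inbox (cbox T)) (dq k p * phi p).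
      move=> el eh; apply: (green0 (proper_cbox T) (L2_sub (subunit_cbox T) (flux_L2 k)) (flux_wderivT T k) sphi).
      move=> p hp; have /= -> // := test_fun_supp [::] tphi (p := p).
      move=> /(_ k); rewrite -el -eh.
      by case: hp => ->; rewrite ltxx ?andbF.
    by congr (_ + _); apply: part; rewrite -?e1 -?e2 /= ?(negbTE kd).
  have W := weak_eq pB sB tphi.
  rewrite (bigD1 d)//= in W; rewrite (eq_bigr _ tang) sumrN in W.
  have i0 k := integrable_smoothM pB (LB k) cphi.
  have i1 := integrable_smoothM pB LfB cphi; have i2 := integrable_smoothM pB Ls cphi.
  have i12 := integrable_lin (mu := leb3 R) mB 1 1 i1 i2.
  have idv : \int[leb3 R]_(p in inbox B) (dv p * phi p) =
     \int[leb3 R]_(p in inbox B) (dq d p * phi p) -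
     (\int[leb3 R]_(p in inbox B) (f p * phi p) +
      \sum_k \int[leb3 R]_(p in inbox B) (dq k p * phi p)).
    transitivity (\int[leb3 R]_(p in inbox B) (1 * (dq d p * phi p) +
        -1 * (1 * (f p * phi p) + 1 * ((\sum_k dq k p) * phi p)))).
      by apply: eq_Rintegral => p _; rewrite /dv; ring.
    rewrite (Rintegral_lin (mu := leb3 R) mB 1 (-1) (i0 d) i12).
    rewrite (Rintegral_lin (mu := leb3 R) mB 1 1 i1 i2) !mul1r mulN1r.
    congr (_ - (_ + _)); rewrite -int_sum//; last by move=> k; exact: L2_smoothM.
    by apply: eq_Rintegral => p _; rewrite mulr_suml.
  rewrite /= expr1 mulN1r idv (bigD1 d)//= -W; ring.
have w1 : is_wderiv (inbox (cbox T1)) [:: d] (q_ d) dv by rewrite -e1; exact: wderiv_sethi (ltW mh) wdv.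
have w2 : is_wderiv (inbox (cbox T2)) [:: d] (q_ d) dv by rewrite -e2; exact: wderiv_setlo (ltW lm) wdv.
rewrite (trace_int_unique _ (proper_cbox T1) (L2_sub (subunit_cbox T1) (flux_L2 d)) (flux_wderivT T1 d) w1).
rewrite (trace_int_unique _ (proper_cbox T2) (L2_sub (subunit_cbox T2) (flux_L2 d)) (flux_wderivT T2 d) w2).
by rewrite -e1 -e2; exact: (trace_int_adjacent pB lm mh (LqB d) wdv).
Qed.

End Flux.

(** * The error equation *)

Section Energy.
Variables (R : realType) (M : mesh R).
Notation pt := (R * R * R)%type.
Variables (A : pt -> 'M[R]_3) (u f g : pt -> R).
Hypotheses (cA : coefficient A) (pA : piecewise_constant M A) (su : sobolev 3 u)
  (Lf : L2 (@Omega R) f) (hd : dirichlet_solution A u f g).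
Implicit Types (T : cell M) (v w : Vb M) (p q : pt) (i j k d : 'I_3) (b : bool) (B : box R).

Notation q_ := (flux A u).
Notation dq k := (Dflux A u k [:: k]).
Notation area T d := (farea (cbox T) d).
Notation gr T v := (dgrad (cbox T) (face_vals T v)).
Notation df T v := (defect (cbox T) (face_vals T v)).

Definition avg_dflux T d := avg (cbox T) (dq d).
Definition avg_flux T d := avg (cbox T) (q_ d).
Definition dflux_moment T d k := avg (cbox T) (fun p => dq d p * (co p k - mid (cbox T) k)).

Lemma dq_L2T T d : L2 (inbox (cbox T)) (dq d).
Proof. exact: (L2_sub (subunit_cbox T) (dq_L2 cA su d)). Qed.

Lemma flux_L2T T d : L2 (inbox (cbox T)) (q_ d).
Proof. exact: (L2_sub (subunit_cbox T) (flux_L2 cA su d)). Qed.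

Lemma trace_int_flux T d b : trace_int (cbox T) d b (q_ d) (dq d) =
  area T d * (avg_flux T d + dflux_moment T d d + nsign R b * (len (cbox T) d / 2) * avg_dflux T d).
Proof.
have pT := proper_cbox T; have a0 := farea_gt0 d pT.
have := Qface_avg b pT (flux_L2T T d) (flux_wderivT pA su T d).
rewrite (Qface_trace_int b pT (flux_L2T T d) (flux_wderivT pA su T d)) => /(canRL (divfK (lt0r_neq0 a0))) ->.
by rewrite mulrC.
Qed.

Lemma int_avg B h : proper B -> \int[leb3 R]_(p in inbox B) h p = vol B * avg B h.
Proof. by move=> pB; rewrite /avg mulrC divfK// gt_eqF// vol_gt0. Qed.

Lemma load_T T v : \int[leb3 R]_(p in inbox (cbox T)) (f p * ext T v p) =
  - (vol (cbox T) * \sum_d (bmean (cbox T) (face_vals T v) * avg_dflux T d + \sum_k gr T v k * dflux_moment T d k)).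
Proof.
have pT := proper_cbox T; have mT := measurable_inbox (cbox T).
rewrite ext_affine (load_elt cA pA su Lf hd T (smooth_affine _ _ _)); congr (- _).
rewrite mulr_sumr; apply: eq_bigr => d _; rewrite int_avg//; congr (_ * _).
have Lt k : L2 (inbox (cbox T)) (fun p => dq d p * (co p k - mid (cbox T) k)).
  exact: (L2_smoothM (dq_L2T T d) (smooth_continuous (smooth_linear k _))).
have Lz k : L2 (inbox (cbox T)) (fun p => gr T v k * (dq d p * (co p k - mid (cbox T) k))).
  exact: L2Z.
rewrite /avg_dflux /dflux_moment -avgZ//; last exact: dq_L2T.
under [in RHS]eq_bigr do rewrite -avgZ//.
rewrite -avg_sum// -avgD//; last 2 first.
- exact: (L2Z _ mT (dq_L2T T d)).
- exact: L2_sum.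
apply: avg_eq => p _; rewrite /affine mulrDr mulrC mulr_sumr; congr (_ + _).
by apply: eq_bigr => k _; ring.
Qed.

(** On an element f = - div q and S(v) is affine, so that the load consists of
    averages and first moments of the d_k q_k. Adding the fluxes weighted by
    the face values of v, which sum up to 0 by [face_sum_cancel] and
    [flux_adj], turns these face values into difference quotients and defects.
    *)
Lemma load_formula v : Vb0 v -> load f v = \sum_T vol (cbox T) *
  \sum_d (gr T v d * avg_flux T d - df T v d * avg_dflux T d - \sum_(k | k != d) gr T v k * dflux_moment T d k).
Proof.
move=> v0.
have C0 : \sum_T \sum_d (v (lface T d true) * trace_int (cbox T) d true (q_ d) (dq d) -
    v (lface T d false) * trace_int (cbox T) d false (q_ d) (dq d)) = 0.
  rewrite exchange_big/= big1// => d _.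
  apply: (face_sum_cancel (G := fun T b => trace_int (cbox T) d b (q_ d) (dq d)) v0).
  by move=> T1 T2; exact: (flux_adj cA pA su Lf hd).
rewrite /load -[LHS]addr0 -[X in _ + X]C0 -big_split/=; apply: eq_bigr => T _.
have pT := proper_cbox T.
rewrite load_T mulr_sumr -sumrN -big_split/= mulr_sumr; apply: eq_bigr => d _.
rewrite !trace_int_flux (bigD1 d)//=.
have l0 := len_gt0 d pT.
rewrite (vol_farea _ d) /defect /dgrad /dmean /nsign /face_vals.
by move: (\sum_(i | _) _) => S; field; rewrite gt_eqF.
Qed.

Lemma Qb_u T d b : Qb u (lface T d b) = Qface (cbox T) d b u.
Proof.
have w : is_wderiv (@Omega R) [:: d] u (Dw u [:: d]) by exact: Dw_wderiv.
by apply: (Qb_lface _ _ _ w); case: su.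
Qed.

Lemma dgrad_Qb T d : gr T (Qb u) d = avg (cbox T) (Dw u [:: d]).
Proof.
have pT := proper_cbox T; have l0 := len_gt0 d pT.
rewrite /dgrad /face_vals !Qb_u (Qface_diff pT (u_L2T su T) (u_wderivT su T d)).
by rewrite mulrC mulKf// gt_eqF.
Qed.

Lemma avg_fluxE T d : avg_flux T d = \sum_j A_on A T d j * avg (cbox T) (Dw u [:: j]).
Proof.
have pT := proper_cbox T.
have LD j : L2 (inbox (cbox T)) (Dw u [:: j]) by exact: Dw_L2T.
have -> : avg_flux T d = avg (cbox T) (fun p => \sum_j A_on A T d j * Dw u [:: j] p).
  apply: avg_eq => p Tp; rewrite flux_Dflux; apply: eq_bigr => j _.
  by rewrite (A_onE pA Tp).
rewrite avg_sum//; last by move=> j; apply: L2Z => //; exact: measurable_inbox.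
by apply: eq_bigr => j _; rewrite avgZ.
Qed.

Lemma wg_form_sum v w : wg_form A v w =
  \sum_T vol (cbox T) * \sum_i \sum_j A_on A T i j * gr T v j * gr T w i.
Proof.
rewrite wg_form_eq//; apply: eq_bigr => T _; congr (_ * _); apply: eq_bigr => i _.
rewrite !wgrad_eq !mxE mulr_suml; apply: eq_bigr => j _.
by rewrite !mxE.
Qed.

Lemma wg_form_Qb v : wg_form A (Qb u) v = \sum_T vol (cbox T) * \sum_d avg_flux T d * gr T v d.
Proof.
rewrite wg_form_sum; apply: eq_bigr => T _; congr (_ * _); apply: eq_bigr => i _.
by rewrite avg_fluxE mulr_suml; apply: eq_bigr => j _; rewrite dgrad_Qb.
Qed.

Lemma dgrad_lin T (v1 v2 v3 : Vb M) (c : R) d :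
  gr T (fun F => v1 F - v2 F + c * v3 F) d = gr T v1 d - gr T v2 d + c * gr T v3 d.
Proof. by rewrite /dgrad /face_vals; ring. Qed.

Lemma defect_lin T (v1 v2 v3 : Vb M) (c : R) d :
  df T (fun F => v1 F - v2 F + c * v3 F) d = df T v1 d - df T v2 d + c * df T v3 d.
Proof.
rewrite /defect /bmean; set s := (\sum_d _)^-1.
have -> : \sum_d0 area T d0 * dmean (face_vals T (fun F => v1 F - v2 F + c * v3 F)) d0 =
  \sum_d0 area T d0 * dmean (face_vals T v1) d0 - \sum_d0 area T d0 * dmean (face_vals T v2) d0
  + c * \sum_d0 area T d0 * dmean (face_vals T v3) d0.
  rewrite -sumrB mulr_sumr -big_split/=; apply: eq_bigr => e _.
  by rewrite /dmean /face_vals; ring.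
by rewrite [dmean (face_vals T _) d]/dmean /face_vals /dmean; ring.
Qed.

Lemma error_combination (x a1 a2 a3 y s1 s2 s3 kap c l a1' a3' s1' s3' : R) :
  x = a1 - a2 + c * a3 -> y = s1 - s2 + c * s3 -> a2 + kap * s2 = l ->
  a1 = a1' -> a3 = a3' -> s1 = s1' -> s3 = s3' ->
  x + kap * y = a1' - l + c * a3' + kap * (s1' + c * s3').
Proof. by move=> -> -> <- <- <- <- <-; ring. Qed.

(** The scheme tested with z is subtracted from the same form taken at Q_b u +
    c w. By [load_formula] and [wg_form_Qb] the averages of the flux cancel,
    and only consistency terms remain. *)
Lemma energy_identity (ub w z : Vb M) (kap c : R) :
  (forall F, z F = Qb u F - ub F + c * w F) ->
  (forall v, Vb0 v -> wg_form A ub v + kap * stab ub v = load f v) ->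
  Vb0 z ->
  wg_form A z z + kap * stab z z =
  \sum_T (vol (cbox T) * (\sum_d (df T z d * avg_dflux T d + \sum_(k | k != d) gr T z k * dflux_moment T d k)
      + c * \sum_i \sum_j A_on A T i j * gr T w j * gr T z i)
    + \sum_d 2 * kap * (area T d * ((df T (Qb u) d + c * df T w d) * df T z d))).
Proof.
move=> zE hub z0; have e := hub z z0.
have gz T d : gr T z d = gr T (Qb u) d - gr T ub d + c * gr T w d.
  by rewrite (funext zE) dgrad_lin.
have dz T d : df T z d = df T (Qb u) d - df T ub d + c * df T w d.
  by rewrite (funext zE) defect_lin.
rewrite (load_formula z0) in e.
have W : wg_form A z z = wg_form A (Qb u) z - wg_form A ub z + c * wg_form A w z.
  rewrite !wg_form_sum mulr_sumr -sumrB -big_split/=; apply: eq_bigr => T _.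
  rewrite mulrCA -mulrBr -mulrDr; congr (_ * _).
  rewrite mulr_sumr -sumrB -big_split/=; apply: eq_bigr => i _.
  rewrite mulr_sumr -sumrB -big_split/=; apply: eq_bigr => j _.
  by rewrite [in LHS](gz T j); ring.
have S : stab z z = stab (Qb u) z - stab ub z + c * stab w z.
  rewrite !stab_eq mulr_sumr -sumrB -big_split/=; apply: eq_bigr => T _.
  rewrite mulr_sumr -sumrB -big_split/=; apply: eq_bigr => i _.
  by rewrite (dz T i); ring.
refine (etrans (error_combination W S e (wg_form_Qb z) (wg_form_sum w z)
  (stab_eq (Qb u) z) (stab_eq w z)) _).
rewrite !mulr_sumr -sumrB -!big_split/= mulr_sumr -big_split/=.
apply: eq_bigr => T _.
have i1 : \sum_d (df T z d * avg_dflux T d + \sum_(k | k != d) gr T z k * dflux_moment T d k) =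
  \sum_d avg_flux T d * gr T z d - \sum_d (gr T z d * avg_flux T d - df T z d * avg_dflux T d
    - \sum_(k | k != d) gr T z k * dflux_moment T d k).
  by rewrite -sumrB; apply: eq_bigr => d _; ring.
have i2 : \sum_d 2 * kap * (area T d * ((df T (Qb u) d + c * df T w d) * df T z d)) =
  kap * (\sum_d 2 * (area T d * (df T (Qb u) d * df T z d)) +
   c * \sum_d 2 * (area T d * (df T w d * df T z d))).
  by rewrite mulr_sumr -big_split/= mulr_sumr; apply: eq_bigr => d _; ring.
rewrite i1 i2; move: (\sum_d avg_flux T d * _) (\sum_d (_ - _ - _)) (\sum_i \sum_j _) => X Y Z.
by move: (\sum_d 2 * _) (\sum_d 2 * _) => S1 S2; ring.
Qed.

End Energy.

(** * Estimates on one element *)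

Section Estimates.
Variables (R : realType) (M : mesh R).
Notation pt := (R * R * R)%type.
Variables (A : pt -> 'M[R]_3) (u : pt -> R) (K rho : R) (w : Vb M).
Hypotheses (cA : coefficient A) (pA : piecewise_constant M A) (su : sobolev 3 u)
  (K0 : 0 <= K) (AK : forall p i j, Omega p -> `|A p i j| <= K) (rho0 : 0 < rho)
  (cw : is_correction rho A u w).
Implicit Types (T : cell M) (v : Vb M) (p q : pt) (i j k d : 'I_3) (b : bool) (B : box R).

Notation area T d := (farea (cbox T) d).
Notation gr T v := (dgrad (cbox T) (face_vals T v)).
Notation df T v := (defect (cbox T) (face_vals T v)).
Notation h := (meshsize M).
Notation a_ T d := (len (cbox T) d).
Notation sorted3 t := (sorted (fun i1 i2 : 'I_3 => (i1 <= i2)%N) t).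

(** Root mean square of the third derivatives of u over the element. *)
Definition rms_D3 T : R := Num.sqrt (\sum_(t : 3.-tuple 'I_3 | sorted3 t)
  avg (cbox T) (fun p => wderiv (@Omega R) t u p ^+ 2)).

Lemma avg_sq_ge0 B f : proper B -> 0 <= avg B (fun p => f p ^+ 2).
Proof.
move=> pB; rewrite divr_ge0 ?(ltW (vol_gt0 pB))//.
by apply: Rintegral_ge0 => p _; exact: sqr_ge0.
Qed.

Lemma rms_D3_ge0 T : 0 <= rms_D3 T.
Proof. exact: sqrtr_ge0. Qed.

Lemma rms_D3_bound T s : size s = 3%N -> Num.sqrt (avg (cbox T) (fun p => Dw u s p ^+ 2)) <= rms_D3 T.
Proof.
move=> s3; have pT := proper_cbox T; apply: ler_wsqrtr.
have st : size (sort ordle s) == 3%N by rewrite size_sort s3.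
have so : sorted3 (Tuple st) by apply: sort_sorted => i j; exact: leq_total.
rewrite (bigD1 (Tuple st))//= lerDl sumr_ge0// => t _; exact: avg_sq_ge0.
Qed.

Lemma D3_bound T s (F : pt -> R) (m : R) : size s = 3%N -> continuous F -> 0 <= m ->
  (forall p, inbox (cbox T) p -> `|F p| <= m) ->
  `|avg (cbox T) (fun p => Dw u s p * F p)| <= m * rms_D3 T.
Proof.
move=> s3 cF m0 hF; have L : L2 (inbox (cbox T)) (Dw u s) by apply: Dw_L2T; rewrite ?s3.
apply: le_trans (avg_bound (proper_cbox T) L cF m0 hF) _.
by rewrite ler_wpM2l// rms_D3_bound.
Qed.

Lemma normM_le (x y a b : R) : `|x| <= a -> `|y| <= b -> `|x * y| <= a * b.
Proof. by move=> xa yb; rewrite normrM ler_pM. Qed.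

Lemma sum3_bound (P : pred 'I_3) (F : 'I_3 -> R) (m : R) : 0 <= m ->
  (forall k, P k -> `|F k| <= m) -> `|\sum_(k | P k) F k| <= 3 * m.
Proof.
move=> m0 hF; apply: le_trans (ler_norm_sum _ _ _) _.
apply: (@le_trans _ _ (\sum_(k < 3) m)).
  by rewrite big_mkcond/=; apply: ler_sum => k _; case: ifP => // /hF.
by rewrite sumr_const card_ord mulr_natl.
Qed.

Lemma A_on_bound T i j : `|A_on A T i j| <= K.
Proof.
apply: AK; apply: (inbox_Omega (subunit_cbox T)).
by apply: inbox_center; exact: proper_cbox.
Qed.

Lemma Dflux_bound T k s (F : pt -> R) (m : R) : size s = 2%N -> continuous F -> 0 <= m ->
  (forall p, inbox (cbox T) p -> `|F p| <= m) ->
  `|avg (cbox T) (fun p => Dflux A u k s p * F p)| <= 3 * (K * (m * rms_D3 T)).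
Proof.
move=> s2 cF m0 hF; have pT := proper_cbox T.
have L j : L2 (inbox (cbox T)) (fun p => Dw u (j :: s) p * F p).
  by apply: L2_smoothM => //; apply: Dw_L2T; rewrite //= s2.
have -> : avg (cbox T) (fun p => Dflux A u k s p * F p) =
   \sum_j A_on A T k j * avg (cbox T) (fun p => Dw u (j :: s) p * F p).
  transitivity (avg (cbox T) (fun p => \sum_j A_on A T k j * (Dw u (j :: s) p * F p))).
    apply: avg_eq => p Tp; rewrite /Dflux mulr_suml; apply: eq_bigr => j _.
    by rewrite (A_onE pA Tp) mulrA.
  rewrite avg_sum//; last by move=> j; apply: L2Z => //; exact: measurable_inbox.
  by apply: eq_bigr => j _; rewrite avgZ.
apply: sum3_bound; first by rewrite !mulr_ge0// rms_D3_ge0.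
move=> j _; apply: normM_le; first exact: A_on_bound.
by apply: D3_bound => //=; rewrite s2.
Qed.

Lemma continuous_lin d (c : R) : continuous (fun p : pt => co p d - c).
Proof. exact: (smooth_continuous (smooth_linear d c)). Qed.

Lemma avg_mul1 B f : avg B f = avg B (fun p => f p * 1).
Proof. by apply: avg_eq => p _; rewrite mulr1. Qed.

Lemma len_ge0 T d : 0 <= a_ T d.
Proof. exact/ltW/len_gt0/proper_cbox. Qed.

Lemma len_le_h T d : a_ T d <= h.
Proof.
apply: (@le_trans _ _ (diam (cbox T))); last by rewrite /meshsize; exact: le_bigmax.
rewrite -[leLHS]ger0_norm ?len_ge0// -sqrtr_sqr; apply: ler_wsqrtr.
by rewrite (bigD1 d)//= lerDl sumr_ge0// => i _; exact: sqr_ge0.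
Qed.

(** The weight x_k - mid_k has mean 0: integrating by parts yields a
    second-order weight. *)
Lemma dflux_moment_bound T d k : `|dflux_moment A u T d k| <= 3 / 2 * K * h ^+ 2 * rms_D3 T.
Proof.
have pT := proper_cbox T.
have w1 := Dflux_wderivT pA su T d (s := [:: d]) k.
rewrite /dflux_moment (avg_ibp_linear pT (dq_L2T cA su T d) (w1 isT)) normrN normrM ger0_norm//.
have cq : continuous (fun p : pt => quad (lo (cbox T) k) (hi (cbox T) k) (co p k)).
  exact: (smooth_continuous (smooth_coord k (smooth1_quad _ _))).
have := Dflux_bound d (s := [:: d; k]) (erefl 2%N) cq (sqr_ge0 (a_ T k)) (@quad_bound _ _ k).
rewrite [rcons _ _]/= => b1.
have b2 : a_ T k ^+ 2 <= h ^+ 2 by rewrite lerXn2r ?nnegrE ?len_ge0 ?len_le_h// (le_trans (len_ge0 T k) (len_le_h T k)).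
have b3 : K * (a_ T k ^+ 2 * rms_D3 T) <= K * (h ^+ 2 * rms_D3 T).
  by rewrite ler_wpM2l// ler_wpM2r ?rms_D3_ge0.
by move: b1 b3; move: (`|_|) (K * (_ * _)) => x y b1 b3; rewrite -mulrA; lra.
Qed.

Definition D3_moment T d k := avg (cbox T) (fun p => Dw u [:: k; k; d] p * (co p d - mid (cbox T) d)).
Definition D2flux_moment T d k := avg (cbox T) (fun p => Dflux A u k [:: k; d] p * (co p d - mid (cbox T) d)).

(** Two integrations by parts, against [quad] and [cub]. *)
Lemma dmean_Qb T d : dmean (face_vals T (Qb u)) d = avg (cbox T) u +
  a_ T d ^+ 2 / 12 * avg (cbox T) (Dw u [:: d; d]) +
  avg (cbox T) (fun p => Dw u [:: d; d; d] p * cub (cbox T) d (co p d)).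
Proof.
have pT := proper_cbox T.
rewrite /dmean /face_vals !(Qb_u su) (Qface_mean pT (u_L2T su T) (u_wderivT su T d)).
have L1 : L2 (inbox (cbox T)) (Dw u [:: d]) by exact: Dw_L2T.
have L2_ : L2 (inbox (cbox T)) (Dw u [:: d; d]) by exact: Dw_L2T.
have w1 := Dw_wderivT su T (s := [:: d]) d isT.
have w2 := Dw_wderivT su T (s := [:: d; d]) d isT.
rewrite (avg_ibp_linear pT L1 w1) (avg_ibp_quad pT L2_ w2) /=.
by field.
Qed.

(** The mean of w over the two faces orthogonal to [d] ([dmean_w]), in terms
    of averages over the element. *)
Definition mean_w T d : R := 12^-1 * rho^-1 * h^-1 *
  (rho * h^-1 * (\sum_(k < 3 | k != d) a_ T k ^+ 2 * (avg (cbox T) (Dw u [:: k; k]) + D3_moment T d k))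
   - 6 * (\sum_(k < 3 | k != d) a_ T k * (avg_dflux A u T k + D2flux_moment T d k))).

(** The difference quotient of w along [d] ([dgrad_w]). *)
Definition slope_w T d : R := 12^-1 * rho^-1 * h^-1 *
  (rho * h^-1 * (\sum_(k < 3 | k != d) a_ T k ^+ 2 * avg (cbox T) (Dw u [:: k; k; d]))
   - 6 * (\sum_(k < 3 | k != d) a_ T k * avg (cbox T) (Dflux A u k [:: k; d]))).

(** [Qface_avg] applied to each term of the definition of the correction. *)
Lemma w_face T d b : w (lface T d b) = mean_w T d + nsign R b * (a_ T d / 2) * slope_w T d.
Proof.
have pT := proper_cbox T; set e := nsign R b * (a_ T d / 2).
have split_sum (X Y c : 'I_3 -> R) : \sum_(k | k != d) c k * (X k + e * Y k) =
    \sum_(k | k != d) c k * X k + e * \sum_(k | k != d) c k * Y k.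
  by rewrite mulr_sumr -big_split; apply: eq_bigr => k _ /=; ring.
rewrite cw; transitivity (12^-1 * rho^-1 * h^-1 *
  (rho * h^-1 * (\sum_(k < 3 | k != d) a_ T k ^+ 2 *
      (avg (cbox T) (Dw u [:: k; k]) + D3_moment T d k + e * avg (cbox T) (Dw u [:: k; k; d])))
   - 6 * (\sum_(k < 3 | k != d) a_ T k *
      (avg_dflux A u T k + D2flux_moment T d k + e * avg (cbox T) (Dflux A u k [:: k; d]))))); last first.
  rewrite !split_sum /mean_w /slope_w.
  move: (\sum_(_ | _) _) (\sum_(_ | _) _) (\sum_(_ | _) _) (\sum_(_ | _) _) => S1 S2 S3 S4.
  by move: (rho^-1) (h^-1) => r hi; ring.
congr (_ * (_ * _ - _ * _)); apply: eq_bigr => k _; congr (_ * _).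
  have w2 := Dw_wderivT su T (s := [:: k; k]) d isT.
  rewrite -Dw2; exact: (Qface_avg b pT (Dw_L2T su T (s := [:: k; k]) isT) w2).
rewrite (Qface_flux pA su).
exact: (Qface_avg b pT (dq_L2T cA su T k) (Dflux_wderivT pA su T k (s := [:: k]) d isT)).
Qed.

Lemma dmean_w T d : dmean (face_vals T w) d = mean_w T d.
Proof. by rewrite /dmean /face_vals !w_face /nsign; field. Qed.

Lemma dgrad_w T d : gr T w d = slope_w T d.
Proof.
have l0 : a_ T d != 0 by rewrite gt_eqF// len_gt0//; exact: proper_cbox.
by rewrite /dgrad /face_vals !w_face /nsign; field.
Qed.

End Estimates.

Section Element.
Variables (R : realType) (M : mesh R).
Notation pt := (R * R * R)%type.
Variables (A : pt -> 'M[R]_3) (u : pt -> R) (K rho Cs : R) (w : Vb M).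
Hypotheses (cA : coefficient A) (pA : piecewise_constant M A) (su : sobolev 3 u)
  (K0 : 0 <= K) (AK : forall p i j, Omega p -> `|A p i j| <= K) (rho0 : 0 < rho)
  (cw : is_correction rho A u w).
Implicit Types (T : cell M) (v : Vb M) (p q : pt) (i j k d : 'I_3) (b : bool) (B : box R).

Notation area T d := (farea (cbox T) d).
Notation gr T v := (dgrad (cbox T) (face_vals T v)).
Notation df T v := (defect (cbox T) (face_vals T v)).
Notation h := (meshsize M).
Notation a_ T d := (len (cbox T) d).

Hypotheses (h0 : 0 < h) (hC : forall T d, h <= Cs * a_ T d).

Notation kap := (rho * h^-1).

Definition D3_cubic_moment T d := avg (cbox T) (fun p => Dw u [:: d; d; d] p * cub (cbox T) d (co p d)).

(** What the correction leaves of the first-order consistency error along the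
    axis [d]: moments with third derivatives of u. *)
Definition resid T d : R := - 2 * kap * D3_cubic_moment T d
  - kap / 6 * (\sum_(k < 3 | k != d) a_ T k ^+ 2 * D3_moment u T d k)
  + \sum_(k < 3 | k != d) a_ T k * D2flux_moment A u T d k.

(** By [dmean_Qb], Q_b u contributes a_d^2 avg(u_dd) / 12 along d, and
    [energy_identity] contributes a_d avg(d_d q_d). By [dmean_w], h^2 w
    contributes the same expressions, with the same factors, for the two other
    axes. So the coefficient of the defect along d is [resid] plus a sum over
    all three axes, and [sum_defect] removes the latter. *)
Lemma elt_cancel T v :
  vol (cbox T) * \sum_d df T v d * avg_dflux A u T d +
  \sum_d 2 * kap * (area T d * ((df T (Qb u) d + h ^+ 2 * df T w d) * df T v d)) =
  \sum_d area T d * df T v d * resid T d.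
Proof.
have pT := proper_cbox T.
(* The part of the coefficient of the defects that does not depend on the
   axis. *)
pose c : R := 2 * kap * (bmean (cbox T) (face_vals T (Qb u)) + h ^+ 2 * bmean (cbox T) (face_vals T w))
  - 2 * kap * avg (cbox T) u
  - kap / 6 * (\sum_k a_ T k ^+ 2 * avg (cbox T) (Dw u [:: k; k])) + \sum_k a_ T k * avg_dflux A u T k.
have z : \sum_d c * (area T d * df T v d) = 0 by rewrite -mulr_sumr sum_defect// mulr0.
transitivity (\sum_d area T d * df T v d * resid T d + \sum_d c * (area T d * df T v d)); last first.
  by rewrite z addr0.
rewrite mulr_sumr -!big_split/=; apply: eq_bigr => d _.
have E : a_ T d * avg_dflux A u T d + 2 * kap * (df T (Qb u) d + h ^+ 2 * df T w d) = resid T d + c.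
  rewrite {1 2}/defect (dmean_Qb su) (dmean_w cA pA su cw) /mean_w /resid /c -/(D3_cubic_moment T d).
  have e1 : \sum_k a_ T k ^+ 2 * avg (cbox T) (Dw u [:: k; k]) =
    a_ T d ^+ 2 * avg (cbox T) (Dw u [:: d; d]) +
    \sum_(k < 3 | k != d) a_ T k ^+ 2 * avg (cbox T) (Dw u [:: k; k]) by rewrite (bigD1 d).
  have e2 : \sum_k a_ T k * avg_dflux A u T k =
    a_ T d * avg_dflux A u T d + \sum_(k < 3 | k != d) a_ T k * avg_dflux A u T k by rewrite (bigD1 d).
  rewrite e1 e2.
  rewrite [X in 12^-1 * _ * _ * (_ * X - _)](_ : _ = \sum_(k < 3 | k != d) a_ T k ^+ 2 * avg (cbox T) (Dw u [:: k; k]) + \sum_(k < 3 | k != d) a_ T k ^+ 2 * D3_moment u T d k); last first.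
    by rewrite -big_split/=; apply: eq_bigr => k _; rewrite mulrDr.
  rewrite [X in 12^-1 * _ * _ * (_ - _ * X)](_ : _ = \sum_(k < 3 | k != d) a_ T k * avg_dflux A u T k + \sum_(k < 3 | k != d) a_ T k * D2flux_moment A u T d k); last first.
    by rewrite -big_split/=; apply: eq_bigr => k _; rewrite mulrDr.
  move: (\sum_(k < 3 | k != d) _) (\sum_(k < 3 | k != d) _) => S1 S2.
  move: (\sum_(k < 3 | k != d) _) (\sum_(k < 3 | k != d) _) => S3 S4.
  by field; rewrite ?gt_eqF.
have -> : area T d * df T v d * resid T d + c * (area T d * df T v d) =
  area T d * df T v d * (resid T d + c) by ring.
by rewrite -E (vol_farea (cbox T) d); ring.
Qed.

Lemma h_ge0 : 0 <= h. Proof. exact: ltW. Qed.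

Lemma resid_bound T d : `|resid T d| <= (5 / 2 * rho + 9 * K) * h ^+ 2 * rms_D3 u T.
Proof.
have pT := proper_cbox T; have N0 := rms_D3_ge0 u T; set N := rms_D3 u T in N0 *.
have ah k : 0 <= a_ T k <= h by rewrite len_ge0 len_le_h.
have b1 : `|D3_cubic_moment T d| <= h ^+ 3 * N.
  apply: le_trans (D3_bound su (s := [:: d; d; d]) erefl (smooth_continuous (smooth_coord d (smooth1_cub (cbox T) d)))
    _ (@cub_bound R (cbox T) d)) _; first by rewrite exprn_ge0// len_ge0.
  by rewrite ler_wpM2r// lerXn2r ?nnegrE ?len_ge0 ?h_ge0// len_le_h.
have lin1 : forall k, `|D3_moment u T d k| <= h * N.
  move=> k; apply: le_trans (D3_bound su (s := [:: k; k; d]) erefl (@continuous_lin R d (mid (cbox T) d))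
    (len_ge0 T d) (@linear_bound R (cbox T) d)) _.
  by rewrite ler_wpM2r// len_le_h.
have lin2 : forall k, `|D2flux_moment A u T d k| <= 3 * (K * (h * N)).
  move=> k; apply: le_trans (Dflux_bound pA su K0 AK k (s := [:: k; d]) erefl (@continuous_lin R d (mid (cbox T) d))
    (len_ge0 T d) (@linear_bound R (cbox T) d)) _.
  by rewrite ler_wpM2l// ler_wpM2l// ler_wpM2r// len_le_h.
have sq k : `|a_ T k ^+ 2| <= h ^+ 2.
  by rewrite ger0_norm ?sqr_ge0// lerXn2r ?nnegrE ?len_ge0 ?h_ge0// len_le_h.
have s1 : `|\sum_(k < 3 | k != d) a_ T k ^+ 2 * D3_moment u T d k| <= 3 * (h ^+ 2 * (h * N)).
  apply: sum3_bound; first by rewrite !mulr_ge0 ?sqr_ge0 ?h_ge0.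
  by move=> k _; apply: normM_le.
have s2 : `|\sum_(k < 3 | k != d) a_ T k * D2flux_moment A u T d k| <= 3 * (h * (3 * (K * (h * N)))).
  apply: sum3_bound; first by rewrite !mulr_ge0 ?h_ge0.
  move=> k _; apply: normM_le => //.
  by rewrite ger0_norm ?len_ge0// len_le_h.
have k0 : 0 < kap by rewrite divr_gt0.
have t1 : `|- 2 * kap * D3_cubic_moment T d| <= 2 * kap * (h ^+ 3 * N).
  apply: normM_le => //; rewrite mulNr normrN ger0_norm//.
  by rewrite mulr_ge0// ltW.
have t2 : `|kap / 6 * (\sum_(k < 3 | k != d) a_ T k ^+ 2 * D3_moment u T d k)| <= kap / 6 * (3 * (h ^+ 2 * (h * N))).
  by apply: normM_le => //; rewrite ger0_norm// divr_ge0// ltW.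
apply: le_trans (ler_normD _ _) _; apply: le_trans (lerD (ler_normB _ _) s2) _.
apply: le_trans (lerD (lerD t1 t2) (lexx _)) _.
rewrite le_eqVlt; apply/orP; left; apply/eqP.
by field; rewrite gt_eqF.
Qed.

Definition correction_const : R := (3 * rho + 54 * K) / (12 * rho).

Lemma correction_grad_bound T d : `|h ^+ 2 * gr T w d| <= correction_const * h ^+ 2 * rms_D3 u T.
Proof.
have pT := proper_cbox T; have N0 := rms_D3_ge0 u T; set N := rms_D3 u T in N0 *.
have c1 : continuous (fun _ : pt => (1 : R)) by exact: (smooth_continuous (smooth_cst 1)).
have n1 : forall p, inbox (cbox T) p -> `|(1 : R)| <= 1 by move=> p _; rewrite normr1.
have g1 k : `|avg (cbox T) (Dw u [:: k; k; d])| <= N.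
  rewrite avg_mul1; apply: le_trans (D3_bound su (s := [:: k; k; d]) erefl c1 ler01 n1) _.
  by rewrite mul1r.
have g2 k : `|avg (cbox T) (Dflux A u k [:: k; d])| <= 3 * (K * N).
  rewrite avg_mul1; apply: le_trans (Dflux_bound pA su K0 AK k (s := [:: k; d]) erefl c1 ler01 n1) _.
  by rewrite mul1r.
have sq k : `|a_ T k ^+ 2| <= h ^+ 2.
  by rewrite ger0_norm ?sqr_ge0// lerXn2r ?nnegrE ?len_ge0 ?h_ge0// len_le_h.
have s1 : `|\sum_(k < 3 | k != d) a_ T k ^+ 2 * avg (cbox T) (Dw u [:: k; k; d])| <= 3 * (h ^+ 2 * N).
  apply: sum3_bound; first by rewrite !mulr_ge0 ?sqr_ge0 ?h_ge0.
  by move=> k _; apply: normM_le.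
have s2 : `|\sum_(k < 3 | k != d) a_ T k * avg (cbox T) (Dflux A u k [:: k; d])| <= 3 * (h * (3 * (K * N))).
  apply: sum3_bound; first by rewrite !mulr_ge0 ?h_ge0.
  move=> k _; apply: normM_le => //.
  by rewrite ger0_norm ?len_ge0// len_le_h.
rewrite (dgrad_w cA pA su cw) /slope_w mulrA.
have -> : correction_const * h ^+ 2 * N = h ^+ 2 * (12^-1 * rho^-1 * h^-1) *
   (kap * (3 * (h ^+ 2 * N)) + 6 * (3 * (h * (3 * (K * N))))).
  by rewrite /correction_const; field; rewrite !gt_eqF.
apply: normM_le.
  by rewrite ger0_norm// !mulr_ge0 ?sqr_ge0 ?invr_ge0 ?h_ge0// ltW.
apply: le_trans (ler_normB _ _) _; apply: lerD; apply: normM_le => //.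
  by rewrite ger0_norm// divr_ge0 ?h_ge0// ltW.
by rewrite ger0_norm.
Qed.

Definition tangential_const : R := 9 / 2 * K + 3 * (K * correction_const).
Definition resid_const : R := 5 / 2 * rho + 9 * K.
(** The constants are spelled out because they must depend neither on the mesh
    nor on u: [lam] is an ellipticity constant, [K] bounds the coefficients
    and [Cs] compares h with the edge lengths. *)
Definition energy_const (lam : R) : R := 3 * (Cs * resid_const ^+ 2) / (4 * rho) + 3 * tangential_const ^+ 2 / (2 * lam).

Lemma correction_const_ge0 : 0 <= correction_const.
Proof. by rewrite /correction_const divr_ge0 ?addr_ge0 ?mulr_ge0// ltW. Qed.

(** After [elt_cancel], the defects of v are paired with [resid] and its
    gradient with terms of size h^2; Young's inequality leaves half of the
    energy of v on the right-hand side. *)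
Lemma elt_bound T v (lam : R) : 0 < lam ->
  vol (cbox T) * (\sum_d (df T v d * avg_dflux A u T d + \sum_(k | k != d) gr T v k * dflux_moment A u T d k)
      + h ^+ 2 * \sum_i \sum_j A_on A T i j * gr T w j * gr T v i)
    + \sum_d 2 * kap * (area T d * ((df T (Qb u) d + h ^+ 2 * df T w d) * df T v d)) <=
  lam / 2 * (vol (cbox T) * \sum_k gr T v k ^+ 2) +
  kap * \sum_d area T d * df T v d ^+ 2 + energy_const lam * (h ^+ 4 * (vol (cbox T) * rms_D3 u T ^+ 2)).
Proof.
move=> lam0; have pT := proper_cbox T; have v0 := vol_gt0 pT.
have N0 := rms_D3_ge0 u T; set N := rms_D3 u T in N0 *.
pose Y k := \sum_(d | d != k) dflux_moment A u T d k + \sum_j A_on A T k j * (h ^+ 2 * gr T w j).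
have swap : \sum_d \sum_(k | k != d) gr T v k * dflux_moment A u T d k =
    \sum_k gr T v k * \sum_(d | d != k) dflux_moment A u T d k.
  under eq_bigr do rewrite big_mkcond/=; rewrite exchange_big/=; apply: eq_bigr => k _.
  rewrite mulr_sumr [RHS]big_mkcond/=; apply: eq_bigr => d _.
  by rewrite eq_sym.
have E : vol (cbox T) * (\sum_d (df T v d * avg_dflux A u T d + \sum_(k | k != d) gr T v k * dflux_moment A u T d k)
      + h ^+ 2 * \sum_i \sum_j A_on A T i j * gr T w j * gr T v i)
    + \sum_d 2 * kap * (area T d * ((df T (Qb u) d + h ^+ 2 * df T w d) * df T v d)) =
   \sum_d area T d * df T v d * resid T d + vol (cbox T) * \sum_k gr T v k * Y k.
  rewrite -elt_cancel big_split/= swap.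
  have -> : \sum_k gr T v k * Y k = \sum_k gr T v k * \sum_(d | d != k) dflux_moment A u T d k +
     h ^+ 2 * \sum_i \sum_j A_on A T i j * gr T w j * gr T v i.
    rewrite mulr_sumr -big_split/=; apply: eq_bigr => k _; rewrite /Y mulrDr; congr (_ + _).
    by rewrite !mulr_sumr; apply: eq_bigr => j _; ring.
  by move: (\sum_d 2 * kap * _) => S; ring.
rewrite E.
have Yb k : `|Y k| <= tangential_const * h ^+ 2 * N.
  have t1 : `|\sum_(d | d != k) dflux_moment A u T d k| <= 3 * (3 / 2 * K * h ^+ 2 * N).
    apply: sum3_bound; first by apply: mulr_ge0 => //; apply: mulr_ge0; rewrite ?sqr_ge0//; apply: mulr_ge0; rewrite ?K0 ?divr_ge0.
    by move=> d _; exact: (dflux_moment_bound cA pA su K0 AK).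
  have t2 : `|\sum_j A_on A T k j * (h ^+ 2 * gr T w j)| <= 3 * (K * (correction_const * h ^+ 2 * N)).
    apply: sum3_bound; first by apply: mulr_ge0 => //; apply: mulr_ge0 => //; apply: mulr_ge0; rewrite ?sqr_ge0 ?correction_const_ge0.
    by move=> j _; apply: normM_le; [exact: (A_on_bound AK)|exact: correction_grad_bound].
  apply: le_trans (ler_normD _ _) _; apply: le_trans (lerD t1 t2) _.
  by rewrite le_eqVlt; apply/orP; left; apply/eqP; rewrite /tangential_const; field.
have sqle (x m : R) : `|x| <= m -> x ^+ 2 <= m ^+ 2.
  by move=> xm; rewrite -(real_normK (num_real x)) lerXn2r ?nnegrE// (le_trans _ xm).
have k0 : 0 < kap by rewrite divr_gt0.
(* Young's inequality with weight kap; the bound of h by Cs * a_d turns the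
   face area into a volume. *)
have P1b d : area T d * df T v d * resid T d <=
    kap * (area T d * df T v d ^+ 2) + Cs / (4 * rho) * (vol (cbox T) * (resid_const * h ^+ 2 * N) ^+ 2).
  have ar := farea_gt0 d pT.
  have y : df T v d * resid T d <= kap * df T v d ^+ 2 + resid T d ^+ 2 * (h / (4 * rho)).
    have := mulr_ge0 (ltW k0) (sqr_ge0 (df T v d - resid T d * (h / (2 * rho)))).
    have -> : kap * (df T v d - resid T d * (h / (2 * rho))) ^+ 2 =
       kap * df T v d ^+ 2 + resid T d ^+ 2 * (h / (4 * rho)) - df T v d * resid T d.
      by field; rewrite !gt_eqF.
    by rewrite subr_ge0.
  rewrite -mulrA; apply: le_trans (ler_wpM2l (ltW ar) y) _.
  rewrite mulrDr mulrCA lerD2l.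
  have r2 := sqle _ _ (resid_bound T d).
  have q1 : resid T d ^+ 2 * (h / (4 * rho)) <= (resid_const * h ^+ 2 * N) ^+ 2 * (Cs * a_ T d / (4 * rho)).
    apply: ler_pM; rewrite ?sqr_ge0//; first by rewrite divr_ge0 ?h_ge0// mulr_ge0// ltW.
    by rewrite ler_wpM2r ?hC// invr_ge0 mulr_ge0// ltW.
  apply: le_trans (ler_wpM2l (ltW ar) q1) _.
  by rewrite le_eqVlt; apply/orP; left; apply/eqP; rewrite (vol_farea (cbox T) d); ring.
(* Young's inequality with weight lam. *)
have P2b k : gr T v k * Y k <= lam / 2 * gr T v k ^+ 2 + (tangential_const * h ^+ 2 * N) ^+ 2 / (2 * lam).
  have := mulr_ge0 (ltW lam0) (sqr_ge0 (gr T v k - Y k / lam)).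
  have -> : lam * (gr T v k - Y k / lam) ^+ 2 =
     2 * (lam / 2 * gr T v k ^+ 2 + Y k ^+ 2 / (2 * lam) - gr T v k * Y k).
    by field; rewrite !gt_eqF.
  rewrite pmulr_rge0// subr_ge0 => y; apply: le_trans y _; rewrite lerD2l.
  by rewrite ler_wpM2r ?sqle// invr_ge0 mulr_ge0// ltW.
have S1 : \sum_d area T d * df T v d * resid T d <= kap * (\sum_d area T d * df T v d ^+ 2) +
    3 * (Cs / (4 * rho) * (vol (cbox T) * (resid_const * h ^+ 2 * N) ^+ 2)).
  apply: le_trans (ler_sum _ (fun d _ => P1b d)) _.
  by rewrite big_split/= -mulr_sumr sumr_const card_ord lerD2l -[leLHS]mulr_natl.
have S2 : \sum_k gr T v k * Y k <= lam / 2 * (\sum_k gr T v k ^+ 2) + 3 * ((tangential_const * h ^+ 2 * N) ^+ 2 / (2 * lam)).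
  apply: le_trans (ler_sum _ (fun k _ => P2b k)) _.
  by rewrite big_split/= -mulr_sumr sumr_const card_ord lerD2l -[leLHS]mulr_natl.
apply: le_trans (lerD S1 (ler_wpM2l (ltW v0) S2)) _.
rewrite le_eqVlt; apply/orP; left; apply/eqP; rewrite /energy_const.
move: (\sum_d _) (\sum_k _) => X1 X2.
by field; rewrite !gt_eqF.
Qed.

End Element.

(** * Shape regularity and ellipticity *)

Section Quasi.
Variables (R : realType) (M : mesh R) (sigma : R).
Hypothesis sr : shape_regular M sigma.
Implicit Types (T : cell M) (i j k d : 'I_3).
Notation a_ T d := (len (cbox T) d).

Lemma sigma_ge1 T : 1 <= sigma.
Proof.
have l0 := len_gt0 0 (proper_cbox T); have := sr T 0 0.
by rewrite -[leLHS]mul1r ler_pM2r.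
Qed.

(** On a tensor product mesh some element has the edge of T' along i and the
    edge of T along d. *)
Lemma len_cross T T' i d : i != d -> a_ T' i <= sigma * a_ T d.
Proof.
move=> id; pose T2 : cell M := [ffun k => if k == i then T' k else T k].
have := sr T2 i d.
by rewrite /len /= !ffunE eqxx eq_sym (negbTE id).
Qed.

(** For i = d, pass through another axis. *)
Lemma len_quasi T T' i d : a_ T' i <= sigma ^+ 2 * a_ T d.
Proof.
have s1 := sigma_ge1 T; have l0 := len_gt0 d (proper_cbox T).
have s0 : 0 <= sigma by rewrite (le_trans ler01 s1).
have [->|id] := eqVneq i d; last first.
  apply: le_trans (len_cross T T' id) _; rewrite ler_pM2r//.
  by rewrite expr2 -[leLHS]mul1r ler_wpM2r.
pose j := lift d (ord0 : 'I_2); have jd : j != d by rewrite eq_sym neq_lift.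
apply: le_trans (sr T' d j) _; rewrite expr2 -mulrA ler_wpM2l//.
exact: len_cross.
Qed.

Lemma meshsize_quasi T d : meshsize M <= 2 * sigma ^+ 2 * a_ T d.
Proof.
have l0 := len_gt0 d (proper_cbox T).
have m0 : 0 <= 2 * sigma ^+ 2 * a_ T d.
  by apply: mulr_ge0; rewrite ?(ltW l0)//; apply: mulr_ge0; rewrite ?sqr_ge0.
apply: bigmax_le => // T' _; rewrite /diam -(ger0_norm m0) -sqrtr_sqr; apply: ler_wsqrtr.
apply: (@le_trans _ _ (\sum_(i < 3) (sigma ^+ 2 * a_ T d) ^+ 2)).
  apply: ler_sum => i _; rewrite lerXn2r ?nnegrE ?len_quasi//.
    exact/ltW/len_gt0/proper_cbox.
  by rewrite mulr_ge0 ?sqr_ge0// ltW.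
rewrite sumr_const card_ord -[leLHS]mulr_natl.
have -> : (2 * sigma ^+ 2 * a_ T d) ^+ 2 = 4 * (sigma ^+ 2 * a_ T d) ^+ 2 by ring.
by rewrite ler_wpM2r ?sqr_ge0// ler_nat.
Qed.

End Quasi.

Section Ellipticity.
Variable R : realType.
Notation pt := (R * R * R)%type.
Implicit Types (S : 'M[R]_3) (a b c : 'cV[R]_3).

Lemma dotC a b : dot a b = dot b a.
Proof. by apply: eq_bigr => i _; rewrite mulrC. Qed.

Lemma dot_lin a b c (t : R) : dot (a - t *: b) c = dot a c - t * dot b c.
Proof. by rewrite /dot mulr_sumr -sumrB; apply: eq_bigr => i _; rewrite !mxE; ring. Qed.

Lemma dot_tr S a b : dot (S *m a) b = dot (S^T *m b) a.
Proof.
rewrite /dot; under eq_bigr do rewrite mxE mulr_suml; rewrite exchange_big/=.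
apply: eq_bigr => j _; rewrite mxE mulr_suml; apply: eq_bigr => i _.
by rewrite mxE; ring.
Qed.

Lemma dot_ge0 a : 0 <= dot a a.
Proof. by apply: sumr_ge0 => i _; rewrite -expr2 sqr_ge0. Qed.

Lemma sq_le_dot a i : a i 0 ^+ 2 <= dot a a.
Proof.
rewrite /dot (bigD1 i)//= expr2 lerDl; apply: sumr_ge0 => j _.
by rewrite -expr2 sqr_ge0.
Qed.

Lemma dot_mx_bound S a : dot a (S *m a) <= (1 + \sum_i \sum_j `|S i j|) * dot a a.
Proof.
apply: (@le_trans _ _ ((\sum_i \sum_j `|S i j|) * dot a a)); last first.
  by rewrite ler_wpM2r ?dot_ge0// lerDr.
rewrite {1}/dot mulr_suml; apply: ler_sum => i _.
rewrite mxE mulr_sumr mulr_suml; apply: ler_sum => j _.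
apply: le_trans (ler_norm _) _; rewrite mulrCA normrM ler_wpM2l//.
rewrite normrM; have h1 := sq_le_dot a i; have h2 := sq_le_dot a j.
rewrite -(real_normK (num_real (a i 0))) in h1; rewrite -(real_normK (num_real (a j 0))) in h2.
by have := sqr_ge0 (`|a i 0| - `|a j 0|); nra.
Qed.

(** Cauchy-Schwarz for the form of S: (xi . xi)^2 <= (S xi . xi) (S^-1 xi .
    xi), and S^-1 is bounded. *)
Lemma spd_coercive S : S^T = S -> (forall xi : 'cV[R]_3, xi != 0 -> 0 < dot (S *m xi) xi) ->
  exists2 lam : R, 0 < lam & forall xi, lam * dot xi xi <= dot (S *m xi) xi.
Proof.
move=> sS pS.
have uS : S \in unitmx.
  rewrite unitmxE unitfE; apply/negP => /det0P[v v0 vS].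
  have tv0 : v^T != 0 by rewrite -(inj_eq (@trmx_inj _ _ _)) trmxK trmx0.
  have := pS _ tv0; rewrite -sS -trmx_mul vS trmx0 /dot big1 ?ltxx// => i _.
  by rewrite mxE mul0r.
pose k := 1 + \sum_i \sum_j `|invmx S i j|.
have k0 : 0 < k by rewrite ltr_pwDl// sumr_ge0// => i _; rewrite sumr_ge0.
exists k^-1; first by rewrite invr_gt0.
move=> xi; have [->|xi0] := eqVneq xi 0.
  by rewrite mulmx0 /dot !big1 ?mulr0// => i _; rewrite mxE mul0r.
pose eta := invmx S *m xi.
have Se : S *m eta = xi by rewrite mulmxA mulmxV// mul1mx.
set n := dot xi xi; set b := dot (S *m xi) xi.
have b0 : 0 < b by exact: pS.
have nonneg c : 0 <= dot (S *m c) c.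
  have [->|c0] := eqVneq c 0; last exact/ltW/pS.
  by rewrite mulmx0 /dot big1// => i _; rewrite mxE mul0r.
have ke : dot (S *m eta) eta <= k * n by rewrite Se; exact: dot_mx_bound.
(* The form of S is smallest at this point of the line through eta directed by
   xi. *)
have := nonneg (eta - (n / b) *: xi).
have -> : dot (S *m (eta - (n / b) *: xi)) (eta - (n / b) *: xi) = dot (S *m eta) eta - n ^+ 2 / b.
  rewrite mulmxBr -scalemxAr dot_lin !(dotC _ (eta - _)) !dot_lin Se.
  rewrite (dotC eta (S *m xi)) (dot_tr S xi eta) sS Se -/n (dotC eta xi) (dotC xi (S *m xi)) -/b.
  by field; rewrite gt_eqF.
rewrite subr_ge0 => h.
have n0 : 0 <= n by exact: dot_ge0.
have h2 : n ^+ 2 / b <= k * n by exact: le_trans h ke.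
rewrite mulrC ler_pdivrMr// mulrC.
have [n00|nn] := eqVneq n 0; first by rewrite n00 mulr_ge0 ?(ltW k0) ?(ltW b0).
have np : 0 < n by rewrite lt_def nn.
rewrite ler_pdivrMr// in h2; rewrite -(ler_pM2l np).
by move: h2; rewrite expr2; have -> : k * n * b = n * (k * b) by ring.
Qed.

End Ellipticity.

Section Uniform.
Variable R : realType.
Notation pt := (R * R * R)%type.

(** Take the interval of the partition that ends at the first node beyond a.
    *)
Lemma interval_meets_cell (M : mesh R) (i : 'I_3) (a b : R) : 0 <= a -> a < b -> b <= 1 ->
  exists (k : 'I_(ncell M i)) (x : R), (a < x < b) /\ (node M i k < x < node M i k.+1).
Proof.
move=> a0 ab b1.
have ex : exists k, a < node M i k.+1.
  exists (ncell M i).-1; rewrite prednK ?ncell_gt0// node_last.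
  exact: lt_le_trans ab b1.
have ak := ex_minnP ex; case: ak => k ak kmin.
have kn : (k < ncell M i)%N.
  have : (k <= (ncell M i).-1)%N.
    by apply: kmin; rewrite prednK ?ncell_gt0// node_last (lt_le_trans ab b1).
  by rewrite -ltnS prednK ?ncell_gt0.
have na : node M i k <= a.
  case: k ak kmin kn => [|k] _ kmin _; first by rewrite node_first.
  by rewrite leNgt; apply/negP => /kmin; rewrite ltnn.
have m1 : Num.min b (node M i k.+1) <= b by rewrite ge_min lexx.
have m2 : Num.min b (node M i k.+1) <= node M i k.+1 by rewrite ge_min lexx orbT.
have m3 : a < Num.min b (node M i k.+1) by rewrite lt_min ab ak.
exists (Ordinal kn), ((a + Num.min b (node M i k.+1)) / 2) => /=.
move: (Num.min _ _) m1 m2 m3 => m m1 m2 m3.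
by split; apply/andP; split; lra.
Qed.

Lemma cells_meet (M M0 : mesh R) (T : cell M) :
  exists (T0 : cell M0) (p : pt), inbox (cbox T) p /\ inbox (cbox T0) p.
Proof.
have pT := proper_cbox T; have sT := subunit_cbox T.
have h i : exists kx : 'I_(ncell M0 i) * R,
    (lo (cbox T) i < kx.2 < hi (cbox T) i) /\ (node M0 i kx.1 < kx.2 < node M0 i kx.1.+1).
  have [l0 l1] := sT i; have [k [x hx]] := interval_meets_cell M0 i l0 (pT i) l1.
  by exists (k, x).
pose kx i := sval (cid (h i)).
have hk i := svalP (cid (h i)).
exists [ffun i => (kx i).1], (mkpt (fun i => (kx i).2)).
split=> i; rewrite co_mkpt; first by have [] := hk i.
by rewrite /= ffunE; have [] := hk i.
Qed.

(** The values of A on the elements of the mesh M0 are finitely many, and each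
    of them has an ellipticity constant; every element of another mesh on
    which A is piecewise constant meets an element of M0. *)
Lemma uniform_ellipticity (A : pt -> 'M[R]_3) (M0 : mesh R) : coefficient A ->
  piecewise_constant M0 A -> exists2 lam : R, 0 < lam &
  forall (M : mesh R) (T : cell M) (xi : 'cV[R]_3), piecewise_constant M A ->
    lam * dot xi xi <= dot (A_on A T *m xi) xi.
Proof.
move=> [mA bA symA posA] pA0.
have h (T0 : cell M0) : exists lam : R, 0 < lam /\ forall xi : 'cV[R]_3,
    lam * dot xi xi <= dot (A_on A T0 *m xi) xi.
  have c0 : Omega (center (cbox T0)).
    apply: (inbox_Omega (subunit_cbox T0)); apply: inbox_center; exact: proper_cbox.
  have [lam l0 hl] := spd_coercive (symA _ c0) (fun xi => posA _ xi c0).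
  by exists lam.
pose lam T0 := sval (cid (h T0)); have hlam T0 := svalP (cid (h T0)).
exists (\big[Num.min/1]_(T0 : cell M0) lam T0).
  by apply: lt_bigmin => // T0 _; have [] := hlam T0.
move=> M T xi pA; have [T0 [p [Tp T0p]]] := cells_meet M0 T.
have -> : A_on A T = A_on A T0 by rewrite -(A_onE pA Tp) (A_onE pA0 T0p).
apply: le_trans (proj2 (hlam T0) xi); rewrite ler_wpM2r ?dot_ge0//.
exact: bigmin_le.
Qed.

Lemma cells_disjoint (M : mesh R) (T T' : cell M) p :
  inbox (cbox T) p -> inbox (cbox T') p -> T = T'.
Proof.
move=> hT hT'; apply/ffunP => i; apply: val_inj; apply/eqP.
have aux (T1 T2 : cell M) : inbox (cbox T1) p -> inbox (cbox T2) p -> ~~ (T1 i < T2 i)%N.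
  move=> h1 h2; apply/negP => lt12; have /andP[_ /= a] := h1 i; have /andP[/= b _] := h2 i.
  have := node_mono lt12 (ltnW (ltn_ord (T2 i))).
  by rewrite leNgt (lt_trans b a).
by rewrite eqn_leq; apply/andP; split; rewrite leqNgt; exact: aux.
Qed.

Lemma sum_cells_le (M : mesh R) (F : pt -> R) : (forall p, 0 <= F p) ->
  (leb3 R).-integrable (@Omega R) (EFin \o F) ->
  \sum_(T : cell M) \int[leb3 R]_(p in inbox (cbox T)) F p <= \int[leb3 R]_(p in @Omega R) F p.
Proof.
move=> F0 Fi; have measurable_Omega := @measurable_inbox R (cube R).
pose D := \big[setU/set0]_(T <- index_enum (cell M)) inbox (cbox T) : set pt.
have mT (T : cell M) : measurable (inbox (cbox T) : set pt) by exact: measurable_inbox.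
have mD : measurable D by apply: bigsetU_measurable.
have sub : D `<=` @Omega R.
  rewrite /D -bigcup_seq => p [T _]; apply: inbox_Omega; exact: subunit_cbox.
have iT (T : cell M) := integrableS (mu := leb3 R) measurable_Omega (mT T) (inbox_Omega (subunit_cbox T)) Fi.
have iD := integrableS (mu := leb3 R) measurable_Omega mD sub Fi.
rewrite -lee_fin -sumEFin.
have -> : \sum_(T : cell M) (\int[leb3 R]_(p in inbox (cbox T)) F p)%:E =
   (\int[leb3 R]_(p in D) (F p)%:E)%E.
  rewrite (integral_bigsetU_EFin (leb3 R))//; last 3 first.
  - exact: index_enum_uniq.
  - by apply/trivIsetP => T1 T2 _ _ /eqP ne; rewrite -subset0 => p [h1 h2]; apply: ne; exact: cells_disjoint h1 h2.
  - exact: (measurable_int _ iD).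
  by apply: eq_bigr => T _; rewrite fineK//; exact: (integrable_fin_num (mu := leb3 R) (mT T) (iT T)).
rewrite fineK; last exact: (integrable_fin_num (mu := leb3 R) measurable_Omega Fi).
apply: (ge0_subset_integral (leb3 R)) => //.
- exact: (measurable_int _ Fi).
- by move=> p _; rewrite lee_fin.
Qed.

Lemma sum_rms_D3_le (M : mesh R) (u : pt -> R) : sobolev 3 u ->
  \sum_(T : cell M) vol (cbox T) * rms_D3 u T ^+ 2 <= sobolev_norm 3 u ^+ 2.
Proof.
move=> su; have nn (P : pred (3.-tuple 'I_3)) (T : cell M) :
    0 <= \sum_(t | P t) avg (cbox T) (fun p => wderiv (@Omega R) t u p ^+ 2).
  by apply: sumr_ge0 => t _; apply: avg_sq_ge0; exact: proper_cbox.
have nnO n (P : pred (n.-tuple 'I_3)) :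
    0 <= \sum_(t | P t) \int[leb3 R]_(p in @Omega R) (wderiv (@Omega R) t u p ^+ 2).
  by apply: sumr_ge0 => t _; apply: Rintegral_ge0 => p _; exact: sqr_ge0.
rewrite /sobolev_norm sqr_sqrtr; last by apply: sumr_ge0 => j _; exact: nnO.
rewrite big_ord_recr/= -[leLHS]add0r; apply: lerD; first by apply: sumr_ge0 => j _; exact: nnO.
under eq_bigr do rewrite sqr_sqrtr ?nn// mulr_sumr.
rewrite exchange_big/=; apply: ler_sum => t st.
rewrite (eq_bigr (fun T : cell M => \int[leb3 R]_(p in inbox (cbox T)) (wderiv (@Omega R) t u p ^+ 2))); last first.
  by move=> T _; rewrite int_avg//; exact: proper_cbox.
apply: sum_cells_le => [p|]; first exact: sqr_ge0.
have sz : (size t <= 3)%N by rewrite size_tuple.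
exact: (xgetPex (fun=> 0) (su.2 t sz)).1.2.
Qed.

End Uniform.

(** * The error estimate *)

Section Final.
Variables (R : realType) (M : mesh R).
Notation pt := (R * R * R)%type.

Lemma some_cell : cell M.
Proof. exact: [ffun i => Ordinal (ncell_gt0 M i)]. Qed.

Lemma meshsize_gt0 : 0 < meshsize M.
Proof.
have T := some_cell; apply: (@lt_le_trans _ _ (len (cbox T) 0)); last exact: len_le_h.
exact/len_gt0/proper_cbox.
Qed.

(** The data of the scheme on the boundary contain h^2 w, and the face
    averages of g are those of the trace of u ([boundary_trace]). *)
Lemma error_boundary (A : pt -> 'M[R]_3) (u f g : pt -> R) (rho : R) (w ub : Vb M) :
  sobolev 3 u -> dirichlet_solution A u f g -> is_wg_solution rho A f g w ub ->
  Vb0 (fun F => (Qb u F - ub F) + meshsize M ^+ 2 * w F).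
Proof.
move=> su hd [_ hb] F bF; have [T [b e]] := face_exists F.
set d := tag F in e; rewrite -{}e in bF *.
have pT := proper_cbox T; have sT := subunit_cbox T.
have wu : is_wderiv (@Omega R) [:: d] u (Dw u [:: d]) by exact: Dw_wderiv.
rewrite (hb T d b bF) (Qb_u su) (Qface_trace_int b pT (u_L2T su T) (u_wderivT su T d)).
rewrite /fmean fint1// (boundary_trace pT sT (boundary_level bF) su.1 wu (hd.2 d b)).
by ring.
Qed.

Lemma dot_self (T : cell M) (v : Vb M) :
  dot (wgrad T v) (wgrad T v) = \sum_k dgrad (cbox T) (face_vals T v) k ^+ 2.
Proof. by apply: eq_bigr => k _; rewrite wgrad_eq mxE expr2. Qed.

Lemma absorb (lam k C N P W S X : R) :
  lam * W <= X -> X + k * (2 * S) <= lam / 2 * W + k * S + P -> P <= C * N ->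
  lam * W + k * (2 * S) <= 2 * C * N.
Proof.
move=> h1 h2 h3; have {}h2 : X + 2 * (k * S) <= (lam * W) / 2 + k * S + P by lra.
have -> : k * (2 * S) = 2 * (k * S) by ring.
by rewrite -(mulrA 2); lra.
Qed.

Lemma sqrt_split (lam C N W S : R) :
  0 < lam -> 0 <= C -> 0 <= N -> 0 <= W -> 0 <= S ->
  lam * W + S <= 2 * C * N ^+ 2 ->
  Num.sqrt W + Num.sqrt S <= (Num.sqrt (2 * C / lam) + Num.sqrt (2 * C)) * N.
Proof.
move=> lam0 C0 N0 W0 S0 le.
have lW0 : 0 <= lam * W by apply: mulr_ge0 => //; exact: ltW.
have NE : N = Num.sqrt (N ^+ 2) by rewrite sqrtr_sqr ger0_norm.
rewrite mulrDl; apply: lerD.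
  rewrite {1}NE -sqrtrM; last first.
    by apply: divr_ge0; [apply: mulr_ge0|exact: ltW].
  by apply: ler_wsqrtr; rewrite mulrAC ler_pdivlMr// mulrC; lra.
rewrite {1}NE -sqrtrM; last exact: mulr_ge0.
by apply: ler_wsqrtr; lra.
Qed.

Lemma energy_const_ge0 (rho sigma K lam : R) :
  0 < rho -> 0 < lam -> 0 <= energy_const K rho (2 * sigma ^+ 2) lam.
Proof.
move=> rho0 lam0.
have s0 : 0 <= 2 * sigma ^+ 2 by apply: mulr_ge0 => //; exact: sqr_ge0.
rewrite /energy_const; apply: addr_ge0; apply: divr_ge0.
- by apply: mulr_ge0 => //; apply: mulr_ge0 => //; exact: sqr_ge0.
- by apply: mulr_ge0 => //; exact: ltW.
- by apply: mulr_ge0 => //; exact: sqr_ge0.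
- by apply: mulr_ge0 => //; exact: ltW.
Qed.

Lemma stab_ge0 (v : Vb M) : 0 <= stab v v.
Proof.
rewrite stab_eq; apply: sumr_ge0 => T _; apply: sumr_ge0 => d _.
apply: mulr_ge0 => //; apply: mulr_ge0; last by rewrite -expr2; exact: sqr_ge0.
exact/ltW/farea_gt0/proper_cbox.
Qed.

Lemma energy_bound (A : pt -> 'M[R]_3) (u f g : pt -> R) (rho sigma K lam : R)
    (w ub e : Vb M) :
  0 < rho -> coefficient A -> (forall p i j, Omega p -> `|A p i j| <= K) -> 0 <= K ->
  0 < lam ->
  (forall (T : cell M) (xi : 'cV_3), lam * dot xi xi <= dot (A_on A T *m xi) xi) ->
  shape_regular M sigma -> piecewise_constant M A -> sobolev 3 u -> L2 (@Omega R) f ->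
  dirichlet_solution A u f g -> is_correction rho A u w ->
  is_wg_solution rho A f g w ub ->
  (forall F, e F = (Qb u F - ub F) + meshsize M ^+ 2 * w F) -> Vb0 e ->
  lam * (\sum_T vol (cbox T) * dot (wgrad T e) (wgrad T e)) +
    rho * (meshsize M)^-1 * stab e e <=
  2 * energy_const K rho (2 * sigma ^+ 2) lam * (meshsize M ^+ 2 * sobolev_norm 3 u) ^+ 2.
Proof.
move=> rho0 cA AK K0 lam0 ell sr pA su Lf hd cw [sol _] eE e0.
have h0 := meshsize_gt0.
have hC (T : cell M) d : meshsize M <= 2 * sigma ^+ 2 * len (cbox T) d.
  exact: meshsize_quasi.
have id1 := energy_identity cA pA su Lf hd eE sol e0.
have le1 (T : cell M) := elt_bound cA pA su K0 AK rho0 cw h0 hC T e lam0.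
have le2 := ler_sum (index_enum (cell M)) (fun T (_ : xpredT T) => le1 T).
have Cp0 := energy_const_ge0 sigma K rho0 lam0.
have nuE := sum_rms_D3_le M su.
have WE : \sum_T vol (cbox T) * dot (wgrad T e) (wgrad T e) =
    \sum_T vol (cbox T) * \sum_k dgrad (cbox T) (face_vals T e) k ^+ 2.
  by apply: eq_bigr => T _; rewrite dot_self.
have elW : lam * (\sum_T vol (cbox T) * dot (wgrad T e) (wgrad T e)) <= wg_form A e e.
  rewrite (wg_form_eq _ _ pA) mulr_sumr; apply: ler_sum => T _.
  rewrite mulrCA; apply: ler_wpM2l; first exact/ltW/vol_gt0/proper_cbox.
  exact: ell.
have stE : stab e e =
    2 * \sum_(T : cell M) \sum_d farea (cbox T) d * defect (cbox T) (face_vals T e) d ^+ 2.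
  rewrite stab_eq mulr_sumr; apply: eq_bigr => T _.
  by rewrite mulr_sumr; apply: eq_bigr => d _; rewrite -expr2.
move: le2; rewrite !big_split /= -!mulr_sumr.
move: id1; rewrite !big_split /=.
move: elW; rewrite {}stE -{}WE.
move=> elW <- le2.
have le3 : energy_const K rho (2 * sigma ^+ 2) lam *
    (meshsize M ^+ 4 * \sum_(T : cell M) vol (cbox T) * rms_D3 u T ^+ 2) <=
    energy_const K rho (2 * sigma ^+ 2) lam * (meshsize M ^+ 2 * sobolev_norm 3 u) ^+ 2.
  apply: (ler_wpM2l Cp0); rewrite exprMn -exprM.
  by apply: ler_wpM2l nuE; apply: exprn_ge0; exact: ltW.
exact: absorb elW le2 le3.
Qed.

Lemma error_bound (A : pt -> 'M[R]_3) (u f g : pt -> R) (rho sigma K lam : R)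
    (w ub e : Vb M) :
  0 < rho -> coefficient A -> (forall p i j, Omega p -> `|A p i j| <= K) -> 0 <= K ->
  0 < lam ->
  (forall (T : cell M) (xi : 'cV_3), lam * dot xi xi <= dot (A_on A T *m xi) xi) ->
  shape_regular M sigma -> piecewise_constant M A -> sobolev 3 u -> L2 (@Omega R) f ->
  dirichlet_solution A u f g -> is_correction rho A u w ->
  is_wg_solution rho A f g w ub ->
  (forall F, e F = (Qb u F - ub F) + meshsize M ^+ 2 * w F) -> Vb0 e ->
  wgrad_norm e + stab_norm rho e <=
  (Num.sqrt (2 * energy_const K rho (2 * sigma ^+ 2) lam / lam) +
   Num.sqrt (2 * energy_const K rho (2 * sigma ^+ 2) lam)) * meshsize M ^+ 2 * sobolev_norm 3 u.
Proof.
move=> rho0 cA AK K0 lam0 ell sr pA su Lf hd cw sol eE e0.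
have le := energy_bound rho0 cA AK K0 lam0 ell sr pA su Lf hd cw sol eE e0.
have Cp0 := energy_const_ge0 sigma K rho0 lam0.
rewrite /stab_norm wgrad_norm_eq -[leRHS]mulrA; apply: sqrt_split => //.
- by apply: mulr_ge0; [exact: sqr_ge0|exact: sqrtr_ge0].
- apply: sumr_ge0 => T _; apply: mulr_ge0; first exact/ltW/vol_gt0/proper_cbox.
  by rewrite dot_self; apply: sumr_ge0 => k _; exact: sqr_ge0.
- apply: mulr_ge0; last exact: stab_ge0.
  by apply: divr_ge0; apply: ltW => //; exact: meshsize_gt0.
Qed.

End Final.

Theorem theorem7p2 (R : realType) (rho sigma : R) (A : R * R * R -> 'M[R]_3)
    (rho_gt0 : 0 < rho) (A_coefficient : coefficient A) :
  exists C : R,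
    forall (M : mesh R) (u f g : R * R * R -> R) (w ub : Vb M),
      shape_regular M sigma ->
      piecewise_constant M A ->
      sobolev 3 u ->
      L2 (@Omega R) f ->
      dirichlet_solution A u f g ->
      is_correction rho A u w ->
      is_wg_solution rho A f g w ub ->
      let h := meshsize M in
      let e : Vb M := fun F => (Qb u F - ub F) + h ^+ 2 * w F in
      wgrad_norm e + stab_norm rho e <= C * h ^+ 2 * sobolev_norm 3 u.
Proof.
(* The ellipticity constant is taken from one mesh on which A is piecewise
   constant. *)
have [[M0 pA0]|nA] := pselect (exists M0 : mesh R, piecewise_constant M0 A); last first.
  by exists 0 => M u f g w ub _ pA; case: nA; exists M.
have [lam lam0 ell] := uniform_ellipticity A_coefficient pA0.
have [_ [K0 AK0] _ _] := A_coefficient.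
pose K := `|K0|; have AK p i j : Omega p -> `|A p i j| <= K.
  by move=> Op; apply: le_trans (AK0 p i j Op) (ler_norm _).
have K_ge0 : 0 <= K by exact: normr_ge0.
pose Cp := energy_const K rho (2 * sigma ^+ 2) lam.
exists (Num.sqrt (2 * Cp / lam) + Num.sqrt (2 * Cp)).
move=> M u f g w ub sr pA su Lf hd cw sol.
have Ve := error_boundary su hd sol.
exact: (error_bound rho_gt0 A_coefficient AK K_ge0 lam0
  (fun T xi => ell M T xi pA) sr pA su Lf hd cw sol (fun F => erefl) Ve).
Qed.
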